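(* For every input vector $(f_0,f_1,f_2,f_3)\in\mathbb{Z}^4$, the algorithm find_lattices described in the context enumerates (up to isomorphism) all interval-connected Eulerian lattices of length $5$ with $f$-vector $(f_0,f_1,f_2,f_3)$.
   Context: A finite graded lattice is Eulerian if any non-trivial interval has the same number of elements of odd rank and of even rank; it is interval-connected if the proper part of any interval of length at least $3$ is connected (as a poset). The length of a graded lattice is the rank of its maximal element, the minimal element having rank $0$. The $f$-vector of a length-$5$ lattice is $(f_0,f_1,f_2,f_3)$ with $f_i$ the number of elements of rank $i+1$. Elements of rank $1,2,3,4$ are called vertices, edges, ridges and facets, respectively; the graph of the lattice has its vertices and edges as vertices and edges. Algorithm find_lattices. Input: $(f_0,f_1,f_2,f_3)\in\mathbb{Z}^4$. (i) Enumerate (up to isomorphism) all $4$-connected graphs $G$ with $f_0$ vertices and $f_1$ edges. (ii) For every such $G$, find the list $\mathcal{F}_G=\{F_i\}$ of all induced subgraphs of $G$ that are planar and $3$-connected (potential facets). Each such $F_i$ is the graph of a $3$-polytope, and its faces (of dimension $2$) are the cycles bounding the regions of its essentially unique planar embedding. Let $\mathcal{R}_G=\{R_j\}$ be the list of all faces of the members of $\mathcal{F}_G$ (potential ridges). Write $F_i\supset R_j$ if $R_j$ is a face of $F_i$. (iii) For every $G$, construct the 0/1 integer program with variables $x_i\in\{0,1\}$ for the $F_i\in\mathcal{F}_G$ and $y_j\in\{0,1\}$ for the $R_j\in\mathcal{R}_G$, and constraints: - $\sum_i x_i=f_3$ and $\sum_j y_j=f_2$; - $2y_j-\sum_{F_i\supset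 R_j}x_i=0$ for all ridges $R_j$; - Euler relations for the intervals above vertices and edges: for every vertex $v$ of $G$, $\deg_G(v)-\sum_{R_j\ni v}y_j+\sum_{F_i\ni v}x_i=2$, and for every edge $e$ of $G$, $\sum_{R_j\supset e}y_j=\sum_{F_i\supset e}x_i$; - for every edge $e$ of $G$, the number of selected faces containing $e$ is greater than zero; - $x_i+x_j\le 1$ for every pair of distinct potential facets $F_i,F_j$ whose intersection is not proper, i.e. is not a common (possibly empty) face of both, so that they cannot appear simultaneously in a regular cellular $3$-manifold with the intersection property. (iv) Enumerate all feasible solutions of this integer program. A feasible solution determines the poset consisting of a minimal element, the vertices and edges of $G$, the selected ridges ($y_j=1$), the selected facets ($x_i=1$) and a maximal element, ordered by containment. (v) For every feasible solution, check whether this poset is an interval-connected Eulerian lattice of length $5$; if so, output it. *)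

(* Defs.v *)
From HB Require Import structures.
From mathcomp Require Import all_boot all_order all_algebra.
From mathcomp Require Import fingroup perm.

Set Implicit Arguments.
Unset Strict Implicit.
Unset Printing Implicit Defensive.

Import Order.TTheory GRing.Theory Num.Theory.

(* Used both for graphs and, with the comparability relation, for posets. *)
Definition connected_on (T : finType) (e : rel T) (A : {set T}) : bool :=
  [forall x in A, forall y in A,
     connect [rel u v | [&& u \in A, v \in A & e u v]] x y].

Section Posets.
Local Open Scope order_scope.
Context {d : Order.disp_t}.
Implicit Type P : finPOrderType d.

(* All predicates below are boolean, because the algorithm tests them; see
   [finLattice_is_lattice] for the link with MathComp's lattice structures. *)
Definition is_lattice P : bool :=
  [forall x : P, forall y : P,
     [exists j : P, [forall z : P, (j <= z) == (x <= z) && (y <= z)]] &&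
     [exists m : P, [forall z : P, (z <= m) == (z <= x) && (z <= y)]]].

Definition chain P (C : {set P}) : bool :=
  [forall x in C, forall y in C, x >=< y].

(* Length (number of elements minus one) of a longest chain with top x. *)
Definition rank P (x : P) : nat :=
  (\max_(C : {set P} | chain C && [forall y in C, y <= x]) #|C|).-1.

Definition covers P (x y : P) : bool :=
  (x < y) && [forall z : P, ~~ ((x < z) && (z < y))].

Definition graded P : bool :=
  [forall x : P, forall y : P, covers x y ==> (rank y == (rank x).+1)].

Definition poset_length P : nat := \max_(x : P) rank x.

Definition eulerian P : bool :=
  [forall x : P, forall y : P, (x < y) ==>
     (#|[set z : P | (x <= z <= y) && odd (rank z)]|
        == #|[set z : P | (x <= z <= y) && ~~ odd (rank z)]|)].

Definition interval_connected P : bool :=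
  [forall x : P, forall y : P, (x <= y) && (rank x + 3 <= rank y)%N ==>
     connected_on (fun u v : P => u >=< v) [set z : P | x < z < y]].

Definition ic_eulerian_lattice5 P : bool :=
  [&& is_lattice P, graded P, eulerian P, interval_connected P
    & poset_length P == 5].

Definition has_fvector P (f0 f1 f2 f3 : int) : Prop :=
  let f i : int := Posz #|[set z : P | rank z == i.+1]| in
  [/\ f 0 = f0, f 1 = f1, f 2 = f2 & f 3 = f3].

Lemma finLattice_is_lattice (L : finLatticeType d) : is_lattice L.
Proof.
apply/forallP => x; apply/forallP => y; apply/andP; split; apply/existsP.
  by exists (x `|` y); apply/forallP => z; rewrite leUx.
by exists (x `&` y); apply/forallP => z; rewrite lexI.
Qed.

End Posets.

Definition isomorphic d d' (P : finPOrderType d) (Q : finPOrderType d') : Prop :=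
  exists2 g : P -> Q, bijective g & {mono g : x y / (x <= y)%O}.

(* A graph with its vertices in T is a pair (vertex set, edge set), an edge being
   the set of its two end points; the cycles, faces and facets considered below
   are subgraphs, hence values of the same type. *)
Definition graph (T : finType) : Type := ({set T} * {set {set T}})%type.
HB.instance Definition _ (T : finType) := Finite.copy (graph T)
  ({set T} * {set {set T}})%type.

Section Graphs.
Context {T : finType}.
Implicit Types (G H K : graph T) (A : {set T}) (e : {set T}) (v : T).

Definition verts G : {set T} := G.1.
Definition edges G : {set {set T}} := G.2.

Definition simple_graph G : bool :=
  [forall e in edges G, (e \subset verts G) && (#|e| == 2)].

Definition adj G : rel T := fun u v => [set u; v] \in edges G.

Definition deg G v : nat := #|[set e in edges G | v \in e]|.

Definition subgraph H K : bool := (verts H \subset verts K) && (edges H \subset edges K).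

Definition induced G A : graph T := (A, [set e in edges G | e \subset A]).

Definition intersection H K : graph T := (verts H :&: verts K, edges H :&: edges K).

Definition empty_graph : graph T := (set0, set0).
Definition vertex_graph v : graph T := ([set v], set0).
Definition edge_graph e : graph T := (e, [set e]).

Definition graph_iso G H : bool :=
  [exists s : {perm T},
     (s @: verts G == verts H) && ([set s @: (e : {set T}) | e in edges G] == edges H)].

Definition k_connected (k : nat) G : bool :=
  (k < #|verts G|) &&
  [forall A : {set T}, (A \subset verts G) && (#|A| < k) ==>
     connected_on (adj G) (verts G :\: A)].

(* Embeddings in the sphere are given by rotation systems.  A dart is an edge
   with a direction; a rotation permutes cyclically the darts leaving each
   vertex; the regions are the orbits of [face_step]. *)
Definition darts G : {set T * T} := [set a | adj G a.1 a.2].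

Definition rotation G (r : {perm T * T}) : bool :=
  [forall a in darts G, porbit r a == [set b in darts G | b.1 == a.1]].

Definition face_step (r : {perm T * T}) (a : T * T) : T * T := r (a.2, a.1).

(* Euler's formula in this form characterises genus 0 for connected graphs with
   at least one edge; it is only used for 3-connected graphs. *)
Definition planar_embedding G (r : {perm T * T}) : bool :=
  rotation G r &&
  (#|verts G| + fcard (face_step r) (darts G) == #|edges G| + 2).

Definition planar G : bool := [exists r, planar_embedding G r].

Definition region_boundary (r : {perm T * T}) (a : T * T) : graph T :=
  ([set b.1 | b in orbit (face_step r) a],
   [set [set b.1; b.2] | b in orbit (face_step r) a]).

(* The 2-dimensional faces; as the planar embedding of a 3-connected graph is
   essentially unique, any planar embedding may be used. *)
Definition is_2face G H : bool :=
  [exists r, planar_embedding G r &&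
     [exists a in darts G, H == region_boundary r a]].

Definition is_face G H : bool :=
  [|| H == empty_graph,
      [exists v in verts G, H == vertex_graph v],
      [exists e in edges G, H == edge_graph e]
    | is_2face G H].

Definition potential_facets G : {set graph T} :=
  [set F | [exists A : {set T}, [&& A \subset verts G, F == induced G A,
                                    planar F & k_connected 3 F]]].

Definition potential_ridges G : {set graph T} :=
  [set R | [exists F in potential_facets G, is_2face F R]].

Definition proper_intersection F F' : bool :=
  is_face F (intersection F F') && is_face F' (intersection F F').

(* A 0/1 assignment (x, y) is given by its supports X and Y. *)
Definition feasible (f2 f3 : int) G (S : {set graph T} * {set graph T}) : bool :=
  let: (X, Y) := S in
  let FG := potential_facets G in
  let RG := potential_ridges G in
  let x (F : graph T) : int := ((F \in X)%:R)%R in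
  let y (R : graph T) : int := ((R \in Y)%:R)%R in
  [&& X \subset FG, Y \subset RG,
      (\sum_(F in FG) x F == f3)%R,
      (\sum_(R in RG) y R == f2)%R &
  [&& [forall R in RG,
         (2 * y R - \sum_(F in FG | is_2face F R) x F == 0)%R],
      [forall v in verts G,
         ((deg G v)%:R - \sum_(R in RG | v \in verts R) y R
            + \sum_(F in FG | v \in verts F) x F == 2)%R],
      [forall e in edges G,
         (\sum_(R in RG | e \in edges R) y R
            == \sum_(F in FG | e \in edges F) x F)%R],
      [forall e in edges G, (0 < \sum_(R in RG | e \in edges R) y R)%R] &
      [forall F in FG, forall F' in FG,
         (F != F') && ~~ proper_intersection F F' ==>
           (x F + x F' <= 1)%R]]].

End Graphs.

(* Subgraphs ordered by containment, with a maximal element [None] added. *)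
Definition cell (T : finType) : Type := option (graph T).
HB.instance Definition _ (T : finType) := Finite.copy (cell T)
  (option (graph T)).

Definition cell_le (T : finType) (a b : cell T) : bool :=
  match a, b with
  | _, None => true
  | None, Some _ => false
  | Some H, Some K => subgraph H K
  end.

Fact cell_le_refl (T : finType) : reflexive (@cell_le T).
Proof. by case=> //= H; rewrite /subgraph !subxx. Qed.

Fact cell_le_anti (T : finType) : antisymmetric (@cell_le T).
Proof.
case=> [[v e]|] [[v' e']|] //= /andP[/andP[/= h1 h2] /andP[/= h3 h4]].
by congr (Some (_, _)); apply/eqP; rewrite eqEsubset ?h1 ?h2.
Qed.

Fact cell_le_trans (T : finType) : transitive (@cell_le T).
Proof.
case=> [K|] [H|] [L|] //= /andP[h1 h2] /andP[h3 h4].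
by rewrite /subgraph (subset_trans h1 h3) (subset_trans h2 h4).
Qed.

Fact cell_display : Order.disp_t. Proof. exact: (Order.Disp tt tt). Qed.

HB.instance Definition _ (T : finType) :=
  Order.Le_isPOrder.Build cell_display (cell T)
    (@cell_le_refl T) (@cell_le_anti T) (@cell_le_trans T).

(* A graph G with the selected potential facets and potential ridges. *)
Definition solution (T : finType) : Type :=
  (graph T * ({set graph T} * {set graph T}))%type.
HB.instance Definition _ (T : finType) := Finite.copy (solution T)
  (graph T * ({set graph T} * {set graph T}))%type.

Definition is_cell (T : finType) (s : solution T) (a : cell T) : bool :=
  let: (G, (X, Y)) := s in
  if a is Some H then
    [|| H == empty_graph,
        [exists v in verts G, H == vertex_graph v],
        [exists e in edges G, H == edge_graph e],
        H \in Y
      | H \in X]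
  else true.

Definition solution_poset (T : finType) (s : solution T) : Type :=
  {a : cell T | is_cell s a}.
HB.instance Definition _ (T : finType) (s : solution T) :=
  SubFinite.on (solution_poset s).
HB.instance Definition _ (T : finType) (s : solution T) :=
  [SubChoice_isSubPOrder of solution_poset s by <: with cell_display].

Lemma solution_poset_leE (T : finType) (s : solution T) (a b : solution_poset s) :
  (a <= b)%O = cell_le (val a) (val b).
Proof. by []. Qed.

(* Since T has |f0| elements below, graphs in the list have vertex set T; for
   negative f0 there are none. *)
Definition input_graph (T : finType) (f0 f1 : int) (G : graph T) : bool :=
  [&& simple_graph G, Posz #|verts G| == f0, Posz #|edges G| == f1 & k_connected 4 G].

Definition graph_enumeration (f0 f1 : int) (gs : seq (graph 'I_(absz f0))) : Prop :=
  [/\ {in gs, forall G, input_graph f0 f1 G},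
      pairwise (fun G H => ~~ graph_iso G H) gs
    & forall G, input_graph f0 f1 G -> exists2 H, H \in gs & graph_iso G H].
Arguments graph_enumeration : clear implicits.

Lemma graph_enumeration_exists (f0 f1 : int) :
  exists gs, graph_enumeration f0 f1 gs.
Proof.
pose n := absz f0.
have refl (G : graph 'I_n) : graph_iso G G.
  apply/existsP; exists 1%g; rewrite (eq_imset _ (@perm1 _)) imset_id eqxx /=.
  rewrite -[eqbRHS]imset_id; apply/eqP/eq_imset => e.
  by rewrite (eq_imset _ (@perm1 _)) imset_id.
have sym (G H : graph 'I_n) : graph_iso G H -> graph_iso H G.
  case/existsP=> s /andP[/eqP hv /eqP he]; apply/existsP; exists s^-1%g.
  have K (A : {set 'I_n}) : s^-1%g @: (s @: A) = A.
    by rewrite -imset_comp (eq_imset _ (permK s)) imset_id.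
  rewrite -hv -he K eqxx /= -imset_comp; apply/eqP.
  by rewrite (eq_imset _ K) imset_id.
have trans (G H K : graph 'I_n) :
    graph_iso G H -> graph_iso H K -> graph_iso G K.
  case/existsP=> s /andP[/eqP hv /eqP he].
  case/existsP=> t /andP[/eqP hv' /eqP he'].
  have C (A : {set 'I_n}) : (s * t)%g @: A = t @: (s @: A).
    by rewrite -imset_comp; apply: eq_imset => x; rewrite permM.
  apply/existsP; exists (s * t)%g; rewrite C hv hv' eqxx -he' -he /=.
  by rewrite -imset_comp; apply/eqP/eq_imset => e; rewrite C.
pose canon (G : graph 'I_n) := odflt G [pick H | graph_iso G H && input_graph f0 f1 H].
have canonP G : input_graph f0 f1 G ->
    graph_iso G (canon G) && input_graph f0 f1 (canon G).
  by move=> hG; rewrite /canon; case: pickP => [H //|/(_ G)]; rewrite refl hG.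
have canon_eq G H : input_graph f0 f1 G -> graph_iso G H -> canon G = canon H.
  move=> hG gh; rewrite /canon.
  have -> : [pick K | graph_iso G K && input_graph f0 f1 K]
          = [pick K | graph_iso H K && input_graph f0 f1 K].
    apply: eq_pick => K; congr (_ && _); apply/idP/idP; last exact: trans.
    exact/trans/sym.
  by case: pickP => // /(_ G); rewrite sym // hG.
exists (enum [set canon G | G in [set G | input_graph f0 f1 G]]); split.
- by move=> G; rewrite mem_enum => /imsetP[H]; rewrite inE => /canonP/andP[_ ?] ->.
- have := enum_uniq [set canon G | G in [set G | input_graph f0 f1 G]].
  rewrite uniq_pairwise; set C := [set canon G | G in _].
  apply: (@sub_in_pairwise _ (mem C)); last by apply/allP => G; rewrite mem_enum.
  move=> _ _ /imsetP[G hG ->] /imsetP[H hH ->]; apply: contraNN => gh.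
  rewrite !inE in hG hH; case/andP: (canonP _ hG) => iG _.
  case/andP: (canonP _ hH) => iH _.
  by apply/eqP/canon_eq => //; apply: trans iG (trans _ _ _ gh (sym _ _ iH)).
- move=> G hG; exists (canon G); last by case/andP: (canonP _ hG).
  by rewrite mem_enum imset_f // inE.
Qed.

(* [find_lattices f0 f1 f2 f3 out]: [out] is the output of a run of the algorithm,
   whatever the representatives of the isomorphism classes of graphs. *)
Definition find_lattices (f0 f1 f2 f3 : int)
    (out : seq (solution 'I_(absz f0))) : Prop :=
  exists2 gs, graph_enumeration f0 f1 gs &
    out = [seq s <- [seq (G, xy) | G <- gs, xy <- enum (feasible f2 f3 G)]
             | ic_eulerian_lattice5 (solution_poset s)].
Arguments find_lattices : clear implicits.

Lemma find_lattices_total (f0 f1 f2 f3 : int) :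
  exists out, find_lattices f0 f1 f2 f3 out.
Proof. by have [gs ?] := graph_enumeration_exists f0 f1; eexists; exists gs. Qed.

(* Main.v *)
(* Soundness is a rank count: in a solution poset of length 5 the selected facets
   are forced into rank 4 and the selected ridges into rank 3.

   For completeness, let L be an interval-connected Eulerian lattice of length 5.
   Its graph is 4-connected and its facets have 3-connected graphs by an inductive
   form of Balinski's theorem for Eulerian lattices.  The order complex of the
   boundary of a facet has Euler characteristic 2, so over F_2 every function on
   its edges that vanishes on the links is a coboundary; hence the flags can be
   2-coloured, which orients the facet and gives a rotation system of genus 0.
   The same exactness, applied to an arbitrary genus 0 rotation system of a facet
   graph, shows that each ridge, being an induced cycle with connected complement,
   bounds a region (Whitney), and Euler's formula leaves no other regions.  The
   linear constraints are then the Euler relations of the intervals of L. *)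
Require Import Defs.
From mathcomp Require Import all_boot all_order all_algebra.
From mathcomp Require Import fingroup perm zify.

Set Implicit Arguments.
Unset Strict Implicit.
Unset Printing Implicit Defensive.

Import Order.TTheory GRing.Theory Num.Theory.

(** * Connectivity and homology over the field with two elements *)

(** No geometric realisation is available: a facet is only an interval of length 4 whose links are
    polygons. Linear algebra over F_2 takes the place of the classification of surfaces, and locally
    constant Boolean functions take the place of paths, orbits and components. The induction for
    Balinski's theorem passes from a deleted vertex to its link, where the other deleted vertices
    are felt only through their joins with it. This is why arbitrary elements, not only atoms, may
    be deleted. The 2-faces of a graph are defined through any planar embedding. An embedding built
    from the lattice therefore does not suffice, and the regions have to be identified in an unknown
    one. In the soundness part, containment bounds ranks only from below and the length bounds them
    from above, which leaves a facet the choice between ranks 3 and 4. Rank 3 is excluded because it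
    would leave only two edges at a vertex of a 3-connected graph. The list contains one graph per
    isomorphism class, so the labelling of the atoms stays free until the representative is
    known. *)

(* Connectedness is used throughout in the form: a Boolean function that agrees on
   adjacent elements is constant. *)
Lemma connected_onP (T : finType) (e : rel T) (A : {set T}) : symmetric e ->
  reflect (forall K : T -> bool,
             {in A &, forall u v, e u v -> K u = K v} ->
             {in A &, forall u v, K u = K v})
          (connected_on e A).
Proof.
move=> e_sym; apply: (iffP idP) => [conA K Kloc u v uA vA | constA].
  have /forall_inP/(_ u uA)/forall_inP/(_ v vA) := conA.
  apply: (@closed_connect _ _ K) => {u v uA vA} u v /= /and3P[uA vA euv].
  exact: Kloc.
apply/forall_inP => u uA; apply/forall_inP => v vA.
set r := [rel _ _ | _]; have r_sym : symmetric r.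
  by move=> x y /=; rewrite e_sym andbCA.
rewrite -(constA (connect r u) _ u v uA vA) // => x y xA yA exy.
by apply: same_connect_r; [exact: sym_connect_sym | apply: connect1; rewrite /= xA yA].
Qed.

Section ChainComplex.
Local Open Scope ring_scope.

(** The left kernel is contained in the line spanned by the all-ones row, so its dimension is at
    most one. *)
Lemma mxrank_const_ker (p m : nat) (A : 'M[bool]_(p, m)) :
  (forall x : 'rV_p, x *m A = 0 -> forall i j, x 0 i = x 0 j) ->
  (p <= (\rank A).+1)%N.
Proof.
move=> kerA; have : (kermx A <= (const_mx 1 : 'rV_p))%MS.
  apply/row_subP => i; set x := row i _.
  have xA : x *m A = 0 by apply/sub_kermxP; exact: row_sub.
  apply/submxP; exists (x 0 i)%:M; apply/rowP => j.
  by rewrite mul_scalar_mx scalemx_const mulr1 [RHS]mxE; exact: kerA.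
move/mxrankS; rewrite mxrank_ker => /leq_trans/(_ (rank_leq_row _)).
by rewrite leq_subLR addn1.
Qed.

Lemma enum_val_extend (T : finType) (A : {set T}) (x : 'I_#|A| -> bool) :
  exists h : T -> bool, forall i, h (enum_val i) = x i.
Proof.
exists (fun t => [exists i, (enum_val i == t) && x i]) => i.
apply/existsP/idP => [[j /andP[/eqP/enum_val_inj -> //]]|xi].
by exists i; rewrite eqxx.
Qed.

(* Over F_2 = bool, Euler characteristic 2 together with one-dimensional
   homology in the two extreme degrees leaves nothing in the middle degree. *)
Lemma chain_complex_exact (TF TE TV : finType)
    (F : {set TF}) (E : {set TE}) (V : {set TV})
    (dF : TF -> TE -> bool) (dE : TE -> TV -> bool) :
  {in F & V, forall f v, \sum_(e in E) dF f e * dE e v = 0} ->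
  (forall h : TF -> bool, {in E, forall e, \sum_(f in F) h f * dF f e = 0} ->
     {in F &, forall f g, h f = h g}) ->
  (forall h : TV -> bool, {in E, forall e, \sum_(v in V) dE e v * h v = 0} ->
     {in V &, forall v w, h v = h w}) ->
  (#|F| + #|V| = #|E| + 2)%N ->
  forall u : TE -> bool, {in V, forall v, \sum_(e in E) u e * dE e v = 0} ->
  exists w : TF -> bool, {in E, forall e, u e = \sum_(f in F) w f * dF f e}.
Proof.
move=> dd kerF kerV euler u du.
pose A : 'M[bool]_(#|F|, #|E|) := \matrix_(i, j) dF (enum_val i) (enum_val j).
pose B : 'M[bool]_(#|E|, #|V|) := \matrix_(i, j) dE (enum_val i) (enum_val j).
have AB0 : A *m B = 0.
  apply/matrixP => i j; rewrite !mxE -[RHS](dd _ _ (enum_valP i) (enum_valP j)).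
  by rewrite [RHS]big_enum_val; apply: eq_bigr => k _; rewrite !mxE.
have rA : (#|F| <= (\rank A).+1)%N.
  apply: mxrank_const_ker => x xA i j; have [h hE] := enum_val_extend (x 0).
  rewrite -!hE; apply: kerF (enum_valP i) (enum_valP j) => e eE.
  have /rowP/(_ (enum_rank_in eE e)) := xA; rewrite !mxE => eqe.
  rewrite -[RHS]eqe [LHS]big_enum_val; apply: eq_bigr => k _.
  by rewrite hE !mxE enum_rankK_in.
have rB : (#|V| <= (\rank B).+1)%N.
  rewrite -mxrank_tr; apply: mxrank_const_ker => x xB i j.
  have [h hE] := enum_val_extend (x 0).
  rewrite -!hE; apply: kerV (enum_valP i) (enum_valP j) => e eE.
  have /rowP/(_ (enum_rank_in eE e)) := xB; rewrite !mxE => eqe.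
  rewrite -[RHS]eqe [LHS]big_enum_val; apply: eq_bigr => k _.
  by rewrite hE !mxE enum_rankK_in // mulrC.
(* [A *m B = 0] bounds the sum of the ranks by [#|E|], while the two kernels bound it from below by
   [#|F| + #|V| - 2], the same number. Hence the row space of [A] is the whole kernel of [B]. *)
have rAB : (\rank A + \rank B = #|E|)%N.
  apply/eqP; rewrite eqn_leq mulmx0_rank_max //=.
  by move: euler rA rB; lia.
have AkB : (A <= kermx B)%MS by exact/sub_kermxP.
have kBA : (kermx B <= A)%MS.
  by rewrite -(geq_leqif (mxrank_leqif_sup AkB)) mxrank_ker leq_subLR addnC rAB.
have : ((\row_j u (enum_val j)) <= A)%MS.
  apply: submx_trans kBA; apply/sub_kermxP/rowP => j.
  rewrite !mxE -[RHS](du _ (enum_valP j)) [RHS]big_enum_val.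
  by apply: eq_bigr => k _; rewrite !mxE.
case/submxP => D uD; have [w wE] := enum_val_extend (D 0).
exists w => e eE; have /rowP/(_ (enum_rank_in eE e)) := uD.
rewrite !mxE enum_rankK_in // => ->; rewrite [RHS]big_enum_val.
by apply: eq_bigr => k _; rewrite !mxE enum_rankK_in // wE.
Qed.

End ChainComplex.

(** * Graded Eulerian lattices *)

Section Rank.
Local Open Scope order_scope.
Context {d : Order.disp_t} {P : finPOrderType d}.
Implicit Types (x y z : P) (C : {set P}).

Lemma rank_chain x : exists C : {set P},
  [/\ chain C, {in C, forall y, y <= x} & #|C| = (rank x).+1].
Proof.
pose Q := [pred C : {set P} | chain C && [forall y in C, y <= x]].
(* The singleton chain makes the maximum positive, so the predecessor in [rank] does not
   truncate. *)
have Q1 : Q [set x].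
  apply/andP; split; apply/forall_inP => y /set1P-> //.
  by apply/forall_inP => z /set1P->; exact: comparablexx.
have Qgt0 : (0 < #|Q|)%N by apply/card_gt0P; exists [set x].
have [C /andP[chC /forall_inP leC] rC] :=
  eq_bigmax_cond (fun C : {set P} => #|C|) Qgt0.
exists C; split=> //; rewrite /rank rC prednK // -rC.
by rewrite (leq_trans _ (@leq_bigmax_cond _ _ (fun C : {set P} => #|C|) _ Q1)) ?cards1.
Qed.

Lemma leq_card_rank x C : chain C -> {in C, forall y, y <= x} -> (#|C| <= (rank x).+1)%N.
Proof.
move=> chC leC; apply: (leq_trans _ (leqSpred _)).
apply: (@leq_bigmax_cond _ (fun C : {set P} => chain C && [forall y in C, y <= x])
  (fun C : {set P} => #|C|)).
by rewrite chC; apply/forall_inP.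
Qed.

Lemma ltn_rank x y : x < y -> (rank x < rank y)%N.
Proof.
move=> xy; have [C [chC leC cardC]] := rank_chain x.
have yC : y \notin C by apply/negP => /leC; rewrite lt_geF.
have: (#|y |: C| <= (rank y).+1)%N.
  apply: leq_card_rank => [|z]; last first.
    by case/setU1P=> [->//|/leC zx]; exact: le_trans zx (ltW xy).
  apply/forall_inP => u /setU1P[->|uC]; apply/forall_inP => v /setU1P[->|vC].
  - exact: comparablexx.
  - by apply/orP; right; rewrite (le_trans (leC _ vC)) ?ltW.
  - by apply/orP; left; rewrite (le_trans (leC _ uC)) ?ltW.
  by move/forall_inP/(_ _ uC)/forall_inP/(_ _ vC): chC.
by rewrite cardsU1 yC cardC.
Qed.

Lemma leq_rank x y : x <= y -> (rank x <= rank y)%N.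
Proof. by rewrite le_eqVlt => /predU1P[->//|/ltn_rank/ltnW]. Qed.

Lemma eq_rank_le x y : x <= y -> rank x = rank y -> x = y.
Proof. by rewrite le_eqVlt => /predU1P[//|/ltn_rank + eq_xy]; rewrite eq_xy ltnn. Qed.

Lemma ltn_rank_le x y : x <= y -> (rank x < rank y)%N -> x < y.
Proof. by rewrite le_eqVlt => /predU1P[->|//]; rewrite ltnn. Qed.

(** Covering in terms of ranks, which makes it accessible to arithmetic; gradedness identifies it
    with [covers]. *)
Definition cov x y : bool := (x < y) && (rank y == (rank x).+1).

Lemma cov_lt x y : cov x y -> x < y.
Proof. by case/andP. Qed.

Lemma cov_le x y : cov x y -> x <= y.
Proof. by move/cov_lt/ltW. Qed.

Lemma cov_rank x y : cov x y -> rank y = (rank x).+1.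
Proof. by case/andP=> _ /eqP. Qed.

Lemma covI x y : x <= y -> rank y = (rank x).+1 -> cov x y.
Proof. by move=> xy rk; rewrite /cov rk eqxx ltn_rank_le // rk. Qed.

Lemma cov_neq x u v : cov x u -> cov x v -> (u <= v) = (u == v).
Proof.
move=> /cov_rank ru /cov_rank rv; apply/idP/eqP => [uv|->//].
by apply: eq_rank_le; rewrite // ru rv.
Qed.

End Rank.

(** The length is left open: the local facts concern intervals, and length 5 enters only when the
    solution is assembled. *)
Record eulerianLattice (d : Order.disp_t) := EulerianLattice {
  EL_sort :> finPOrderType d;
  EL_lattice : is_lattice EL_sort;
  EL_graded : graded EL_sort;
  EL_eulerian : eulerian EL_sort;
  EL_connected : interval_connected EL_sort }.

Section Lattice.
Local Open Scope order_scope.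
Context {d : Order.disp_t} {L : eulerianLattice d}.
Implicit Types (x y z u v e c : L) (A : {set L}) (K : L -> bool).

(** [EL_lattice] makes the default values of the join and the meet unreachable. *)
Definition jn x y : L := odflt x [pick j | [forall z, (j <= z) == (x <= z) && (y <= z)]].
Definition mt x y : L := odflt x [pick m | [forall z, (z <= m) == (z <= x) && (z <= y)]].

Lemma jn_le x y z : (jn x y <= z) = (x <= z) && (y <= z).
Proof.
rewrite /jn; case: pickP => [j /forallP/(_ z)/eqP //|no].
have := EL_lattice L => /forallP/(_ x)/forallP/(_ y)/andP[/existsP[j]].
by rewrite no.
Qed.

Lemma le_mt x y z : (z <= mt x y) = (z <= x) && (z <= y).
Proof.
rewrite /mt; case: pickP => [j /forallP/(_ z)/eqP //|no].
have := EL_lattice L => /forallP/(_ x)/forallP/(_ y)/andP[_ /existsP[j]].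
by rewrite no.
Qed.

Lemma covers_cov x y : covers x y = cov x y.
Proof.
apply/idP/idP => [xy|/andP[xy /eqP rk]].
  have := EL_graded L => /forallP/(_ x)/forallP/(_ y)/implyP/(_ xy).
  by rewrite /cov => ->; case/andP: xy => ->.
rewrite /covers xy; apply/forallP => z; apply/negP => /andP[/ltn_rank xz /ltn_rank zy].
by move: xz zy; rewrite rk; lia.
Qed.

Lemma ex_cov x y : x < y -> exists2 u, cov x u & u <= y.
Proof.
move=> xy; have Qy : [pred z | x < z <= y] y by rewrite /= xy lexx.
case: (@arg_minnP _ y [pred z | x < z <= y] (@rank _ L) Qy) => u /andP[xu uy] min_u.
exists u => //; rewrite -covers_cov /covers xu; apply/forallP => z.
apply/negP => /andP[xz zu]; have /= := min_u z.
by rewrite xz (ltW (lt_le_trans zu uy)) leqNgt ltn_rank // => /(_ isT).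
Qed.

Lemma ex_cocov x y : x < y -> exists2 u, x <= u & cov u y.
Proof.
move=> xy; have Qx : [pred z | x <= z < y] x by rewrite /= xy lexx.
case: (@arg_maxnP _ x [pred z | x <= z < y] (@rank _ L) Qx) => u /andP[xu uy] max_u.
exists u => //; rewrite -covers_cov /covers uy; apply/forallP => z.
apply/negP => /andP[uz zy]; have /= := max_u z.
by rewrite zy (ltW (le_lt_trans xu uz)) leqNgt ltn_rank // => /(_ isT).
Qed.

Definition lev x y k : {set L} := [set z | [&& x <= z, z <= y & rank z == k]].

Lemma levP x y k z : reflect [/\ x <= z, z <= y & rank z = k] (z \in lev x y k).
Proof. by rewrite inE; apply: (iffP and3P) => -[? ? /eqP]. Qed.

(** An odd [rank x] merely exchanges the two parity classes, so parity may be counted from the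
    bottom of the interval. *)
Lemma eulerian_shift x y : x < y ->
  #|[set z : L | (x <= z <= y) && odd (rank z - rank x)]|
    = #|[set z : L | (x <= z <= y) && ~~ odd (rank z - rank x)]|.
Proof.
move=> xy; have := EL_eulerian L => /forallP/(_ x)/forallP/(_ y)/implyP/(_ xy)/eqP.
pose N b := #|[set z : L | (x <= z <= y) && (odd (rank z) == b)]|.
have E b : #|[set z : L | (x <= z <= y) && (odd (rank z - rank x) == b)]|
    = N (b (+) odd (rank x)).
  apply: eq_card => z; rewrite !inE; case xz: (x <= z) => //=; congr (_ && _).
  by rewrite oddB ?leq_rank // -(inj_eq (@addIb (odd (rank x)))) addbK.
have N1 : #|[set z : L | (x <= z <= y) && odd (rank z)]| = N true.
  by apply: eq_card => z; rewrite !inE eqb_id.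
have N0 : #|[set z : L | (x <= z <= y) && ~~ odd (rank z)]| = N false.
  by apply: eq_card => z; rewrite !inE eqbF_neg.
rewrite N1 N0 => NE; transitivity (N (true (+) odd (rank x))).
  by rewrite -E; apply: eq_card => z; rewrite !inE eqb_id.
transitivity (N (false (+) odd (rank x))); first by case: odd.
by rewrite -E; apply: eq_card => z; rewrite !inE eqbF_neg.
Qed.

Lemma card_lev_sum x y (q : pred nat) :
  #|[set z : L | (x <= z <= y) && q (rank z - rank x)]|
    = \sum_(k < (rank y - rank x).+1 | q k) #|lev x y (rank x + k)|.
Proof.
rewrite -sum1_card (partition_big (fun z : L => inord (rank z - rank x) : 'I_(rank y - rank x).+1)
  (fun k : 'I__ => q k)) /=.
  apply: eq_bigr => k qk; rewrite -sum1_card; apply: eq_bigl => z.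
  rewrite !inE; apply/andP/and3P => [[/andP[/andP[xz zy] qz] /eqP zk]|[xz zy /eqP zk]].
    split=> //; rewrite -zk inordK ?subnKC ?leq_rank //.
    by rewrite ltnS leq_sub2r ?leq_rank.
  by rewrite xz zy zk addKn qk; split=> //; apply/eqP/val_inj; rewrite /= inordK.
move=> z; rewrite inE => /andP[/andP[xz zy] qz]; rewrite inordK //.
by rewrite ltnS leq_sub2r ?leq_rank.
Qed.

Lemma card_lev_odd_even x y : x < y ->
  \sum_(k < (rank y - rank x).+1 | odd k) #|lev x y (rank x + k)|
    = \sum_(k < (rank y - rank x).+1 | ~~ odd k) #|lev x y (rank x + k)|.
Proof.
by move/eulerian_shift; rewrite !(card_lev_sum x y odd, card_lev_sum x y [pred k | ~~ odd k]).
Qed.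

Lemma card_lev_bot x y : x <= y -> #|lev x y (rank x)| = 1.
Proof.
move=> xy; rewrite -(cards1 x); apply: eq_card => z; rewrite !inE.
apply/and3P/eqP => [[xz _ /eqP/esym/(eq_rank_le xz)]//|->].
by rewrite lexx xy eqxx.
Qed.

Lemma card_lev_top x y : x <= y -> #|lev x y (rank y)| = 1.
Proof.
move=> xy; rewrite -(cards1 y); apply: eq_card => z; rewrite !inE.
apply/and3P/eqP => [[_ zy /eqP/(eq_rank_le zy)]//|->].
by rewrite lexx xy eqxx.
Qed.

(** The diamond property: the two ends have even relative rank and must be balanced by the middle
    level. *)
Lemma card_lev2 x y : x <= y -> rank y = rank x + 2 -> #|lev x y (rank x + 1)| = 2.
Proof.
move=> xy rk; have lt_xy : x < y by apply: ltn_rank_le; rewrite // rk; lia.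
have := card_lev_odd_even lt_xy; rewrite [LHS]big_mkcond [RHS]big_mkcond.
rewrite rk addKn !big_ord_recl !big_ord0 /= /bump !leq0n !add1n -rk !addn0.
by rewrite card_lev_bot // card_lev_top //; lia.
Qed.

(** In length 3 the two ends have opposite parities and cancel, as for the vertices and edges of a
    polygon. *)
Lemma card_lev3 x y : x <= y -> rank y = rank x + 3 ->
  #|lev x y (rank x + 1)| = #|lev x y (rank x + 2)|.
Proof.
move=> xy rk; have lt_xy : x < y by apply: ltn_rank_le; rewrite // rk; lia.
have := card_lev_odd_even lt_xy; rewrite [LHS]big_mkcond [RHS]big_mkcond.
rewrite rk addKn !big_ord_recl !big_ord0 /= /bump !leq0n !add1n -rk !addn0.
by rewrite card_lev_bot // card_lev_top //; lia.
Qed.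

(** Euler's formula for the sphere; the 2 comes from the ends of the interval, which share the
    parity of the middle level. *)
Lemma card_lev4 x y : x <= y -> rank y = rank x + 4 ->
  #|lev x y (rank x + 1)| + #|lev x y (rank x + 3)| = #|lev x y (rank x + 2)| + 2.
Proof.
move=> xy rk; have lt_xy : x < y by apply: ltn_rank_le; rewrite // rk; lia.
have := card_lev_odd_even lt_xy; rewrite [LHS]big_mkcond [RHS]big_mkcond.
rewrite rk addKn !big_ord_recl !big_ord0 /= /bump !leq0n !add1n -rk !addn0.
by rewrite card_lev_bot // card_lev_top //; lia.
Qed.

Lemma ex_other x y u : x < u < y -> rank y = rank x + 2 ->
  exists u', [/\ u' != u, x < u' < y & forall v, x < v < y -> v = u \/ v = u'].
Proof.
move=> /andP[xu uy] rk; have xy := lt_trans xu uy.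
have inlev v : (v \in lev x y (rank x + 1)) = (x < v < y).
  apply/levP/andP => [[xv vy rv]|[xv vy]].
    by split; apply: ltn_rank_le; rewrite // ?rk rv; lia.
  by split; rewrite ?ltW //; move: (ltn_rank xv) (ltn_rank vy); lia.
have /eqP/cards2P[a [b [nab levE]]] := card_lev2 (ltW xy) rk.
have inE2 v : (x < v < y) = (v == a) || (v == b) by rewrite -inlev levE !inE.
have := inE2 u; rewrite xu uy => /esym/orP[/eqP ua|/eqP ub].
  exists b; rewrite inE2 eqxx orbT eq_sym ua; split=> // v.
  by rewrite inE2 => /orP[]/eqP; [left|right].
exists a; rewrite inE2 eqxx ub; split=> // v.
by rewrite inE2 => /orP[]/eqP; [right|left].
Qed.

Lemma cov_between x u y : cov x u -> cov u y -> x < u < y /\ rank y = rank x + 2.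
Proof. by move=> /andP[-> /eqP r1] /andP[-> /eqP ->]; rewrite r1 addn2. Qed.

Lemma between_cov x u y : rank y = rank x + 2 -> (x < u < y) = cov x u && cov u y.
Proof.
move=> rk; apply/idP/andP => [/andP[xu uy]|[/cov_lt-> /cov_lt->//]].
by split; rewrite /cov ?xu ?uy; move: (ltn_rank xu) (ltn_rank uy); lia.
Qed.

(** A flip in a chain. This version and the next differ in what is known of a competitor [v]: that
    it covers [x], or that it is covered by [y]. *)
Lemma cov_other x u y : cov x u -> cov u y ->
  exists u', [/\ u' != u, cov x u', cov u' y
                & forall v, cov x v -> v <= y -> v = u \/ v = u'].
Proof.
move=> xu uy; have [xuy rk] := cov_between xu uy.
have [u' [nu' xu'y all]] := ex_other xuy rk; exists u'.
move: xu'y; rewrite between_cov // => /andP[-> ->]; split=> // v xv vy.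
apply: all; rewrite cov_lt //=; apply: ltn_rank_le => //.
by rewrite rk (cov_rank xv); lia.
Qed.

Lemma cov_other_up x u y : cov x u -> cov u y ->
  exists u', [/\ u' != u, cov x u', cov u' y
                & forall v, x <= v -> cov v y -> v = u \/ v = u'].
Proof.
move=> xu uy; have [xuy rk] := cov_between xu uy.
have [u' [nu' xu'y all]] := ex_other xuy rk; exists u'.
move: xu'y; rewrite between_cov // => /andP[-> ->]; split=> // v xv vy.
apply: all; rewrite (cov_lt vy) andbT; apply: ltn_rank_le => //.
by move: rk; rewrite (cov_rank vy); lia.
Qed.

(** Atomicity: by the diamond property an element that is neither [x] nor an atom over [x] is the
    join of two elements that it covers, and induction on the rank applies to both. *)
Lemma atoms_le x z w : x <= z -> x <= w ->
  (forall u, cov x u -> u <= z -> u <= w) -> z <= w.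
Proof.
have [n] := ubnP (rank z); elim: n z => // n IHn z; rewrite ltnS => zn xz xw sub.
have [->//|nxz] := eqVneq z x; have xz' : x < z by rewrite lt_neqAle eq_sym nxz.
have [c xc cz] := ex_cocov xz'.
have cw : c <= w.
  apply: IHn => // [|u xu uc]; last by apply: sub => //; rewrite (le_trans uc) ?cov_le.
  by rewrite -(cov_rank cz).
have [xcE|nxc] := eqVneq x c; first by apply: sub; rewrite // xcE.
have [b xb bc] : exists2 b, x <= b & cov b c by apply: ex_cocov; rewrite lt_neqAle nxc.
have [c' [nc' bc' c'z _]] := cov_other bc cz.
have c'w : c' <= w.
  apply: IHn => // [||u xu uc]; last by apply: sub => //; rewrite (le_trans uc) ?cov_le.
  - by rewrite -(cov_rank c'z).
  - exact: le_trans xb (cov_le bc').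
suff <- : jn c c' = z by rewrite jn_le cw c'w.
have jz : jn c c' <= z by rewrite jn_le !cov_le.
apply: eq_rank_le => //; apply/eqP; rewrite eqn_leq leq_rank //= (cov_rank cz).
apply: ltn_rank; have := lexx (jn c c'); rewrite jn_le => /andP[cj c'j].
rewrite lt_neqAle cj andbT; apply: contraNneq nc' => jc.
by rewrite -jc (cov_neq bc' bc) in c'j.
Qed.

End Lattice.

(** * Connectedness of the graph of an interval and of punctured polygons *)

Section Connectivity.
Local Open Scope order_scope.
Context {d : Order.disp_t} {L : eulerianLattice d}.
Implicit Types (x y z u v e c a : L) (A : {set L}) (K : L -> bool).

Lemma interval_constant x y K : x <= y -> (rank x + 3 <= rank y)%N ->
  (forall u v, x < u -> u < v -> v < y -> K u = K v) ->
  forall u v, x < u < y -> x < v < y -> K u = K v.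
Proof.
move=> xy rk Kloc u v xuy xvy.
have /forallP/(_ x)/forallP/(_ y) := EL_connected L; rewrite xy rk.
move=> /connected_onP-/(_ (fun a b => comparable_sym b a))/(_ K) constK.
apply: constK; rewrite ?inE // => {u v xuy xvy} u v; rewrite !inE.
move=> /andP[xu uy] /andP[xv vy]; case: comparableP => // [uv|vu|->] _ //.
  exact: Kloc.
by rewrite (Kloc v u).
Qed.

(** Interval-connectedness concerns the whole proper part. To descend to vertices and edges, a
    proper [z] receives the common value of [K] at the atoms below it, which is well defined by
    induction on the rank of the top. *)
Lemma graph_constant x y K :
  (forall u e, cov x u -> cov u e -> e <= y -> K u = K e) ->
  forall u v, cov x u -> cov x v -> u <= y -> v <= y -> K u = K v.
Proof.
have [n] := ubnP (rank y); elim: n y => // n IHn y; rewrite ltnS => yn Kloc u v xu xv uy vy.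
have xy := lt_le_trans (cov_lt xu) uy.
have [rk1|[rk2|rk3]] : rank y = (rank x).+1 \/ rank y = (rank x).+2 \/ (rank x + 3 <= rank y)%N.
- by move: (ltn_rank xy); clear; lia.
- have -> : u = y by apply: eq_rank_le; rewrite // rk1 (cov_rank xu).
  by have -> : v = y by apply: eq_rank_le; rewrite // rk1 (cov_rank xv).
(* The proper part of an interval of length 2 is disconnected; here [y] itself is the edge that
   joins the two atoms. *)
- have covy w : cov x w -> w <= y -> cov w y.
    by move=> /cov_rank rw wy; apply: covI => //; rewrite rk2 rw.
  by rewrite (Kloc _ y xu) ?(Kloc _ y xv) ?covy.
pose K' z := [exists w, [&& cov x w, w <= z & K w]].
have K'E z w : x < z < y -> cov x w -> w <= z -> K' z = K w.
  move=> /andP[xz zy] xw wz; apply/existsP/idP => [[w' /and3P[xw' w'z Kw']]|Kw].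
    rewrite (IHn z _ _ w w') // => [|a e xa ae ez].
      by move: (ltn_rank zy) yn; clear; lia.
    by apply: Kloc => //; exact: le_trans ez (ltW zy).
  by exists w; rewrite xw wz.
have proper w : cov x w -> w <= y -> x < w < y.
  move=> xw wy; rewrite (cov_lt xw) ltn_rank_le // (cov_rank xw); move: rk3; clear; lia.
rewrite -(K'E u u) ?proper // -(K'E v v) ?proper //.
apply: (interval_constant (ltW xy) rk3); rewrite ?proper //.
move=> a b xa ab bz; have [w xw wa] := ex_cov xa.
rewrite (K'E a w) ?(K'E b w) ?xa ?(lt_trans xa ab) ?(lt_trans ab bz) //.
exact: le_trans wa (ltW ab).
Qed.

(** Deleting a face deletes all that lies above it, so the survivors form an order ideal. *)
Definition surv A z := [forall a in A, ~~ (a <= z)].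

Lemma surv_le A z w : z <= w -> surv A w -> surv A z.
Proof.
move=> zw /forall_inP sw; apply/forall_inP => a aA.
by apply: contra (sw a aA) => az; exact: le_trans az zw.
Qed.

Lemma survP A z : reflect (forall a, a \in A -> ~~ (a <= z)) (surv A z).
Proof. exact: forall_inP. Qed.

Lemma card_cov2 x e : x <= e -> rank e = rank x + 2 ->
  #|[set u | cov x u && (u <= e)]| = 2.
Proof.
move=> xe rk; rewrite -(card_lev2 xe rk); apply: eq_card => u; rewrite !inE.
apply/andP/and3P => [[xu ue]|[xu ue /eqP ru]].
  by rewrite (cov_le xu) ue (cov_rank xu) addn1.
by rewrite ue covI // ru addn1.
Qed.

Lemma card_cov2_up u y : u <= y -> rank y = rank u + 2 ->
  #|[set e | (u <= e) && cov e y]| = 2.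
Proof.
move=> uy rk; rewrite -(card_lev2 uy rk); apply: eq_card => e; rewrite !inE.
apply/andP/and3P => [[ue ey]|[ue ey /eqP re]].
  by rewrite ue (cov_le ey); split=> //; move: rk; rewrite (cov_rank ey); clear; lia.
by rewrite ue covI // rk re; clear; lia.
Qed.

(* Parity: the surviving part of the boundary of each component consists of an
   even, nonzero number of (vertex, removed edge) incidences. *)
Lemma polygon_constant x y A K : x <= y -> rank y = rank x + 3 ->
  (\sum_(e : L | [&& x <= e, cov e y & ~~ surv A e]%O)
     #|[set u | [&& cov x u, u <= e & surv A u]%O]| <= 3)%N ->
  (forall u e, cov x u -> cov u e -> e <= y -> surv A e -> K u = K e) ->
  forall u v, cov x u -> cov x v -> u <= y -> v <= y -> surv A u -> surv A v -> K u = K v.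
Proof.
move=> xy rk few Kloc u0 v0 xu0 xv0 u0y v0y su0 sv0.
pose E e := (x <= e) && cov e y.
pose S (b : bool) u := [&& cov x u, u <= y, surv A u & K u == b].
pose N (b : bool) := \sum_u \sum_e nat_of_bool (S b u && [&& E e, u <= e & ~~ surv A e])%O.
have rkE e : E e -> rank e = rank x + 2 by move=> /andP[_ /cov_rank]; move: rk; clear; lia.
have edge_cov u e : cov x u -> u <= e -> E e -> cov u e.
  by move=> xu ue Ee; apply: covI; rewrite // rkE // (cov_rank xu) addn2.
have covE u e : cov x u -> cov u e -> e <= y -> E e.
  move=> xu ue ey; rewrite /E (ltW (lt_trans (cov_lt xu) (cov_lt ue))) covI //.
  by rewrite rk (cov_rank ue) (cov_rank xu) addn3.
(* Double counting: a surviving vertex of colour [b] lies on two edges, a surviving edge of colour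
   [b] has two ends of that colour, and [N b] is the difference of two even numbers. *)
have Neven b : odd (N b) = false.
  have T1 : \sum_u \sum_e nat_of_bool (S b u && E e && (u <= e)%O) = \sum_u (S b u).*2.
    apply: eq_bigr => u _; case Su: (S b u) => /=; last by rewrite big1.
    have /and4P[xu uy _ _] := Su.
    have ry : rank y = rank u + 2 by rewrite rk (cov_rank xu) addSnnS.
    rewrite -[RHS]/2 -[RHS](card_cov2_up uy ry) -sum1_card [RHS]big_mkcond /=.
    apply: eq_bigr => e _; rewrite inE /E; case ue: (u <= e); rewrite ?andbF //=.
    by rewrite (le_trans (cov_le xu) ue) andbT; case: cov.
  have T2 : \sum_u \sum_e nat_of_bool (S b u && E e && (u <= e)%O) =
      \sum_e ([&& E e, surv A e & K e == b]).*2 + N b.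
    transitivity (\sum_u \sum_e nat_of_bool (S b u && [&& E e, u <= e & surv A e])%O + N b).
      rewrite /N -big_split /=; apply: eq_bigr => u _; rewrite -big_split /=.
      apply: eq_bigr => e _; case: (S b u) => //=; case: (E e) => //=.
      by case: (u <= e); case: surv.
    congr (_ + _); rewrite exchange_big /=; apply: eq_bigr => e _.
    case Ee: (E e); last by rewrite big1 // => u _; rewrite andbF.
    case se: (surv A e); last by rewrite big1 // => u _; rewrite !andbF.
    have /andP[xe ey] := Ee; rewrite /=.
    have KE u : cov x u -> u <= e -> K u = K e.
      by move=> xu ue; exact: Kloc xu (edge_cov _ _ xu ue Ee) (cov_le ey) se.
    case Kb: (K e == b); last first.
      rewrite big1 // => u _; rewrite /S andbT; case xu: (cov x u) => //=.
      by case ue: (u <= e); rewrite ?andbF // KE // Kb !andbF.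
    rewrite -[RHS]/2 -[RHS](card_cov2 xe (rkE _ Ee)) -sum1_card [RHS]big_mkcond /=.
    apply: eq_bigr => u _.
    rewrite inE /S; case xu: (cov x u) => //=; case ue: (u <= e); rewrite ?andbF //=.
    by rewrite KE // Kb (le_trans ue (cov_le ey)) (surv_le ue se).
  have := congr1 odd T1; rewrite T2 oddD.
  suff D (I : finType) (p : I -> bool) : odd (\sum_i (p i).*2) = false by rewrite !D.
  by elim/big_ind: _ => // [m n om on|i _]; rewrite ?oddD ?om ?on ?odd_double.
(* Without such incidences the vertices and edges of colour [b] would be a proper part of the
   polygon closed under incidence, against [graph_constant]. *)
have Npos b u v : S b u -> cov x v -> v <= y -> surv A v -> K v != b -> (0 < N b)%N.
  move=> Sbu xv vy sv Kv; rewrite lt0n; apply: contraTN (Kv) => /eqP N0.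
  have noN u' e : S b u' -> cov u' e -> e <= y -> surv A e.
    move=> Su ue ey; have /and4P[xu _ _ _] := Su; apply: contraTT isT => nse.
    have /eqP := N0; rewrite sum_nat_eq0 => /forallP/(_ u')/=; rewrite sum_nat_eq0.
    by move=> /forallP/(_ e)/=; rewrite Su (covE u') // (cov_le ue) nse.
  pose K' z := S b z || [&& E z, surv A z & K z == b].
  have SE e : E e -> S b e = false.
    by move=> /rkE re; apply/negP => /and4P[/cov_rank]; rewrite re; clear; lia.
  have ES w : cov x w -> E w = false.
    by move=> /cov_rank rw; apply/negP => /rkE; rewrite rw; clear; lia.
  have K'uv : K' u = K' v.
    have /and4P[xu uy _ _] := Sbu.
    apply: (graph_constant (x := x) (y := y)) => // w e xw we ey.
    have Ee := covE _ _ xw we ey; rewrite /K' (SE _ Ee) (ES _ xw) Ee orbF /=.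
    apply/idP/andP => [Sw|[se Ke]].
      have se := noN _ _ Sw we ey; split=> //.
      by rewrite -(Kloc w) //; case/and4P: Sw.
    by rewrite /S xw (Kloc w e) // Ke (le_trans (cov_le we) ey) (surv_le (cov_le we) se).
  by move: K'uv; rewrite /K' Sbu /= /S (ES v) // orbF => /esym/and4P[_ _ _ ->].
(* Two positive even numbers add up to at least 4, so the bound 3 excludes a second colour. *)
have few' : (N true + N false <= 3)%N.
  apply: leq_trans few; rewrite /N -big_split /=.
  under eq_bigr => u _ do rewrite -big_split /=.
  rewrite exchange_big [leqRHS]big_mkcond /=; apply: leq_sum => e _.
  case Ee: [&& _, _ & _]; last first.
    rewrite big1 // => u _; move: Ee; rewrite /E.
    by case: (x <= e); case: (cov e y); case: (surv A e); rewrite //= ?andbF.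
  rewrite -sum1_card [leqRHS]big_mkcond /=; apply: leq_sum => u _.
  rewrite inE /S /E; case: (cov x u) => //=; case: (surv A u); rewrite ?andbF //=.
  case: (u <= e); rewrite ?andbF //=; case: (K u); case: (u <= y) => //=;
  by case: (x <= e); case: (cov e y); case: (surv A e).
apply/eqP; case Kuv: (K u0 == K v0) => //.
have Npos1 : (0 < N (K u0))%N.
  by apply: (Npos _ u0 v0); rewrite // /S ?xu0 ?u0y ?su0 ?eqxx // eq_sym Kuv.
have Npos2 : (0 < N (K v0))%N.
  by apply: (Npos _ v0 u0); rewrite // /S ?xv0 ?v0y ?sv0 ?eqxx // Kuv.
move: Kuv Npos1 Npos2 few' (Neven true) (Neven false); clear.
by case: (K u0); case: (K v0) => //= _; move: (N true) (N false); lia.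
Qed.

End Connectivity.

(** * Deletion of faces *)

Section Deletion.
Local Open Scope order_scope.
Context {d : Order.disp_t} {L : eulerianLattice d}.
Implicit Types (x y z u v e c a : L) (A : {set L}) (K : L -> bool).

Lemma surv1 a z : surv [set a] z = ~~ (a <= z).
Proof. by apply/survP/idP => [/(_ a (set11 a))//|na b /set1P->]. Qed.

Lemma surv2 a b z : surv [set a; b] z = ~~ (a <= z) && ~~ (b <= z).
Proof.
apply/survP/andP => [s|[na nb] c /set2P[]->//].
by rewrite !s ?set21 ?set22.
Qed.

Lemma card_surv_edge x e a A : x <= e -> rank e = rank x + 2 -> cov x a -> a <= e ->
  ~~ surv A a -> (#|[set u | [&& cov x u, u <= e & surv A u]%O]| <= 1)%N.
Proof.
move=> xe rk xa ae na; rewrite -ltnS -(card_cov2 xe rk); apply: proper_card.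
rewrite properE; apply/andP; split.
  by apply/subsetP => u; rewrite !inE andbA => /andP[].
by apply/subsetPn; exists a; rewrite !inE xa ae // (negbTE na).
Qed.

(** Each of the two edges at [a] keeps at most one end, so there are at most two incidences. *)
Lemma polygon_minus_atom x y a K : x <= y -> rank y = rank x + 3 -> cov x a -> a <= y ->
  (forall u e, cov x u -> cov u e -> e <= y -> ~~ (a <= e) -> K u = K e) ->
  forall u v, cov x u -> cov x v -> u <= y -> v <= y -> u != a -> v != a -> K u = K v.
Proof.
move=> xy rk xa ay Kloc u v xu xv uy vy nu nv.
apply: (polygon_constant (x := x) (y := y) (A := [set a])) => //; first last.
- by rewrite surv1 (cov_neq xa xv) eq_sym.
- by rewrite surv1 (cov_neq xa xu) eq_sym.
- by move=> w e xw we ey; rewrite surv1; apply: Kloc.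
apply: (@leq_trans 2) => //; rewrite -(card_cov2_up ay); last by rewrite (cov_rank xa) rk addSnnS.
rewrite -sum1_card big_mkcond [leqRHS]big_mkcond /=; apply: leq_sum => e _.
rewrite inE surv1 negbK; case: (boolP (a <= e)) => [ae|_]; rewrite ?andbF //= andbT.
case: (boolP (x <= e)) => // xe; case ey: (cov e y) => //=.
apply: (@card_surv_edge _ _ a) => //; last by rewrite surv1 lexx.
by move: rk; rewrite (cov_rank ey); clear; lia.
Qed.

(** Only the edge [c] disappears, and its two ends are the only incidences. *)
Lemma polygon_minus_edge x y c K : x <= c -> cov c y -> rank y = rank x + 3 ->
  (forall u e, cov x u -> cov u e -> e <= y -> e != c -> K u = K e) ->
  forall u v, cov x u -> cov x v -> u <= y -> v <= y -> K u = K v.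
Proof.
move=> xc cy rk Kloc u v xu xv uy vy; have xy := le_trans xc (cov_le cy).
have survE z : rank z <= rank c -> surv [set c] z = (z != c).
  move=> rz; rewrite surv1; congr (~~ _); apply/idP/eqP => [cz|->//].
  by apply/esym/eq_rank_le => //; apply/eqP; rewrite eqn_leq leq_rank.
have rc : rank c = rank x + 2 by move: rk; rewrite (cov_rank cy); clear; lia.
have survA w : cov x w -> surv [set c] w.
  move=> /cov_rank rw; rewrite survE; last by rewrite rw rc; clear; lia.
  by apply/eqP => wc; move: rw; rewrite wc rc; clear; lia.
apply: (polygon_constant (x := x) (y := y) (A := [set c])) => //; rewrite ?survA //; last first.
  move=> w e xw we ey; rewrite survE; first exact: Kloc.
  by rewrite (cov_rank we) (cov_rank xw) rc; clear; lia.
rewrite (big_pred1 c); last first.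
  move=> e /=; case ey: (cov e y); rewrite ?andbF /=; last first.
    by apply/esym/negbTE; apply: contraFneq ey => ->.
  rewrite survE; last by move: (cov_rank ey) (cov_rank cy) => ->; clear; lia.
  by rewrite negbK andbC; case: eqP => [->|].
apply: (@leq_trans 2) => //; rewrite -(card_cov2 xc rc); apply: subset_leq_card.
by apply/subsetP => w; rewrite !inE andbA => /andP[].
Qed.

(** The removed edges are [c] and the neighbouring edge at each of its ends, with at most one
    surviving end each. This is the case for which [polygon_constant] allows 3 incidences. *)
Lemma polygon_minus_closed_edge x y a b c K : cov x a -> cov x b -> a != b ->
  a <= c -> b <= c -> cov c y -> rank y = rank x + 3 ->
  (forall u e, cov x u -> cov u e -> e <= y -> ~~ (a <= e) -> ~~ (b <= e) -> K u = K e) ->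
  forall u v, cov x u -> cov x v -> u <= y -> v <= y ->
    u != a -> u != b -> v != a -> v != b -> K u = K v.
Proof.
move=> xa xb nab ac bc cy rk Kloc u v xu xv uy vy nua nub nva nvb.
have xy : x <= y by rewrite (le_trans (cov_le xu)).
apply: (polygon_constant (x := x) (y := y) (A := [set a; b])) => //; first last.
- by rewrite surv2 (cov_neq xa xv) (cov_neq xb xv) ![_ == v]eq_sym nva.
- by rewrite surv2 (cov_neq xa xu) (cov_neq xb xu) ![_ == u]eq_sym nua.
- by move=> w e xw we ey; rewrite surv2 => /andP[]; apply: Kloc.
have rc : rank c = rank x + 2 by move: rk; rewrite (cov_rank cy); clear; lia.
have cova w : cov x w -> w <= c -> cov w c.
  by move=> /cov_rank rw wc; apply: covI; rewrite // rc rw; clear; lia.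
have [ea [_ _ _ allea]] := cov_other_up (cova _ xa ac) cy.
have [eb [_ _ _ alleb]] := cov_other_up (cova _ xb bc) cy.
apply: (@leq_trans #|[set c; ea; eb]|); last first.
  rewrite -[3]/(2 + 1)%N; apply: (leq_trans (leq_card_setU _ _)).
  by rewrite leq_add ?cards1 // cards2; case: eqP.
rewrite -sum1_card big_mkcond [leqRHS]big_mkcond /=; apply: leq_sum => e _.
case: ifP => // /and3P[xe ey]; rewrite surv2 negb_and !negbK => abe.
have -> : e \in [set c; ea; eb].
  by rewrite !inE; case/orP: abe => [/allea|/alleb] /(_ ey)[]->; rewrite eqxx ?orbT.
have re : rank e = rank x + 2 by move: rk; rewrite (cov_rank ey); clear; lia.
case/orP: abe => [ae|be].
  by apply: (card_surv_edge xe re xa ae); rewrite surv2 lexx.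
by apply: (card_surv_edge xe re xb be); rewrite surv2 lexx andbF.
Qed.

(** Passing from an element to one that it covers loses at least one atom, since [atoms_le] would
    otherwise make them equal. *)
Lemma leq_card_atoms x y : x <= y -> (rank y <= rank x + #|[set u | cov x u && (u <= y)%O]|)%N.
Proof.
have [n] := ubnP (rank y); elim: n y => // n IHn y; rewrite ltnS => yn xy.
have [->|nxy] := eqVneq x y; first exact: leq_addr.
have [c xc cy] : exists2 c, x <= c & cov c y by apply: ex_cocov; rewrite lt_neqAle nxy.
rewrite (cov_rank cy); apply: leq_ltn_trans (IHn c _ xc) _; first by rewrite -(cov_rank cy).
rewrite ltn_add2l; apply: proper_card; rewrite properE; apply/andP; split.
  by apply/subsetP => u; rewrite !inE => /andP[-> uc]; rewrite (le_trans uc (cov_le cy)).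
apply/negP => /subsetP sub; have := cov_lt cy; rewrite lt_leAnge => /andP[_ /negP[]].
apply: (atoms_le xy xc) => u xu uy; have := sub u; rewrite !inE xu uy => /(_ isT).
by [].
Qed.

(* Balinski's theorem for edges and faces as well as vertices: a vertex a of the
   path is bypassed through the link [a, y], an edge through a surviving polygon. *)
Lemma deletion_constant n x y A K : x <= y -> rank y = rank x + n.+2 -> (#|A| <= n)%N ->
  (forall a, a \in A -> ~~ (a <= x)) ->
  (forall u e, cov x u -> cov u e -> e <= y -> surv A e -> K u = K e) ->
  forall u v, cov x u -> cov x v -> u <= y -> v <= y -> surv A u -> surv A v -> K u = K v.
Proof.
elim: n x y A K => [|n IHn] x y A K xy rk.
  rewrite leqn0 cards_eq0 => /eqP-> _ Kloc u v xu xv uy vy _ _.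
  apply: graph_constant xu xv uy vy => w e xw we ey.
  by apply: Kloc => //; apply/survP => a; rewrite inE.
have [m] := ubnP #|A|; elim: m A K => // m IHm A K; rewrite ltnS => Am An nAx Kloc.
have [A0|[a0 a0A]] := set_0Vmem A.
  move=> u v xu xv uy vy _ _; apply: graph_constant xu xv uy vy => w e xw we ey.
  by apply: Kloc => //; apply/survP => a; rewrite A0 inE.
pose A' := A :\ a0; pose a := jn x a0.
have cardA : #|A| = #|A'|.+1 by rewrite (cardsD1 a0) a0A.
have nAx' b : b \in A' -> ~~ (b <= x) by rewrite inE => /andP[_ /nAx].
have survD z : surv A z = ~~ (a0 <= z) && surv A' z.
  apply/survP/andP => [s|[na s] b bA].
    by rewrite s //; split=> //; apply/survP => b /setD1P[_ /s].
  by have [->//|nb] := eqVneq b a0; apply: (survP _ _ s); rewrite !inE nb.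
have a0E z : x <= z -> (a0 <= z) = (a <= z) by move=> xz; rewrite jn_le xz.
have xa : x < a.
  have: x <= a by have := lexx a; rewrite jn_le => /andP[].
  rewrite le_eqVlt => /predU1P[ax|//].
  by have := nAx _ a0A; rewrite a0E // -ax lexx.
(* It suffices to recolour what is lost through [a0] alone: the new function is locally constant
   after the smaller deletion [A'] and agrees with [K] on the survivors of [A]. *)
suff [K' K'loc K'E] : exists2 K' : L -> bool,
    (forall u e, cov x u -> cov u e -> e <= y -> surv A' e -> K' u = K' e)
  & forall u, cov x u -> u <= y -> surv A u -> K' u = K u.
  move=> u v xu xv uy vy su sv; rewrite -!K'E //.
  move: su sv; rewrite !survD => /andP[_ su] /andP[_ sv].
  by apply: (IHm A' K') => //; rewrite -?cardA // ltnW // -cardA.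
case: (boolP [exists z,
  [&& x < z, z <= y, (rank z <= rank x + 2)%N, surv A' z & a <= z]]); last first.
  move=> /existsPn none; exists K => // u e xu ue ey se.
  apply: Kloc => //; rewrite survD se andbT; apply: contraNN (none e) => a0e /=.
  have xe := lt_trans (cov_lt xu) (cov_lt ue).
  by rewrite xe ey se -(a0E _ (ltW xe)) a0e (cov_rank ue) (cov_rank xu) addn2 leqnn.
move=> /existsP[z /and5P[xz zy rz sz az]].
have ay := le_trans az zy; have sa : surv A' a := surv_le az sz.
have := leq_rank az; have := ltn_rank xa => ra1 ra2.
(* Only vertices and edges matter to [K], so a face [a] whose deletion is felt is itself a vertex or
   an edge. *)
have {ra1 ra2}[ra|ra] : rank a = rank x + 1 \/ rank a = rank x + 2.
  by move: ra1 ra2 rz; clear; lia.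
  have cxa : cov x a by rewrite covI ?ltW // ra addn1.
  (* An edge or a polygon through the vertex [a] is a vertex or an edge of the link. It takes the
     value of [K] at its vertices other than [a]; for a polygon this is consistent because the
     polygon stays connected without [a]. *)
  have K2E w z' : cov a z' \/ (exists2 e, cov a e & cov e z') -> z' <= y -> surv A' z' ->
      cov x w -> w <= z' -> w != a -> [exists v, [&& cov x v, v <= z', v != a & K v]] = K w.
    move=> az' z'y sz' xw wz nw; apply/existsP/idP => [[v /and4P[xv vz nv Kv]]|Kw]; last first.
      by exists w; rewrite xw wz nw.
    case: az' => [az'|[e ae ez']].
      have [u' [_ _ _ all]] := cov_other cxa az'.
      case: (all v xv vz) => ve; first by rewrite ve eqxx in nv.
      case: (all w xw wz) => we; first by rewrite we eqxx in nw.
      by rewrite we -ve.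
    rewrite -(@polygon_minus_atom x z' a K _ _ cxa _ _ v w) //.
    - by rewrite ltW // (lt_trans xa) // (lt_trans (cov_lt ae) (cov_lt ez')).
    - by rewrite (cov_rank ez') (cov_rank ae) ra; clear; lia.
    - exact: le_trans (cov_le ae) (cov_le ez').
    - move=> u f xu uf fz naf; apply: Kloc => //; first exact: le_trans fz z'y.
      rewrite survD (surv_le fz sz') andbT a0E //.
      exact: ltW (lt_trans (cov_lt xu) (cov_lt uf)).
  pose K2 z' := [exists v, [&& cov x v, v <= z', v != a & K v]].
  have K2const e e' : cov a e -> cov a e' -> e <= y -> e' <= y ->
      surv A' e -> surv A' e' -> K2 e = K2 e'.
    apply: (IHn a y A' K2) => //.
    - by rewrite rk ra; clear; lia.
    - by move: An; rewrite cardA.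
    - by move=> b bA'; exact: (survP _ _ sa).
    move=> f P af fP Py sP; have [u [nu xu uf _]] := cov_other cxa af.
    have fP' := cov_le fP; rewrite /K2 (K2E u) ?(K2E u P) //.
    - by right; exists f.
    - exact: le_trans (cov_le uf) fP'.
    - by left.
    - exact: le_trans fP' Py.
    - exact: surv_le sP.
    - exact: cov_le.
  pose good := [pred e | [&& cov a e, e <= y & surv A' e]].
  (* If no edge through [a] survives, the value given to [a] is arbitrary. *)
  pose k := if [pick e | good e] is Some e then K2 e else false.
  have kE e : good e -> K2 e = k.
    move=> ge; rewrite /k; case: pickP => [f|/(_ e)]; last by rewrite ge.
    by move: ge => /and3P[? ? ?] /and3P[? ? ?]; apply: K2const.
  exists (fun z' => if a <= z' then k else K z').
    move=> u e xu ue ey se; case: (boolP (a <= e)) => [ae|nae].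
      case: (boolP (a <= u)) => // nau; have au : u != a by apply: contraNneq nau => ->.
      have cae : cov a e by apply: covI; rewrite // (cov_rank ue) (cov_rank xu) ra addn1.
      have K2u : K2 e = K u := K2E u e (or_introl cae) ey se xu (cov_le ue) au.
      by rewrite -K2u kE // inE cae ey.
    rewrite ifN; last by apply: contraNN nae => /le_trans; apply; exact: cov_le.
    apply: Kloc => //; rewrite survD se andbT a0E //.
    exact: ltW (lt_trans (cov_lt xu) (cov_lt ue)).
  by move=> u xu uy; rewrite survD (a0E _ (cov_le xu)) => /andP[/negbTE->].
have aE e u : cov x u -> cov u e -> (a <= e) = (e == a).
  move=> xu ue; apply/idP/eqP => [ae|->//]; apply/esym/eq_rank_le => //.
  by rewrite (cov_rank ue) (cov_rank xu) ra; clear; lia.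
(* An element [b] of [A'] kills at most one polygon over the edge [a], namely the join of [a] and
   [b], and [leq_card_atoms] provides more polygons than [A'] has elements. *)
have [P /and3P[aP Py sP]] : exists P, [&& cov a P, P <= y & surv A' P].
  apply/existsP; apply: contraT => /existsPn none.
  suff: (#|[set P | cov a P && (P <= y)%O]| <= #|A'|)%N.
    by move: An (leq_card_atoms ay); rewrite cardA rk ra; clear; lia.
  apply: leq_trans (leq_imset_card (jn a) A'); apply: subset_leq_card.
  apply/subsetP => P; rewrite inE => /andP[aP Py]; have := none P.
  rewrite aP Py /= => /forall_inPn[b bA' /negPn bP]; apply/imsetP; exists b => //.
  have jP : jn a b <= P by rewrite jn_le cov_le.
  have := lexx (jn a b); rewrite jn_le => /andP[aj bj].
  apply/esym/eq_rank_le => //; apply/eqP; rewrite eqn_leq leq_rank //= (cov_rank aP).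
  apply: ltn_rank; rewrite lt_neqAle aj andbT.
  by apply: contraNneq (survP _ _ sa b bA') => ->.
have xle u e : cov x u -> cov u e -> x <= e.
  by move=> xu ue; exact: ltW (lt_trans (cov_lt xu) (cov_lt ue)).
(* The two ends of the lost edge [a] are joined by the rest of the boundary of the surviving polygon
   [P]. *)
have K_P u v : cov x u -> cov x v -> u <= a -> v <= a -> K u = K v.
  move=> xu xv ua va; apply: (@polygon_minus_edge x P a K) => //; rewrite ?ltW //.
  - by rewrite (cov_rank aP) ra; clear; lia.
  - move=> w e xw we eP nea; apply: Kloc => //; first exact: le_trans eP Py.
    by rewrite survD (surv_le eP sP) a0E ?(xle w) // (aE e w) // nea.
  - exact: le_lt_trans ua (cov_lt aP).
  - exact: le_lt_trans va (cov_lt aP).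
have [u1 xu1 u1a] := ex_cov xa.
exists (fun z => if z == a then K u1 else K z).
  move=> u e xu ue ey se; have -> : (u == a) = false.
    by apply/eqP => ua; move: (cov_rank xu); rewrite ua ra; clear; lia.
  case: eqP => [ea|/eqP nea]; first by apply: K_P; rewrite // -ea cov_le.
  by apply: Kloc => //; rewrite survD se a0E ?(xle u) // (aE e u) // nea.
by move=> u xu _ _; case: eqP => // ua; move: (cov_rank xu); rewrite ua ra; clear; lia.
Qed.

End Deletion.

(** * The complement of a coatom *)

Section FacetComplement.
Local Open Scope order_scope.
Context {d : Order.disp_t} {L : eulerianLattice d}.
Implicit Types (x y z u v e c a : L) (A : {set L}) (K : L -> bool).

(** An edge is the join of its two ends. *)
Lemma edge_le x u v e w : cov x u -> cov x v -> u != v -> cov u e -> v <= e ->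
  u <= w -> v <= w -> e <= w.
Proof.
move=> xu xv nuv ue ve uw vw; have [u' [nu' xu' u'e all]] := cov_other xu ue.
have vu' : v = u' by case: (all v xv ve) nuv => [->|//]; rewrite eqxx.
apply: (@atoms_le _ _ x).
- exact: le_trans (cov_le xu) (cov_le ue).
- exact: le_trans (cov_le xu) uw.
- by move=> t xt te; case: (all t xt te) => -> //; rewrite -vu'.
Qed.

Lemma coatom_meet_lt y P R : cov P y -> cov R y -> P != R -> mt P R < P.
Proof.
move=> Py Ry nPR; have := lexx (mt P R); rewrite le_mt => /andP[mP mR].
rewrite lt_neqAle mP andbT; apply: contraNneq nPR => mE; apply/eqP/eq_rank_le.
  by rewrite -mE.
by apply/eqP; rewrite -eqSS -(cov_rank Py) -(cov_rank Ry).
Qed.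

(* The boundary of the coatom R is crossed at each of its vertices v inside the
   polygon [v, y] minus R, and at each of its edges inside the other coatom of
   the edge: hence the complement of R is seen as one piece from R. *)
Lemma coatom_complement_constant x y R K : x <= R -> cov R y -> rank y = rank x + 4 ->
  (forall u e, cov x u -> cov u e -> e <= y ->
     (forall a, cov x a -> a <= R -> ~~ (a <= e)) -> K u = K e) ->
  forall u v, cov x u -> cov x v -> u <= y -> v <= y -> ~~ (u <= R) -> ~~ (v <= R) ->
    K u = K v.
Proof.
move=> xR Ry rk Kloc.
have rR : rank R = rank x + 3 by move: rk; rewrite (cov_rank Ry); clear; lia.
(* The value of [K] at the vertices of an edge or a polygon that lie outside [R]. *)
pose K2 z := [exists u, [&& cov x u, u <= z, ~~ (u <= R) & K u]].
have K2_edge v e u : cov x v -> v <= R -> cov v e -> ~~ (e <= R) -> cov x u -> u <= e ->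
    u != v -> ~~ (u <= R) /\ K2 e = K u.
  move=> xv vR ve neR xu ue nuv.
  have nuR : ~~ (u <= R).
    by apply: contraNN neR => uR; apply: edge_le xv xu _ ve ue vR uR; rewrite eq_sym.
  split=> //; apply/existsP/idP => [[w /and4P[xw we nwR Kw]]|Ku]; last first.
    by exists u; rewrite xu ue nuR.
  have [u' [_ _ _ all]] := cov_other xv ve.
  case: (all u xu ue) nuv => [->|uu' _]; first by rewrite eqxx.
  by case: (all w xw we) nwR => [->|ww' _]; rewrite ?vR // uu' -ww'.
have claim1 v e e' : cov x v -> v <= R -> cov v e -> cov v e' -> e <= y -> e' <= y ->
    ~~ (e <= R) -> ~~ (e' <= R) -> K2 e = K2 e'.
  move=> xv vR ve ve' ey e'y neR ne'R.
  (* In the polygon [[v, y]] the coatom [R] is an edge with ends [e1] and [e2]; the edges at [v]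
     that leave [R] are the remaining vertices of this polygon. *)
  have vR' : v < R by apply: ltn_rank_le; rewrite // rR (cov_rank xv); clear; lia.
  have [e1 ve1 e1R] := ex_cov vR'.
  have ce1R : cov e1 R by apply: covI; rewrite // rR (cov_rank ve1) (cov_rank xv) addn3.
  have [e2 [ne2 ve2 e2R alle]] := cov_other ve1 ce1R.
  have off w : ~~ (w <= R) -> (w != e1) && (w != e2).
    by move=> nwR; apply/andP; split; apply: contraNneq nwR => -> //; exact: cov_le.
  have /andP[ee1 ee2] := off e neR; have /andP[e'e1 e'e2] := off e' ne'R.
  apply: (@polygon_minus_closed_edge _ _ v y e1 e2 R K2) => //.
  - by rewrite eq_sym.
  - exact: cov_le.
  - by rewrite rk (cov_rank xv) addSnnS.
  - move=> f P vf fP Py ne1P ne2P.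
    have nPR : ~~ (P <= R).
      apply: contraNN ne1P => PR; suff -> : P = R by [].
      by apply: eq_rank_le; rewrite // rR (cov_rank fP) (cov_rank vf) (cov_rank xv) addn3.
    (* [P] meets [R] in [v] only: a further common vertex would make the meet an edge of [R] at [v],
       hence [e1] or [e2], which are not below [P]. *)
    have outR w : cov x w -> w <= P -> w != v -> ~~ (w <= R).
      move=> xw wP nwv; apply/negP => wR.
      have vP := le_trans (cov_le vf) (cov_le fP).
      have := lexx (mt P R); rewrite le_mt => /andP[mP mR].
      have mltP : mt P R < P by rewrite lt_neqAle mP andbT; apply: contraNneq nPR => <-.
      have vm : v <= mt P R by rewrite le_mt vP vR.
      have wm : w <= mt P R by rewrite le_mt wP wR.
      have vm' : v < mt P R.
        by rewrite lt_neqAle vm andbT; apply: contraNneq nwv => vmE; rewrite -(cov_neq xw xv) vmE.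
      have cvm : cov v (mt P R).
        rewrite /cov vm'; move: (ltn_rank vm') (ltn_rank mltP).
        by rewrite (cov_rank fP) (cov_rank vf); clear; lia.
      by case: (alle _ cvm mR) mP => ->; apply/negP.
    have [u [nu xu uf _]] := cov_other xv vf.
    have nfR : ~~ (f <= R) by apply: contraNN (outR u xu _ nu) => [/(le_trans (cov_le uf))//|];
      exact: le_trans (cov_le uf) (cov_le fP).
    have [nuR ->] := K2_edge v f u xv vR vf nfR xu (cov_le uf) nu.
    have uP := le_trans (cov_le uf) (cov_le fP).
    apply/idP/existsP => [Ku|[w /and4P[xw wP nwR Kw]]]; first by exists u; rewrite xu uP nuR.
    rewrite -(@polygon_minus_atom _ _ x P v K _ _ xv _ _ w u) //.
    + exact: le_trans (cov_le xu) uP.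
    + by rewrite (cov_rank fP) (cov_rank vf) (cov_rank xv) addn3.
    + exact: le_trans (cov_le vf) (cov_le fP).
    + move=> t g xt tg gP nvg; apply: Kloc => //; first exact: le_trans gP Py.
      move=> a xa aR; have [->//|nav] := eqVneq a v.
      by apply: contraTN aR => ag; apply: outR => //; exact: le_trans ag gP.
    + by apply: contraNneq nwR => ->.
pose kk v := [exists e, [&& cov v e, e <= y, ~~ (e <= R) & K2 e]].
have kkE v e : cov x v -> v <= R -> cov v e -> e <= y -> ~~ (e <= R) -> kk v = K2 e.
  move=> xv vR ve ey neR; apply/existsP/idP => [[f /and4P[vf fy nfR Kf]]|Ke].
    by rewrite (claim1 v e f).
  by exists e; rewrite ve ey neR.
(* The second coatom [P] over [f] meets [R] exactly in [f]. Its boundary without the closed edge [f]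
   is connected and contains the far end of an edge leaving [R] at either end of [f]. *)
have claim2 v v' f : cov x v -> cov x v' -> v' != v -> cov v f -> cov v' f -> f <= R ->
    kk v = kk v'.
  move=> xv xv' nvv' vf v'f fR.
  have cfR : cov f R by apply: covI; rewrite // rR (cov_rank vf) (cov_rank xv) addn3.
  have [P [nPR fP Py _]] := cov_other cfR Ry.
  have mf : mt P R = f.
    apply/esym/eq_rank_le; first by rewrite le_mt fR cov_le.
    have := ltn_rank (coatom_meet_lt Py Ry nPR).
    have : f <= mt P R by rewrite le_mt fR cov_le.
    by move/leq_rank; rewrite (cov_rank fP); clear; lia.
  have outR w : cov x w -> w <= P -> w <= R -> w = v \/ w = v'.
    move=> xw wP wR; have wf : w <= f by rewrite -mf le_mt wP.
    have [u' [_ _ _ all]] := cov_other xv vf.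
    have := all w xw wf; have := all v' xv' (cov_le v'f).
    by case=> [vv'|->]; first by rewrite vv' eqxx in nvv'.
  have step t t' : cov x t -> cov x t' -> t' != t -> cov t f -> cov t' f ->
      exists u, [/\ cov x u, u <= P, u != t, u != t' & kk t = K u].
    move=> xt xt' ntt' tf t'f; have [e [nef te eP _]] := cov_other tf fP.
    have tR := le_trans (cov_le tf) fR.
    have neR : ~~ (e <= R).
      apply: contraNN nef => eR; have ef : e <= f by rewrite -mf le_mt eR cov_le.
      by rewrite -(cov_neq te tf).
    have [u [nut xu ue _]] := cov_other xt te.
    have [nuR Ku] := K2_edge t e u xt tR te neR xu (cov_le ue) nut.
    exists u; split=> //; first exact: le_trans (cov_le ue) (cov_le eP).
      by apply: contraNneq nuR => ->; exact: le_trans (cov_le t'f) fR.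
    by rewrite (kkE t e) // (le_trans (cov_le eP) (cov_le Py)).
  have nv'v : v != v' by rewrite eq_sym.
  have [u [xu uP nuv nuv' ->]] := step v v' xv xv' nvv' vf v'f.
  have [u' [xu' u'P nu'v' nu'v ->]] := step v' v xv' xv nv'v v'f vf.
  apply: (@polygon_minus_closed_edge _ _ x P v v' f K) => //; rewrite ?cov_le //.
    by rewrite (cov_rank fP) (cov_rank vf) (cov_rank xv) addn3.
  move=> w e xw we eP nve nv'e; apply: Kloc => //; first exact: le_trans eP (cov_le Py).
  move=> a xa aR; apply: contraNN nve => ae.
  case: (outR a xa (le_trans ae eP) aR) => aE; first by rewrite -aE.
  by rewrite aE (negbTE nv'e) in ae.
have xltR : x < R by apply: ltn_rank_le; rewrite // rR; clear; lia.
have [v0 xv0 v0R] := ex_cov xltR.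
have kkc v : cov x v -> v <= R -> kk v = kk v0.
  move=> xv vR; pose k z := [exists w, [&& cov x w, w <= z & kk w]].
  have kE w : cov x w -> k w = kk w.
    move=> xw; apply/existsP/idP => [[w' /and3P[xw' ]]|kw]; last by exists w; rewrite xw lexx.
    by rewrite (cov_neq xw' xw) => /eqP->.
  rewrite -!kE //; apply: (@graph_constant _ _ x R k) => // w f xw wf fR; rewrite kE //.
  apply/idP/existsP => [kw|[w' /and3P[xw' w'f kw']]]; first by exists w; rewrite xw cov_le.
  have [-> //|nww'] := eqVneq w w'.
  have [t [_ _ tf all]] := cov_other xw wf.
  case: (all w' xw' w'f) => [ww'|w't]; first by rewrite ww' eqxx in nww'.
  by rewrite (claim2 w w' f) //; [rewrite eq_sym | rewrite w't].
move=> u v xu xv uy vy nuR nvR.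
pose touch z := [exists a, [&& cov x a, a <= R & a <= z]].
have touchE w : cov x w -> touch w = (w <= R).
  move=> xw; apply/existsP/idP => [[a /and3P[xa aR]]|wR]; last by exists w; rewrite xw wR lexx.
  by rewrite (cov_neq xa xw) => /eqP <-.
(* Contracting [R] to one point: everything that touches it takes the common outward value, and
   connectedness of the full graph applies. *)
pose K' z := if touch z then kk v0 else K z.
have K'E w : cov x w -> ~~ (w <= R) -> K' w = K w.
  by move=> xw; rewrite /K' touchE // => /negbTE->.
rewrite -!K'E //; apply: (@graph_constant _ _ x y K') => // w e xw we ey.
rewrite /K' touchE //; case wR: (w <= R).
  by have -> // : touch e by apply/existsP; exists w; rewrite xw wR; exact: cov_le.
case te: (touch e); last first.
  apply: Kloc => // a xa aR; apply: contraFN te => ae.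
  by apply/existsP; exists a; rewrite xa aR.
have /existsP[a /and3P[xa aR ae]] := te.
have ca : cov a e by apply: covI; rewrite // (cov_rank we) (cov_rank xw) (cov_rank xa).
have neR : ~~ (e <= R) by apply: contraFN wR; apply: le_trans; exact: cov_le.
have nwa : w != a by apply: contraFneq wR => ->.
have [_ <-] := K2_edge a e w xa aR ca neR xw (cov_le we) nwa.
by rewrite -(kkc a) // (kkE a e).
Qed.

End FacetComplement.

(** * Two-colouring of flags *)

Section BoolSums.
Local Open Scope ring_scope.
Context {T : finType}.
Implicit Types (A : {set T}) (f : T -> bool).

Lemma addr_bool (a b : bool) : a + b = a (+) b. Proof. by []. Qed.
Lemma mulr_bool (a b : bool) : a * b = a && b. Proof. by []. Qed.

Lemma sum_bool_odd A f : \sum_(x in A) f x = odd #|[set x in A | f x]|.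
Proof.
rewrite -sum1_card; have -> : (\sum_(x in [set x in A | f x]) 1 = \sum_(x in A) f x)%N.
  rewrite big_mkcond [RHS]big_mkcond /=; apply: eq_bigr => x _.
  by rewrite inE; case: (x \in A); case: (f x).
elim/big_ind2: _ => // [a m b n -> ->|x _]; first by rewrite oddD.
by case: (f x).
Qed.

Lemma sum_delta A f a : a \in A -> \sum_(x in A) (x == a) * f x = f a.
Proof.
move=> aA; rewrite (bigD1 a) //= eqxx mul1r big1 ?addr0 // => x /andP[_ /negbTE->].
exact: mul0r.
Qed.

Lemma sum_pair A f (m : T -> bool) a b : a != b -> [set x in A | m x] = [set a; b] ->
  \sum_(x in A) f x * m x = f a + f b.
Proof.
move=> nab mE; transitivity (\sum_(x in [set a; b]) f x).
  rewrite -mE big_mkcond [RHS]big_mkcond /=; apply: eq_bigr => x _; rewrite inE.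
  by case: (x \in A) => //=; case: (m x); rewrite ?mulr1 ?mulr0.
by rewrite big_setU1 ?inE // big_set1.
Qed.

End BoolSums.

Section FlagColouring.
Local Open Scope order_scope.
Context {d : Order.disp_t} {L : eulerianLattice d}.
Implicit Types (x y z u v e r c a : L).

(** The parity classes of the closed interval are equinumerous, so its size is even, and the two
    ends are then removed. *)
Lemma odd_card_open x y : x < y -> odd #|[set z | x < z < y]| = false.
Proof.
move=> xy; have /forallP/(_ x)/forallP/(_ y) := EL_eulerian L; rewrite xy => /eqP NE.
have : odd #|[set z : L | x <= z <= y]| = false.
  rewrite -(cardsID [set z : L | odd (rank z)]).
  rewrite (_ : _ :&: _ = [set z : L | (x <= z <= y) && odd (rank z)]); last first.
    by apply/setP => z; rewrite !inE.
  rewrite NE (_ : _ :\: _ = [set z : L | (x <= z <= y) && ~~ odd (rank z)]); last first.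
    by apply/setP => z; rewrite !inE andbC.
  by rewrite addnn odd_double.
rewrite (cardsD1 x) (cardsD1 y) !inE !lexx (ltW xy) (gt_eqF xy) /=.
rewrite negbK add0n => <-; congr (odd _); apply: eq_card => z; rewrite !inE.
by rewrite !lt_neqAle [x == z]eq_sym; case: (z == x); case: (z == y); rewrite //= ?andbF.
Qed.

Context {x y : L} (xy : x <= y) (rk : rank y = rank x + 4).

(** The order complex of the open interval: [S], [E2] and [F3] are its vertices, edges and
    triangles, [dE] and [dF] its boundary maps modulo 2. *)
Let S : {set L} := [set z | x < z < y].
Let E2 : {set L * L} := [set p | [&& x < p.1, p.1 < p.2 & p.2 < y]].
Let flag (f : L * L * L) :=
  [&& cov x f.1.1, cov f.1.1 f.1.2, cov f.1.2 f.2 & cov f.2 y].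
Let F3 : {set L * L * L} := [set f | flag f].
Let dE (p : L * L) z : bool := ((p.1 == z) + (p.2 == z))%R.
Let dF (f : L * L * L) (p : L * L) : bool :=
  ((p == (f.1.1, f.1.2)) + (p == (f.1.2, f.2)) + (p == (f.1.1, f.2)))%R.

Let flagP v e r : flag (v, e, r) ->
  [/\ cov x v, cov v e, cov e r & cov r y].
Proof. by case/and4P. Qed.

Let flag_lt v e r : flag (v, e, r) -> [/\ x < v, v < e, e < r & r < y].
Proof. by case/flagP => /cov_lt ? /cov_lt ? /cov_lt ? /cov_lt. Qed.

Let ranks v e r : flag (v, e, r) ->
  [/\ rank v = rank x + 1, rank e = rank x + 2 & rank r = rank x + 3].
Proof.
case/flagP => /cov_rank rv /cov_rank re /cov_rank rr _.
by rewrite rr re rv addn1 addn2 addn3.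
Qed.

Let dFE v e r v' e' r' : flag (v, e, r) -> flag (v', e', r') ->
  [/\ dF (v', e', r') (v, e) = ((v', e') == (v, e)),
      dF (v', e', r') (e, r) = ((e', r') == (e, r))
    & dF (v', e', r') (v, r) = ((v', r') == (v, r))].
Proof.
move=> /ranks[rv re rr] /ranks[rv' re' rr']; rewrite /dF /= !xpair_eqE.
have n (a b : L) i j : rank a = rank x + i -> rank b = rank x + j -> i != j -> (a == b) = false.
  by move=> ra rb; apply: contraNF => /eqP ab; move: ra; rewrite ab rb => /addnI ->.
rewrite (n v e' _ _ rv re') // (n e r' _ _ re rr') // (n e v' _ _ re rv') //.
rewrite (n r e' _ _ rr re') // !andbF /= !addr0 ?add0r.
by split; congr (_ && _); exact: eq_sym.
Qed.

(** The diamond property puts every edge of the order complex in exactly two triangles; this lemma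
    and the next two treat the three kinds of edges. *)
Let sum_ve (h : L * L * L -> bool) v e r r' : r' != r -> flag (v, e, r) -> flag (v, e, r') ->
  (\sum_(f in F3) h f * dF f (v, e) = h (v, e, r) + h (v, e, r'))%R.
Proof.
move=> nrr' fr fr'; apply: sum_pair; first by rewrite xpair_eqE eqxx eq_sym.
have [xv ve er ry] := flagP fr; have [_ _ er' r'y] := flagP fr'.
have [t [_ _ _ all]] := cov_other er ry.
have r't : r' = t by case: (all r' er' (cov_le r'y)) nrr' => [->|//]; rewrite eqxx.
apply/setP => -[[v' e'] s]; rewrite !inE; apply/andP/orP => [[fs]|[]/eqP->].
- have [-> _ _] := dFE fr fs; have [_ _ e's sy] := flagP fs.
  move=> /eqP[v'v e'e]; move: fs e's; rewrite v'v e'e => fs es.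
  by case: (all s es (cov_le sy)) => ->; rewrite ?r't eqxx; [left|right].
- by rewrite fr; have [-> _ _] := dFE fr fr.
- by rewrite fr'; have [-> _ _] := dFE fr fr'.
Qed.

Let sum_vr (h : L * L * L -> bool) v e e' r : e' != e -> flag (v, e, r) -> flag (v, e', r) ->
  (\sum_(f in F3) h f * dF f (v, r) = h (v, e, r) + h (v, e', r))%R.
Proof.
move=> nee' fe fe'; apply: sum_pair; first by rewrite !xpair_eqE !eqxx andbT eq_sym.
have [xv ve er ry] := flagP fe; have [_ ve' e'r _] := flagP fe'.
have [t [_ _ _ all]] := cov_other ve er.
have e't : e' = t by case: (all e' ve' (cov_le e'r)) nee' => [->|//]; rewrite eqxx.
apply/setP => -[[v' s] r']; rewrite !inE; apply/andP/orP => [[fs]|[]/eqP->].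
- have [_ _ ->] := dFE fe fs; have [_ v's sr' _] := flagP fs.
  move=> /eqP[v'v r'r]; move: fs v's sr'; rewrite v'v r'r => fs vs sr.
  by case: (all s vs (cov_le sr)) => ->; rewrite ?e't eqxx; [left|right].
- by rewrite fe; have [_ _ ->] := dFE fe fe.
- by rewrite fe'; have [_ _ ->] := dFE fe fe'.
Qed.

Let sum_er (h : L * L * L -> bool) v v' e r : v' != v -> flag (v, e, r) -> flag (v', e, r) ->
  (\sum_(f in F3) h f * dF f (e, r) = h (v, e, r) + h (v', e, r))%R.
Proof.
move=> nvv' fv fv'; apply: sum_pair; first by rewrite !xpair_eqE !eqxx !andbT eq_sym.
have [xv ve er ry] := flagP fv; have [xv' v'e _ _] := flagP fv'.
have [t [_ _ _ all]] := cov_other xv ve.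
have v't : v' = t by case: (all v' xv' (cov_le v'e)) nvv' => [->|//]; rewrite eqxx.
apply/setP => -[[s e'] r']; rewrite !inE; apply/andP/orP => [[fs]|[]/eqP->].
- have [_ -> _] := dFE fv fs; have [xs se' _ _] := flagP fs.
  move=> /eqP[e'e r'r]; move: fs se'; rewrite e'e r'r => fs se.
  by case: (all s xs (cov_le se)) => ->; rewrite ?v't eqxx; [left|right].
- by rewrite fv; have [_ -> _] := dFE fv fv.
- by rewrite fv'; have [_ -> _] := dFE fv fv'.
Qed.

Let two_r v e : cov x v -> cov v e -> e <= y -> exists r r',
  [/\ r' != r, flag (v, e, r), flag (v, e, r')
    & forall s, flag (v, e, s) -> s = r \/ s = r'].
Proof.
move=> xv ve ey; have ey' : e < y.
  by apply: ltn_rank_le; rewrite // rk (cov_rank ve) (cov_rank xv) -addn2 ltn_add2l.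
have [r er ry] := ex_cov ey'.
have cry : cov r y by apply: covI; rewrite // rk (cov_rank er) (cov_rank ve) (cov_rank xv) addn4.
have [r' [nr' er' r'y all]] := cov_other er cry.
exists r, r'; split=> // [||s /flagP[_ _ es sy]]; [exact/and4P | exact/and4P |].
exact: all (cov_le sy).
Qed.

(** A 2-cycle is invariant under flips. Flips that keep the middle element make it a function of
    that element, the graph of [[v, y]] makes it a function of the vertex [v], and the graph of
    [[x, y]] makes it constant. *)
Let const_flag (h : L * L * L -> bool) :
  {in E2, forall p, (\sum_(f in F3) h f * dF f p = 0)%R} -> {in F3 &, forall f g, h f = h g}.
Proof.
move=> h0.
have eqb (a b : bool) : (a + b = 0)%R -> a = b by case: a; case: b.
have h_r v e r r' : flag (v, e, r) -> flag (v, e, r') -> h (v, e, r) = h (v, e, r').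
  move=> f f'; have [->//|nr] := eqVneq r' r; apply: eqb; rewrite -sum_ve //; apply: h0.
  by rewrite inE /=; have [-> -> er ry] := flag_lt f; exact: lt_trans ry.
have h_e v e e' r : flag (v, e, r) -> flag (v, e', r) -> h (v, e, r) = h (v, e', r).
  move=> f f'; have [->//|nr] := eqVneq e' e; apply: eqb; rewrite -(sum_vr _ nr f f'); apply: h0.
  by rewrite inE /=; have [-> ve er ->] := flag_lt f; rewrite (lt_trans ve).
have h_v v v' e r : flag (v, e, r) -> flag (v', e, r) -> h (v, e, r) = h (v', e, r).
  move=> f f'; have [->//|nr] := eqVneq v' v; apply: eqb; rewrite -(sum_er _ nr f f'); apply: h0.
  by rewrite inE /=; have [xv ve -> ->] := flag_lt f; rewrite (lt_trans xv).
pose k e := [exists f, [&& flag f, f.1.2 == e & h f]].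
have kE v e r : flag (v, e, r) -> k e = h (v, e, r).
  move=> f; apply/existsP/idP => [[[[v' e'] r'] /and3P[f' /eqP/= e'e]]|hf]; last first.
    by exists (v, e, r); rewrite f eqxx.
  rewrite e'e in f' *; have fm : flag (v', e, r).
    by have [? ? _ _] := flagP f'; have [_ _ ? ?] := flagP f; apply/and4P.
  by rewrite (h_r v' e r' r) // (h_v v' v).
have kv v e e' : cov x v -> cov v e -> cov v e' -> e <= y -> e' <= y -> k e = k e'.
  move=> xv ve ve' ey e'y.
  pose K z := if rank z == rank x + 2 then k z else [exists t, [&& cov v t, t <= z & k t]].
  have rE t : cov v t -> rank t == rank x + 2.
    by move=> vt; rewrite (cov_rank vt) (cov_rank xv) addn2.
  have KE t : cov v t -> K t = k t by move=> vt; rewrite /K rE.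
  rewrite -!KE //; apply: (@graph_constant _ _ v y K) => // t r vt tr ry.
  have cry : cov r y.
    by apply: covI; rewrite // rk (cov_rank tr) (cov_rank vt) (cov_rank xv) addn4.
  have ft : flag (v, t, r) by apply/and4P.
  rewrite KE // /K ifN; last by rewrite (cov_rank tr) (eqP (rE _ vt)) gtn_eqF.
  apply/idP/existsP => [kt|[t' /and3P[vt' t'r kt']]]; first by exists t; rewrite vt kt cov_le.
  have ft' : flag (v, t', r).
    apply/and4P; split=> //=; apply: covI => //.
    by rewrite (cov_rank tr) (eqP (rE _ vt)) (eqP (rE _ vt')).
  by rewrite (kE v t r) // (h_e v t t' r) // -(kE v t' r).
pose K z := [exists e, [&& cov z e, e <= y & k e]].
have KE v e : cov x v -> cov v e -> e <= y -> K v = k e.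
  move=> xv ve ey; apply/existsP/idP => [[e' /and3P[ve' e'y ke']]|ke]; last first.
    by exists e; rewrite ve ey.
  by rewrite (kv v e e').
have Kconst v v' : cov x v -> cov x v' -> v <= y -> v' <= y -> K v = K v'.
  pose K' z := if rank z == rank x + 1 then K z else k z.
  have K'E w : cov x w -> K' w = K w by move=> xw; rewrite /K' (cov_rank xw) addn1 eqxx.
  move=> xv xv' vy v'y; rewrite -!K'E //; apply: (@graph_constant _ _ x y K') => // w e xw we ey.
  rewrite K'E // (KE w e) // /K' ifN // (cov_rank we) (cov_rank xw).
  by rewrite -addn2 eqn_add2l.
move=> [[v e] r] [[v' e'] r']; rewrite !inE => f f'.
have [xv ve er ry] := flagP f; have [xv' ve' er' ry'] := flagP f'.
have ey := le_trans (cov_le er) (cov_le ry); have e'y := le_trans (cov_le er') (cov_le ry').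
rewrite -(kE v e r) // -(kE v' e' r') // -(KE v e) // -(KE v' e') //; apply: Kconst => //.
  exact: le_trans (cov_le ve) ey.
exact: le_trans (cov_le ve') e'y.
Qed.

Let lev_cov2 a b z : rank b = rank a + 2 -> (z \in lev a b (rank a + 1)) = cov a z && cov z b.
Proof.
move=> rb; rewrite -(between_cov _ rb); apply/levP/andP => [[az zb rz]|[az zb]].
  by split; apply: ltn_rank_le; rewrite // ?rb rz ?ltn_add2l // addn1.
by split; rewrite ?ltW //; move: (ltn_rank az) (ltn_rank zb); rewrite rb; clear; lia.
Qed.

Let card_open a b : a < b ->
  #|[set z | a < z < b]| + 2 = \sum_(k < (rank b - rank a).+1) #|lev a b (rank a + k)|.
Proof.
move=> ab; rewrite -(card_lev_sum a b xpredT).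
pose C := [set z : L | a <= z <= b].
transitivity #|C|; last by apply: eq_card => z; rewrite !inE andbT.
rewrite (cardsD1 a C) (cardsD1 b (C :\ a)) !inE !lexx (ltW ab) (gt_eqF ab) /=.
rewrite addnA addnC; congr (_ + _)%N; apply: eq_card => z; rewrite !inE.
by rewrite !lt_neqAle [a == z]eq_sym; case: (z == a); case: (z == b); rewrite //= ?andbF.
Qed.

Let mem_lev2 e : (e \in lev x y (rank x + 2)) = [exists f, flag f && (f.1.2 == e)].
Proof.
apply/idP/existsP => [/levP[xe ey re]|[[[v e'] r] /andP[f /eqP/= <-]]]; last first.
  have [xv ve er ry] := flagP f; have [_ re _] := ranks f; apply/levP; split=> //.
    exact: le_trans (cov_le xv) (cov_le ve).
  exact: le_trans (cov_le er) (cov_le ry).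
have xlt : x < e by apply: ltn_rank_le; rewrite // re addn2 ltnS leqnSn.
have [v xv ve] := ex_cov xlt.
have cve : cov v e by apply: covI; rewrite // re (cov_rank xv) addn2.
have [r [_ [_ f _ _]]] := two_r xv cve ey.
by exists (v, e, r); rewrite f eqxx.
Qed.

(** A middle element is completed by one of two elements below it and one of two above it. *)
Let card_flags : #|F3| = 4 * #|lev x y (rank x + 2)|.
Proof.
have -> : #|F3| = \sum_v \sum_e \sum_r flag (v, e, r).
  rewrite pair_big pair_big /= -sum1_card big_mkcond /=.
  by apply: eq_bigr => -[[v e] r] _; rewrite inE; case: (flag _).
rewrite exchange_big mulnC -sum_nat_const [RHS]big_mkcond /=; apply: eq_bigr => e _.
case: ifPn => [|ne]; last first.
  rewrite big1 // => v _; rewrite big1 // => r _; apply/eqP; rewrite eqb0.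
  by apply: contra ne => f; rewrite mem_lev2; apply/existsP; exists (v, e, r); rewrite f eqxx.
move=> /levP[xe ey re].
have ry : rank y = rank e + 2 by rewrite rk re -addnA.
transitivity ((\sum_v (cov x v && cov v e)) * (\sum_r (cov e r && cov r y)))%N.
  rewrite big_distrlr /=; apply: eq_bigr => v _; apply: eq_bigr => r _.
  by rewrite mulnb /flag /= !andbA.
rewrite -[RHS]/(2 * 2)%N; congr (_ * _)%N.
  rewrite -[RHS](card_lev2 xe re) -sum1_card [RHS]big_mkcond /=; apply: eq_bigr => v _.
  by rewrite (lev_cov2 _ re); case: (_ && _).
rewrite -[RHS](card_lev2 ey ry) -sum1_card [RHS]big_mkcond /=; apply: eq_bigr => r _.
by rewrite (lev_cov2 _ ry); case: (_ && _).
Qed.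

Let sum_nat_card (T : finType) (A : {set T}) : #|A| = \sum_t (t \in A).
Proof. by rewrite -sum1_card big_mkcond; apply: eq_bigr => t _; case: (t \in A). Qed.

(** Sorted by the larger member [b]: an atom contributes nothing, a middle element its two atoms, a
    coatom twice the number of its edges. Each edge lies in two coatoms, whence 2 + 4 = 6. *)
Let card_two_chains : #|E2| = 6 * #|lev x y (rank x + 2)|.
Proof.
have -> : #|E2| = \sum_(b in S) #|[set a | x < a < b]%O|.
  rewrite sum_nat_card [RHS]big_mkcond /=; under [RHS]eq_bigr => b _ do rewrite sum_nat_card.
  transitivity (\sum_a \sum_b ((a, b) \in E2)).
    by rewrite pair_big /=; apply: eq_bigr => -[a b].
  rewrite exchange_big /=; apply: eq_bigr => b _; rewrite inE; case: ifPn => [/andP[xb by_]|nb].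
    by apply: eq_bigr => a _; rewrite !inE /= by_ andbT.
  rewrite big1 // => a _; rewrite inE /=; apply/eqP; rewrite eqb0; apply: contra nb.
  by case/and3P=> xa ab ->; rewrite (lt_trans xa ab).
transitivity (\sum_(b in S) (2 * (b \in lev x y (rank x + 2)) +
   2 * \sum_e ((b \in lev x y (rank x + 3)) && (e \in lev x b (rank x + 2))))).
  apply: eq_bigr => b; rewrite inE => /andP[xb yb].
  have N := card_open xb; have B := card_lev_bot (ltW xb); have T := card_lev_top (ltW xb).
  have := ltn_rank xb; have := ltn_rank yb; rewrite rk => r1 r2.
  rewrite !inE (ltW xb) (ltW yb) /=.
  have [rb|[rb|rb]] : rank b = rank x + 1 \/ rank b = rank x + 2 \/ rank b = rank x + 3.
  - by move: r1 r2; clear; lia.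
  - move: N; rewrite rb addKn !big_ord_recl big_ord0 /= /bump !leq0n !add1n -rb !addn0 B T.
    by rewrite rb !eqn_add2l [\sum_e _]big1 //; clear; lia.
  - move: N; rewrite rb addKn !big_ord_recl big_ord0 /= /bump !leq0n !add1n -rb !addn0 B T.
    by rewrite (card_lev2 (ltW xb) rb) rb !eqn_add2l [\sum_e _]big1 //; clear; lia.
  move: N; rewrite rb addKn !big_ord_recl big_ord0 /= /bump !leq0n !add1n -rb !addn0 B T.
  have E := sum_nat_card (lev x b (rank x + 2)).
  rewrite (card_lev3 (ltW xb) rb) rb !eqn_add2l /= E => {}N.
  apply: (@addIn 2); apply: (etrans N); clear.
  by move: (\sum_t _) => k; lia.
rewrite big_split -!big_distrr /= -[6]/(2 + 4)%N mulnDl; congr (_ + _)%N.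
  rewrite big_mkcond sum_nat_card; congr (2 * _)%N; apply: eq_bigr => b _.
  case: ifPn => //; rewrite inE => nb; apply/esym/eqP; rewrite eqb0; apply: contra nb.
  case/levP=> xb yb rb; apply/andP; split; apply: ltn_rank_le; rewrite // rb ?rk.
    by clear; lia.
  by clear; lia.
rewrite -[4]/(2 * 2)%N -mulnA; congr (2 * _)%N; rewrite exchange_big /=.
rewrite mulnC -sum_nat_const [RHS]big_mkcond /=; apply: eq_bigr => e _.
case: ifPn => [/levP[xe ey re]|ne]; last first.
  rewrite big1 // => b _; apply/eqP; rewrite eqb0; apply: contra ne.
  by case/andP=> /levP[_ yb _] /levP[xe eb re]; apply/levP; rewrite (le_trans eb yb).
have ry : rank y = rank e + 2 by rewrite rk re -addnA.
rewrite -[RHS](card_lev2 ey ry) sum_nat_card big_mkcond; apply: eq_bigr => b _.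
have -> : (b \in lev x y (rank x + 3)) && (e \in lev x b (rank x + 2))
    = (b \in lev e y (rank e + 1)).
  apply/andP/levP => [[/levP[xb yb rb] /levP[_ eb _]]|[eb yb rb]].
    by split=> //; rewrite rb re -addnA.
  by split; apply/levP; split; rewrite ?(le_trans xe eb) // rb re -addnA.
rewrite inE; case: ifPn => // nb; apply/esym/eqP; rewrite eqb0; apply: contra nb.
case/levP=> eb yb rb; apply/andP; split; apply: ltn_rank_le => //.
- exact: le_trans eb.
- by rewrite rb re; clear; lia.
- by rewrite rb re rk; clear; lia.
Qed.

(** With m elements in the middle level there are 4m triangles, 6m edges and, by [card_lev4], 2m + 2
    vertices. *)
Let euler_count : (#|F3| + #|S| = #|E2| + 2)%N.
Proof.
have xlty : x < y by apply: ltn_rank_le; rewrite // rk; clear; lia.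
have := card_open xlty; rewrite rk addKn !big_ord_recl big_ord0 /= /bump !leq0n !add1n.
rewrite -rk !addn0 card_lev_bot // card_lev_top // card_flags card_two_chains.
have := card_lev4 xy rk; rewrite -/S; clear.
by move: #|S| #|lev x y (rank x + 1)| #|lev x y (rank x + 2)| #|lev x y (rank x + 3)|; lia.
Qed.

(** The sum of all edges of the order complex is a cycle, because each vertex has an even number of
    neighbours both below and above. It bounds a set [w] of triangles, and of the two triangles at
    an edge exactly one belongs to [w]. *)
Lemma flag_colouring : exists w : L -> L -> L -> bool, [/\
  forall v e r r', cov x v -> cov v e -> cov e r -> cov e r' -> cov r y -> cov r' y ->
    r' != r -> w v e r' = ~~ w v e r,
  forall v e e' r, cov x v -> cov v e -> cov v e' -> cov e r -> cov e' r -> cov r y ->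
    e' != e -> w v e' r = ~~ w v e r
& forall v v' e r, cov x v -> cov x v' -> cov v e -> cov v' e -> cov e r -> cov r y ->
    v' != v -> w v' e r = ~~ w v e r].
Proof.
have d_dE (h : L -> bool) p : p \in E2 -> (\sum_(z in S) dE p z * h z = h p.1 + h p.2)%R.
  rewrite inE => /and3P[xp pp py].
  under eq_bigr => z _ do rewrite mulrDl ![_ == z]eq_sym.
  by rewrite big_split /= !sum_delta // inE ?xp ?py ?(lt_trans xp pp) ?(lt_trans pp py).
have cond1 : {in F3 & S, forall f z, (\sum_(p in E2) dF f p * dE p z = 0)%R}.
  move=> [[v e] r] z; rewrite !inE => f _; rewrite /dF /=.
  have [xv ve er ry] := flag_lt f.
  under eq_bigr => p _ do rewrite !mulrDl.
  rewrite !big_split /= !sum_delta ?inE /= ?xv ?ve ?er ?ry ?(lt_trans xv ve) ?(lt_trans er ry) //.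
    by rewrite /dE /=; case: (v == z); case: (e == z); case: (r == z).
  by rewrite (lt_trans ve er).
have cond3 (h : L -> bool) : {in E2, forall p, (\sum_(z in S) dE p z * h z = 0)%R} ->
    {in S &, forall u v, h u = h v}.
  move=> h0 u v; rewrite !inE; apply: interval_constant xy _ _ _ _.
    by rewrite rk leq_add2l.
  move=> a b xa ab bY; have := h0 (a, b); rewrite d_dE inE /= xa ab bY // => /(_ isT).
  by case: (h a); case: (h b).
have cond4 : {in S, forall z, (\sum_(p in E2) true * dE p z = 0)%R}.
  move=> z; rewrite inE => /andP[xz zy]; rewrite /dE.
  under eq_bigr => p _ do rewrite mul1r.
  rewrite big_split /= !sum_bool_odd.
  rewrite (_ : #|_| = #|[set b | z < b < y]|); last first.
    rewrite -[RHS](card_imset _ (_ : injective (fun b => (z, b)))); last by move=> b b' [].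
    apply: eq_card => -[a b]; rewrite !inE /=; apply/andP/imsetP => [[/and3P[_ ab bY] /eqP<-]|].
      by exists b; rewrite // inE ab.
    by case=> c; rewrite inE => /andP[zc cy] [-> ->]; rewrite xz zc cy.
  rewrite (_ : #|[set p in E2 | p.2 == z]| = #|[set a | x < a < z]|); last first.
    rewrite -[RHS](card_imset _ (_ : injective (fun a => (a, z)))); last by move=> b b' [].
    apply: eq_card => -[a b]; rewrite !inE /=; apply/andP/imsetP => [[/and3P[xa ab _] /eqP bz]|].
      by exists a; rewrite ?inE ?xa -?bz.
    by case=> c; rewrite inE => /andP[zc cy] [-> ->]; rewrite zy zc cy.
  by rewrite !odd_card_open.
have [w wE] := chain_complex_exact cond1 const_flag cond3 euler_count cond4.
have neg (a b : bool) : true = (a + b)%R -> b = ~~ a by case: a; case: b.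
exists (fun v e r => w (v, e, r)); split.
- move=> v e r r' xv ve er er' ry r'y nr.
  have f : flag (v, e, r) by apply/and4P.
  have f' : flag (v, e, r') by apply/and4P.
  apply: neg; rewrite -sum_ve //; apply: wE.
  by rewrite inE /=; have [-> -> ? ?] := flag_lt f; exact: lt_trans (cov_lt ry).
- move=> v e e' r xv ve ve' er e'r ry nr.
  have f : flag (v, e, r) by apply/and4P.
  have f' : flag (v, e', r) by apply/and4P.
  apply: neg; rewrite -(sum_vr _ nr f f'); apply: wE.
  by rewrite inE /=; have [-> vE ? ->] := flag_lt f; rewrite (lt_trans vE).
- move=> v v' e r xv xv' ve v'e er ry nr.
  have f : flag (v, e, r) by apply/and4P.
  have f' : flag (v', e, r) by apply/and4P.
  apply: neg; rewrite -(sum_er _ nr f f'); apply: wE.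
  by rewrite inE /=; have [xV vE -> ->] := flag_lt f; rewrite (lt_trans xV).
Qed.

End FlagColouring.

(** * Rotation systems *)

Section Rotations.
Context {T : finType} (G : graph T) (r : {perm T * T}).
Hypotheses (sG : simple_graph G) (rG : rotation G r).
Implicit Types (a b : T * T) (u v : T) (e : {set T}).

Notation fs := (face_step r).
Notation edge a := [set a.1; a.2].

Lemma in_darts a : (a \in darts G) = adj G a.1 a.2.
Proof. by rewrite inE. Qed.

Lemma adj_sym u v : adj G u v = adj G v u.
Proof. by rewrite /adj setUC. Qed.

Lemma adjP u v : adj G u v -> [/\ u != v, u \in verts G & v \in verts G].
Proof.
move=> uv; have /forall_inP/(_ _ uv)/andP[/subsetP sub] := sG; rewrite cards2.
have uG := sub u (set21 u v); have vG := sub v (set22 u v).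
by case: (u != v).
Qed.

Lemma edgeP e : e \in edges G -> exists2 a, a \in darts G & e = edge a.
Proof.
move=> eG; have /forall_inP/(_ e eG)/andP[_ /cards2P[u [v [_ ev]]]] := sG.
by exists (u, v); rewrite ?in_darts /adj -?ev.
Qed.

Lemma dart_rev a : ((a.2, a.1) \in darts G) = (a \in darts G).
Proof. by rewrite !in_darts adj_sym. Qed.

Lemma porbit_darts a : a \in darts G -> porbit r a = [set b in darts G | b.1 == a.1].
Proof. by move=> aG; have /forall_inP/(_ a aG)/eqP := rG. Qed.

Lemma mem_porbit1 a : r a \in porbit r a.
Proof. by have := mem_porbit r 1 a; rewrite expg1. Qed.

Lemma rot_dart a : (r a \in darts G) = (a \in darts G).
Proof.
apply/idP/idP => [raG|aG].
  have : a \in porbit r (r a) by rewrite porbit_sym mem_porbit1.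
  by rewrite porbit_darts // inE => /andP[].
have : r a \in porbit r a by exact: mem_porbit1.
by rewrite porbit_darts // inE => /andP[].
Qed.

Lemma rot_tail a : a \in darts G -> (r a).1 = a.1.
Proof.
move=> aG; have : r a \in porbit r a by exact: mem_porbit1.
by rewrite porbit_darts // inE => /andP[_ /eqP].
Qed.

(** The darts leaving a vertex form a single cycle of the rotation. *)
Lemma rot_constant (U : eqType) (k : T * T -> U) u :
  (forall a, a \in darts G -> a.1 = u -> k (r a) = k a) ->
  forall a b, a \in darts G -> b \in darts G -> a.1 = u -> b.1 = u -> k a = k b.
Proof.
move=> kr a b aG bG au bu.
have : b \in porbit r a by rewrite porbit_darts // inE bG au bu eqxx.
case/porbitP => i ->; elim: i => [|i IHi]; first by rewrite expg0 perm1.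
have : (r ^+ i)%g a \in porbit r a by exact: mem_porbit.
rewrite porbit_darts // inE => /andP[iG /eqP iu].
by rewrite expgSr permM kr // iu.
Qed.

Lemma rot_neq a : a \in darts G -> 1 < deg G a.1 -> r a != a.
Proof.
move=> aG; apply: contraTneq => ra; rewrite -leqNgt /deg.
rewrite -(cards1 (edge a)); apply: subset_leq_card; apply/subsetP => e.
rewrite !inE => /andP[eG ae]; have [b bG be] := edgeP eG.
wlog ba : b bG be / b.1 = a.1 => [wl|].
  move: ae; rewrite {1}be !inE => /orP[]/eqP ab; first exact: (wl b).
  by apply: (wl (b.2, b.1)); rewrite ?dart_rev //= setUC.
have : b \in porbit r a by rewrite porbit_darts // inE bG ba eqxx.
case/porbitP => i bi; rewrite be; have -> // : b = a.
by rewrite bi; elim: i {bi} => [|i IHi]; rewrite ?expg0 ?perm1 // expgSr permM IHi.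
Qed.

Lemma face_step_inj : injective fs.
Proof. by move=> [a b] [c d] /perm_inj[-> ->]. Qed.

Lemma face_step_dart a : (fs a \in darts G) = (a \in darts G).
Proof. by rewrite rot_dart dart_rev. Qed.

Lemma face_step_tail a : a \in darts G -> (fs a).1 = a.2.
Proof. by move=> aG; rewrite rot_tail // dart_rev. Qed.

Lemma rot_face_step a : r a = fs (a.2, a.1).
Proof. by case: a. Qed.

Lemma orbit_dart a b : a \in darts G -> b \in orbit fs a -> b \in darts G.
Proof.
move=> aG; have cl : fclosed fs (darts G) by move=> c c' /eqP <-; rewrite face_step_dart.
by rewrite -fconnect_orbit => /(closed_connect cl) <-.
Qed.

Lemma orbit_step a b : (fs b \in orbit fs a) = (b \in orbit fs a).
Proof.
rewrite -!fconnect_orbit; apply/idP/idP => [h|h].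
  apply: connect_trans h _; rewrite (fconnect_sym face_step_inj); exact: fconnect1.
apply: connect_trans h _; exact: fconnect1.
Qed.

Lemma orbit_constant (U : eqType) (k : T * T -> U) a b :
  (forall c, c \in darts G -> k (fs c) = k c) -> a \in darts G -> b \in orbit fs a -> k b = k a.
Proof.
move=> kf aG; rewrite -fconnect_orbit.
pose C := [pred c | (c \in darts G) && (k c == k a)].
have clC : fclosed fs C.
  move=> c c' /eqP <-; rewrite -[c \in C]/(_ && _) -[fs c \in C]/(_ && _) face_step_dart.
  by case cG: (c \in darts G); rewrite //= kf.
by move/(closed_connect clC); rewrite -[a \in C]/(_ && _) aG eqxx => /esym/andP[_ /eqP].
Qed.

Lemma region_root a : region_boundary r (froot fs a) = region_boundary r a.
Proof.
have E : orbit fs (froot fs a) =i orbit fs a.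
  move=> b; rewrite -!fconnect_orbit; apply: same_connect.
    exact: fconnect_sym face_step_inj.
  by rewrite (fconnect_sym face_step_inj) connect_root.
by congr (_, _); apply/setP => t;
  apply/imsetP/imsetP => -[b]; rewrite ?E => bo ->; exists b; rewrite ?E.
Qed.

(** One dart for each region, which gives regions a finite index set. *)
Definition face_roots := [set a in darts G | froots fs a].

Lemma root_face_roots a : a \in darts G -> froot fs a \in face_roots.
Proof.
move=> aG; rewrite inE roots_root ?andbT; last exact: fconnect_sym face_step_inj.
by apply: (@orbit_dart a) => //; rewrite -fconnect_orbit connect_root.
Qed.

Lemma card_face_roots : #|face_roots| = fcard fs (darts G).
Proof. by apply: eq_card => a; rewrite !inE andbC. Qed.

(** The boundary map sends at most [#|X|] regions onto a set containing [X], so it has no other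
    values. *)
Lemma region_boundaries_eq (X : {set graph T}) :
  (forall H, H \in X -> exists2 a, a \in darts G & region_boundary r a = H) ->
  fcard fs (darts G) <= #|X| ->
  forall a, a \in darts G -> region_boundary r a \in X.
Proof.
move=> XB le_card a aG.
have XS : X \subset [set region_boundary r b | b in face_roots].
  apply/subsetP => H /XB[b bG <-]; apply/imsetP; exists (froot fs b).
    exact: root_face_roots.
  by rewrite region_root.
have /eqP -> : X == [set region_boundary r b | b in face_roots].
  rewrite eqEcard XS; apply: leq_trans (leq_imset_card _ _) _.
  by rewrite card_face_roots.
by rewrite -region_root; apply: imset_f; exact: root_face_roots.
Qed.

End Rotations.

(** * Regions of an arbitrary rotation system of genus 0 *)

Section Whitney.
Local Open Scope ring_scope.
Context {T : finType} (G : graph T) (r : {perm T * T}).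
Hypotheses (sG : simple_graph G) (rG : rotation G r).
Hypothesis euler : (#|verts G| + fcard (face_step r) (darts G) = #|edges G| + 2)%N.
Hypothesis conG : forall K : T -> bool,
  (forall u v, adj G u v -> K u = K v) -> {in verts G &, forall u v, K u = K v}.
Hypothesis deg_gt1 : forall v, v \in verts G -> (1 < deg G v)%N.
Implicit Types (a b : T * T) (u v : T) (e : {set T}).

Notation fs := (face_step r).
Notation edge a := [set a.1; a.2].

Lemma dart_tail a : a \in darts G -> a.1 \in verts G.
Proof. by rewrite in_darts => /(adjP sG)[]. Qed.

Lemma dart_neq a : a \in darts G -> a.1 != a.2.
Proof. by rewrite in_darts => /(adjP sG)[]. Qed.

Lemma darts_of_edge a : a \in darts G ->
  [set b in darts G | edge b == edge a] = [set a; (a.2, a.1)].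
Proof.
move=> aG; apply/setP => b; rewrite inE in_set2.
apply/andP/orP => [[bG /eqP bE]|[]/eqP->]; last first.
- by rewrite dart_rev aG setUC.
- by rewrite aG.
have uv := dart_neq bG; have := set21 b.1 b.2; have := set22 b.1 b.2.
rewrite bE !in_set2; case: a b {aG bG bE} uv => a1 a2 [u v] /= uv vE uE.
case/orP: uE uv => /eqP->; case/orP: vE => /eqP->; rewrite ?eqxx // => _; [left | right] => //.
Qed.

(* The sphere has no first homology: a cycle modulo 2 bounds a set of faces. *)
Lemma even_edge_cut (u : {set T} -> bool) :
  {in verts G, forall v, \sum_(e in edges G) u e * (v \in e) = 0} ->
  exists2 w : T * T -> bool, (forall a, a \in darts G -> w (fs a) = w a) &
    forall a, a \in darts G -> w a (+) w (a.2, a.1) = u (edge a).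
Proof.
move=> u_even; pose rt := froot fs.
have fsym := fconnect_sym (@face_step_inj _ r).
have rt_fs a : rt (fs a) = rt a by apply/esym/eqP; rewrite (root_connect fsym) fconnect1.
pose dE e v : bool := v \in e.
(* Incidences are counted modulo 2: an edge with the same region on both sides contributes
   nothing. *)
pose dF a e : bool := \sum_(b in darts G) (rt b == a) * (edge b == e).
have d_dF (h : T * T -> bool) a : a \in darts G ->
    \sum_(f in face_roots G r) h f * dF f (edge a) = h (rt a) + h (rt (a.2, a.1)).
  move=> aG; have naG : a != (a.2, a.1).
    by apply/eqP => aE; have := dart_neq aG; rewrite {1}aE eqxx.
  rewrite -(sum_pair (fun b => h (rt b)) naG (darts_of_edge aG)).
  under eq_bigr => f _ do rewrite /dF mulr_sumr.
  rewrite exchange_big /=; apply: eq_bigr => b bG.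
  under eq_bigr => f _ do rewrite mulrCA mulrA -mulrA.
  have rbF : rt b \in face_roots G r by exact: root_face_roots.
  rewrite -(sum_delta (fun f => h f) rbF) mulr_suml; apply: eq_bigr => f _.
  by rewrite mulrA eq_sym.
have d_dE (h : T -> bool) a : a \in darts G ->
    \sum_(v in verts G) dE (edge a) v * h v = h a.1 + h a.2.
  move=> aG; under eq_bigr => v _ do rewrite mulrC.
  apply: sum_pair; first exact: dart_neq.
  apply/setP => v; rewrite inE /dE andbC; case: (boolP (v \in edge a)) => //.
  have a2 : a.2 \in verts G by rewrite -[a.2]/((a.2, a.1).1) dart_tail // dart_rev.
  by rewrite !inE => /orP[]/eqP->; rewrite ?dart_tail ?a2.
have dd : {in face_roots G r & verts G, forall f v, \sum_(e in edges G) dF f e * dE e v = 0}.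
  move=> f v _ _; under eq_bigr => e _ do rewrite /dF mulr_suml.
  rewrite exchange_big /=.
  transitivity (\sum_(b in darts G) (rt b == f) * ((b.1 == v) + (b.2 == v))).
    apply: eq_bigr => b bG; under eq_bigr => e _ do rewrite -mulrA [edge b == e]eq_sym.
    have eG : edge b \in edges G by move: bG; rewrite in_darts.
    rewrite -mulr_sumr (sum_delta (dE^~ v) eG); congr (_ * _).
    rewrite /dE !inE ![v == _]eq_sym; move: (dart_neq bG).
    by case: (b.1 =P v) => [->|_]; case: (b.2 =P v) => [->|_]; rewrite ?eqxx.
  under eq_bigr => b _ do rewrite mulrDr.
  (* The face step carries heads to tails, so a region leaves [v] as often as it enters it. *)
  rewrite big_split /= [X in X + _](reindex_inj (@face_step_inj _ r)) /=.
  rewrite (eq_bigl (mem (darts G))) => [|b]; last by rewrite face_step_dart.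
  rewrite (eq_bigr (fun b => (rt b == f) * (b.2 == v))) => [|b bG].
    by rewrite addr_bool addbb.
  by rewrite rt_fs (face_step_tail rG).
have kerF (h : T * T -> bool) :
    {in edges G, forall e, \sum_(f in face_roots G r) h f * dF f e = 0} ->
    {in face_roots G r &, forall f g, h f = h g}.
  move=> h0; pose k a := h (rt a).
  have k_rev a : a \in darts G -> k (a.2, a.1) = k a.
    move=> aG; have aE : edge a \in edges G by move: aG; rewrite in_darts.
    have := h0 _ aE; rewrite d_dF //.
    by rewrite -/(k a) -/(k (a.2, a.1)); case: (k a); case: (k _).
  (* The rotation is reversal followed by the face step; hence [k] depends only on the tail of a
     dart. *)
  have k_rot a : a \in darts G -> k (r a) = k a.
    by move=> aG; rewrite rot_face_step /k rt_fs -/(k _) k_rev.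
  pose K v := [exists a, [&& a \in darts G, a.1 == v & k a]].
  have KE a : a \in darts G -> K a.1 = k a.
    move=> aG; apply/existsP/idP => [[b /and3P[bG /eqP ba kb]]|ka]; last first.
      by exists a; rewrite aG eqxx.
    by rewrite (rot_constant rG (u := a.1) (k := k) _ aG bG) // => c cG _; exact: k_rot.
  have Kc : {in verts G &, forall u v, K u = K v}.
    apply: conG => v w vw; have bG : (v, w) \in darts G by rewrite in_darts.
    have bG' : (w, v) \in darts G by rewrite in_darts adj_sym.
    by rewrite (KE _ bG) (KE _ bG') -k_rev.
  have kr f : f \in face_roots G r -> h f = k f.
    by rewrite inE => /andP[_ /eqP ff]; rewrite /k /rt ff.
  move=> f g fF gF; rewrite !kr //.
  move: fF gF; rewrite [f \in _]inE [g \in _]inE => /andP[fG _] /andP[gG _].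
  by rewrite -(KE _ fG) -(KE _ gG); apply: Kc; exact: dart_tail.
have kerV (h : T -> bool) : {in edges G, forall e, \sum_(v in verts G) dE e v * h v = 0} ->
    {in verts G &, forall v w, h v = h w}.
  move=> h0; apply: conG => v w vw; have := h0 _ vw.
  rewrite -[[set v; w]]/(edge (v, w)) d_dE ?in_darts //=.
  by case: (h v); case: (h w).
have count : (#|face_roots G r| + #|verts G| = #|edges G| + 2)%N.
  by rewrite card_face_roots addnC.
have [w wE] := chain_complex_exact dd kerF kerV count u_even.
exists (fun a => w (rt a)) => [a aG|a aG]; first by rewrite rt_fs.
by rewrite wE ?d_dF //; move: aG; rewrite in_darts.
Qed.

(* The two sides of C in the sphere are the values of w; the connected complement
   lies on one side, so a region on the other side is bounded by C. *)
Lemma induced_cycle_region (C : {set T}) :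
  C \subset verts G -> C != set0 ->
  {in C, forall v, #|[set u in C | adj G v u]| = 2} ->
  (forall K : T -> bool, {in C &, forall u v, adj G u v -> K u = K v} ->
     {in C &, forall u v, K u = K v}) ->
  (forall K : T -> bool,
     {in verts G :\: C &, forall u v, adj G u v -> K u = K v} ->
     {in verts G :\: C &, forall u v, K u = K v}) ->
  exists2 a, a \in darts G & region_boundary r a = induced G C.
Proof.
move=> /subsetP CG /set0Pn[v0 v0C] C2 conC conO.
have nbr2 v x y z : v \in C -> x \in C -> y \in C -> z \in C -> adj G v x -> adj G v y ->
    adj G v z -> x != y -> z = x \/ z = y.
  move=> vC xC yC zC vx vy vz nxy.
  have: [set x; y] == [set u in C | adj G v u].
    rewrite eqEcard C2 // cards2 nxy andbT; apply/subsetP => t.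
    by rewrite !inE => /orP[]/eqP->; rewrite ?xC ?yC.
  move/eqP/setP/(_ z); rewrite !inE zC vz => /orP[]/eqP; [left | right] => //.
pose u e := (e \in edges G) && (e \subset C).
have [w w_fs w_rev] : exists2 w : T * T -> bool,
    (forall a, a \in darts G -> w (fs a) = w a) &
    forall a, a \in darts G -> w a (+) w (a.2, a.1) = u (edge a).
  apply: even_edge_cut => v vG; rewrite /u.
  under eq_bigr => e eG do rewrite eG mulr_bool /=.
  rewrite sum_bool_odd; case vC: (v \in C); last first.
    rewrite (_ : [set e in _ | _] = set0) ?cards0 //; apply/setP => e; rewrite !inE.
    by apply/negP => /and3P[_ /subsetP eC /eC]; rewrite vC.
  rewrite (_ : [set e in _ | _] = [set [set v; x] | x in [set x in C | adj G v x]]).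
    rewrite card_in_imset ?C2 // => x y; rewrite !inE => /andP[_ vx] /andP[_ vy] /setP/(_ x).
    rewrite !inE eqxx orbT => /esym/orP[/eqP xv|/eqP//].
    by have [] := adjP sG vx; rewrite xv eqxx.
  apply/setP => e; rewrite inE; apply/and3P/imsetP => [[eG eC ve]|[x]].
    have [a aG ea] := edgeP sG eG.
    move: ve eC; rewrite {1 2}ea !inE => /orP[]/eqP va eC.
      by exists a.2; rewrite ?inE va // (subsetP eC) ?set22 //= -in_darts.
    exists a.1; rewrite ?inE va 1?setUC // (subsetP eC) ?set21 //=.
    by rewrite adj_sym -in_darts.
  rewrite inE => /andP[xC vx] ->; rewrite set21; split=> //.
  by apply/subsetP => t; rewrite !inE => /orP[]/eqP->.
(* No edge at a vertex outside [C] belongs to the cycle, so [w] is unchanged when turning around the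
   vertex, and the connected complement carries its value along. *)
have [c w_out] : exists c, forall b, b \in darts G -> b.1 \notin C -> w b = c.
  have w_rot v b : v \notin C -> b \in darts G -> b.1 = v -> w (r b) = w b.
    move=> vC bG bv; rewrite rot_face_step w_fs ?dart_rev //.
    have := w_rev _ bG; rewrite /u (_ : edge b \subset C = false) ?andbF.
      by case: (w b); case: (w _).
    by apply/negP => /subsetP/(_ b.1); rewrite set21 bv (negbTE vC) => /(_ isT).
  pose K v := [exists b, [&& b \in darts G, b.1 == v & w b]].
  have KE b : b \in darts G -> b.1 \notin C -> K b.1 = w b.
    move=> bG bC; apply/existsP/idP => [[b' /and3P[bG' /eqP bb wb]]|wb]; last first.
      by exists b; rewrite bG eqxx.
    rewrite (rot_constant rG (u := b.1) (k := w) _ bG bG') // => c cG cb.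
    exact: w_rot cb.
  have Kc : {in verts G :\: C &, forall v v', K v = K v'}.
    apply: conO => v v'; rewrite !inE => /andP[vC _] /andP[vC' _] vv'.
    have bG : (v, v') \in darts G by rewrite in_darts.
    have bG' : (v', v) \in darts G by rewrite in_darts adj_sym.
    rewrite (KE _ bG) // (KE _ bG') //; have := w_rev _ bG.
    rewrite /u (_ : _ \subset C = false) ?andbF /=.
      by case: (w _); case: (w _).
    by apply/negP => /subsetP/(_ v); rewrite set21 (negbTE vC) => /(_ isT).
  case: (pickP [pred v | v \in verts G :\: C]) => [v /= vO|noO].
    exists (K v) => b bG bC; rewrite -KE //; apply: Kc => //.
    by rewrite inE bC dart_tail.
  (* With an empty complement every constant will do. *)
  exists true => b bG bC; have := noO b.1; by rewrite /= inE bC dart_tail.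
(* The two darts of an edge of the cycle take different values, so one of them is off the side
   [c]. *)
have [a0 a0G wa0] : exists2 a, a \in darts G & w a != c.
  have: (0 < #|[set x in C | adj G v0 x]|)%N by rewrite C2.
  case/card_gt0P => x; rewrite inE => /andP[xC vx].
  have bG : (v0, x) \in darts G by rewrite in_darts.
  have := w_rev _ bG; rewrite /u (vx : [set v0; x] \in edges G) (_ : _ \subset C); last first.
    by apply/subsetP => t; rewrite !inE => /orP[]/eqP->.
  case: (eqVneq (w (v0, x)) c) => [->|nc _]; last by exists (v0, x).
  by move=> wc; exists (x, v0); rewrite ?in_darts 1?adj_sym //; case: (w _) (c) wc => [] [].
pose O := orbit fs a0.
have O_dart b : b \in O -> b \in darts G by exact: orbit_dart.
have OC b : b \in O -> b.1 \in C /\ b.2 \in C.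
  move=> bO; have bG := O_dart b bO.
  have wb : w b != c by rewrite (orbit_constant rG w_fs a0G bO).
  split; first by apply: contraNT wb => bC; rewrite w_out.
  apply: contraNT wb => bC; have := w_rev _ bG; rewrite /u.
  rewrite (_ : edge b \subset C = false) ?andbF; last first.
    by apply/negP => /subsetP/(_ b.2); rewrite set22 (negbTE bC) => /(_ isT).
  by rewrite (w_out (b.2, b.1)) ?dart_rev //; case: (w b); case: (c).
(* The orbit reaches and leaves [b.1] along different edges, because a vertex of degree at least 2
   does not turn it back. These are the two edges of the cycle at [b.1], so the orbit follows the
   cycle. *)
have step b v : b \in O -> v \in C -> adj G b.1 v ->
    (exists2 b', b' \in O & b'.1 = v) /\ (exists2 b', b' \in O & edge b' = [set b.1; v]).
  move=> bO vC bv; pose b' := finv fs b.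
  have fb' : fs b' = b by apply: f_finv; exact: face_step_inj.
  have b'O : b' \in O by rewrite -(orbit_step r) fb'.
  have bG := O_dart b bO; have b'G := O_dart b' b'O.
  have b'b : b'.2 = b.1 by rewrite -(face_step_tail rG) // fb'.
  have [b1C b2C] := OC b bO; have [b'1C _] := OC b' b'O.
  have nb : b.2 != b'.1.
    apply: contra (rot_neq sG rG bG (deg_gt1 (dart_tail bG))) => /eqP bb'.
    by rewrite -{2}fb' /face_step b'b -bb' -surjective_pairing.
  have vE : v = b.2 \/ v = b'.1.
    apply: (nbr2 b.1) => //; first by rewrite -in_darts.
    by rewrite adj_sym -b'b -in_darts.
  case: vE => vE.
    split; last by exists b; rewrite // vE.
    by exists (fs b); rewrite ?orbit_step // (face_step_tail rG).
  by split; exists b'; rewrite // vE -b'b setUC.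
exists a0 => //; rewrite /region_boundary /induced -/O.
have headsE : [set b.1 | b in O] = C.
  apply/setP => v; apply/imsetP/idP => [[b bO ->]|vC]; first by case: (OC b bO).
  pose K x := x \in [set b.1 | b in O].
  have K0 : K a0.1 by apply: imset_f; rewrite /O -fconnect_orbit connect0.
  have a0C : a0.1 \in C by case: (OC a0) => //; rewrite /O -fconnect_orbit connect0.
  apply/imsetP; rewrite -/(K v) (conC K _ v a0.1) // => x y xC yC xy.
  have KK z t : z \in C -> t \in C -> adj G z t -> K z -> K t.
    move=> zC tC zt /imsetP[b bO zE]; move: zt; rewrite zE => zt.
    by have [[b' b'O <-] _] := step b t bO tC zt; apply: imset_f.
  by apply/idP/idP; [apply: KK | apply: KK => //; rewrite adj_sym].
rewrite headsE; congr (_, _); apply/setP => e; rewrite inE; apply/imsetP/andP.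
  move=> [b bO ->]; have := O_dart b bO; rewrite in_darts => bG; split=> //.
  by have [b1 b2] := OC b bO; apply/subsetP => t; rewrite !inE => /orP[]/eqP->.
case=> eG /subsetP eC; have [a aG ea] := edgeP sG eG.
have aC : a.1 \in [set b.1 | b in O] by rewrite headsE eC // ea set21.
have /imsetP[b bO ab] := aC.
have [_ [b' b'O b'E]] : (exists2 b', b' \in O & b'.1 = a.2) /\
    (exists2 b', b' \in O & edge b' = [set b.1; a.2]).
  by apply: step; rewrite // -?ab -?in_darts // eC // ea set22.
by exists b'; rewrite // b'E ea ab.
Qed.

End Whitney.

(** * Outputs of the algorithm *)

(** Translates the sums of the integer program into cardinalities of selected sets. *)
Lemma sum_mem_int (T : finType) (A : {pred T}) (B : {set T}) (p : pred T) :
  (\sum_(x in A | p x) (x \in B)%:R = #|[set x in B | (x \in A) && p x]|%:R :> int)%R.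
Proof.
rewrite -sum1_card -natr_sum big_mkcond [in RHS]big_mkcond /=; congr (_ %:R)%R.
apply: eq_bigr => x _; rewrite inE; case: (x \in A) => /=; case: (p x) => /=; last 3 first.
- by rewrite andbF.
- by rewrite andbF.
- by rewrite andbF.
by case: (x \in B).
Qed.

Section ConnectedGraphs.
Context {T : finType} (G : graph T).
Implicit Types (u v : T) (e : {set T}).

(** Deleting fewer than [k] neighbours would isolate [v] while some other vertex remains. *)
Lemma k_connected_deg k v : simple_graph G -> k_connected k G -> v \in verts G -> k <= deg G v.
Proof.
move=> sG /andP[kG /forallP conn] vG; rewrite leqNgt; apply/negP => dv.
pose N := [set u | adj G v u].
have vN : v \notin N by rewrite inE; apply/negP => /(adjP sG)[]; rewrite eqxx.
have NE : #|N| = deg G v.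
  rewrite /deg -(card_in_imset (_ : {in N &, injective (fun u => [set v; u])})).
    apply: eq_card => e; rewrite inE; apply/imsetP/andP => [[u]|[eG ve]].
      by rewrite inE => vu ->; rewrite set21.
    have [[a b] abG eE] := edgeP sG eG.
    move: ve abG; rewrite eE in_darts /= !inE => /orP[]/eqP <- ab.
      by exists b; first by rewrite inE.
    by exists a; [rewrite inE adj_sym | rewrite setUC].
  move=> u w; rewrite !inE => vu vw /setP/(_ u).
    rewrite !inE eqxx orbT => /esym/orP[/eqP uv|/eqP//].
  by have [] := adjP sG vu; rewrite uv eqxx.
have := conn N; rewrite NE dv andbT.
have -> : N \subset verts G by apply/subsetP => u; rewrite inE => /(adjP sG)[].
move/connected_onP => /(_ (@adj_sym _ G)) /(_ (pred1 v)) constK.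
have : v |: N \proper verts G.
  rewrite properEcard subUset sub1set vG /=; apply/andP; split.
    by apply/subsetP => u; rewrite inE => /(adjP sG)[].
  by rewrite cardsU1 vN NE add1n; apply: leq_trans kG.
case/properP => _ [w wG]; rewrite in_setU1 negb_or => /andP[wv vw].
have := constK _ v w; rewrite !in_setD vN vG wG vw /= eqxx (negbTE wv) => H.
suff: true = false by []; apply: H => // => x y.
rewrite !in_setD ![_ \in N]inE => /andP[vx xG] /andP[vy yG] xy; apply/eqP/eqP => E.
  by rewrite -E xy in vy.
by rewrite -E adj_sym xy in vx.
Qed.

End ConnectedGraphs.

Section TwoFaces.
Context {T : finType} (F R : graph T).
Hypotheses (sF : simple_graph F) (kF : k_connected 3 F) (FR : is_2face F R).

(** Degrees are at least 3, so consecutive darts of a region never turn back and three successive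
    vertices are distinct. *)
Lemma face_verts : 2 < #|verts R|.
Proof.
have /existsP[r /andP[/andP[rF _] /existsP[a /andP[aF /eqP->]]]] := FR.
have aFd : a \in darts F by [].
pose b := face_step r a.
have ab : b.1 = a.2 := face_step_tail rF aFd.
have bF : b \in darts F by rewrite face_step_dart.
have [na a1 a2] : [/\ a.1 != a.2, a.1 \in verts F & a.2 \in verts F].
  by apply: adjP => //; rewrite -in_darts.
have nba : b.2 != a.1.
  have := rot_neq sF rF (_ : (a.2, a.1) \in darts F); rewrite dart_rev => /(_ aFd).
  move/(_ (leq_trans _ (k_connected_deg sF kF a2))) => /(_ isT).
  by apply: contra => /eqP ba; rewrite -/(face_step r a) -/b [b]surjective_pairing ab ba.
have nb : b.2 != b.1 by rewrite eq_sym; have [] := adjP sF (_ : adj F b.1 b.2); rewrite -?in_darts.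
have sub : [set a.1; a.2; b.2] \subset verts (region_boundary r a).
  have o0 : a \in orbit (face_step r) a by rewrite -fconnect_orbit connect0.
  have o1 : b \in orbit (face_step r) a by rewrite orbit_step.
  have o2 : face_step r b \in orbit (face_step r) a by rewrite orbit_step.
  apply/subsetP => t; rewrite !inE => /orP[/orP[]|] /eqP->.
  - exact: imset_f o0.
  - by rewrite -ab; apply: imset_f o1.
  - by rewrite -(face_step_tail rF bF); apply: imset_f o2.
apply: leq_trans (subset_leq_card sub).
rewrite setUC cardsU1 !inE negb_or nba -ab nb cards2 ab na.
by [].
Qed.

Lemma face_has_edge : exists e, e \in edges R.
Proof.
have /existsP[r /andP[_ /existsP[a /andP[aF /eqP->]]]] := FR.
by exists [set a.1; a.2]; apply/imsetP; exists a; rewrite // -fconnect_orbit connect0.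
Qed.

Lemma face_subgraph : subgraph R F.
Proof.
have /existsP[r /andP[/andP[rF _] /existsP[a /andP[aF /eqP->]]]] := FR.
have od b : b \in orbit (face_step r) a -> adj F b.1 b.2.
  by move=> bo; rewrite -in_darts; exact: (orbit_dart rF) bo.
apply/andP; split; apply/subsetP => x /imsetP[b /od bF ->]; last exact: bF.
by have [] := adjP sF bF.
Qed.

Lemma face_edge_sub e : e \in edges R -> e \subset verts R.
Proof.
have /existsP[r /andP[/andP[rF _] /existsP[a /andP[aF /eqP->]]]] := FR.
case/imsetP => b bo ->; apply/subsetP => t; rewrite !inE => /orP[]/eqP->.
  exact: imset_f.
have bF : b \in darts F by exact: (orbit_dart rF) bo.
by rewrite -(face_step_tail rF bF); apply: imset_f; rewrite orbit_step.
Qed.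

End TwoFaces.

Lemma induced_simple (T : finType) (G : graph T) (A : {set T}) :
  simple_graph G -> simple_graph (induced G A).
Proof.
move/forall_inP => sG; apply/forall_inP => e; rewrite inE => /andP[eG eA].
by rewrite eA; case/andP: (sG e eG).
Qed.

Lemma potential_facetP (T : finType) (G F : graph T) : simple_graph G ->
  F \in potential_facets G ->
  [/\ simple_graph F, k_connected 3 F & subgraph F G].
Proof.
move=> sG; rewrite inE => /existsP[A /and4P[AG /eqP-> _ kF]]; split=> //.
  exact: induced_simple.
by apply/andP; split=> //; apply/subsetP => e; rewrite inE => /andP[].
Qed.

(** * Ranks in the poset of a feasible solution *)

Section OutputRanks.
Local Open Scope order_scope.
Context {T : finType} (G : graph T) (X Y : {set graph T}) (f0 f1 f2 f3 : int).
Hypotheses (inG : input_graph f0 f1 G) (feas : feasible f2 f3 G (X, Y)).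

Notation s := (G, (X, Y)).
Notation P := (solution_poset (s : solution T)).
Notation elt h := (exist (fun a => is_true (is_cell (s : solution T) a)) (Some _) h : P).
Hypothesis icP : ic_eulerian_lattice5 P.
Implicit Types (H K F R : graph T) (v : T) (e : {set T}).

Let sG : simple_graph G. Proof. by case/and4P: inG. Qed.
Let kG : k_connected 4 G. Proof. by case/and4P: inG. Qed.

Let facetP F : F \in X -> [/\ simple_graph F, k_connected 3 F & subgraph F G].
Proof.
by case/and5P: feas => /subsetP XF _ _ _ _ /XF; exact: potential_facetP.
Qed.

Let card_X : Posz #|X| = f3.
Proof.
case/and5P: feas => /subsetP XF _ /eqP <- _ _.
transitivity (\sum_(F in potential_facets G | true) (F \in X)%:R : int)%R.
  rewrite sum_mem_int natz; congr Posz; apply: eq_card => F; rewrite inE andbT.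
  by case FX: (F \in X) => //=; rewrite XF.
by apply: eq_bigl => F; rewrite andbT.
Qed.

Let card_Y : Posz #|Y| = f2.
Proof.
case/and5P: feas => _ /subsetP YR _ /eqP <- _.
transitivity (\sum_(R in potential_ridges G | true) (R \in Y)%:R : int)%R.
  rewrite sum_mem_int natz; congr Posz; apply: eq_card => R; rewrite inE andbT.
  by case RY: (R \in Y) => //=; rewrite YR.
by apply: eq_bigl => R; rewrite andbT.
Qed.

Let ridge_facets R : R \in Y ->
  exists F F', [/\ F \in X, F' \in X, F != F', is_2face F R & is_2face F' R].
Proof.
case/and5P: feas => /subsetP XF /subsetP YR _ _ /and5P[/forall_inP two _ _ _ _] RY.
have := two R (YR R RY); rewrite RY mulr1 subr_eq0 sum_mem_int !natz => /eqP E2.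
have [/esym/eqP/cards2P[F [F' [nFF' E]]]] : Posz 2 = Posz _ := E2.
have : F \in [set F; F'] by rewrite !inE eqxx.
have : F' \in [set F; F'] by rewrite !inE eqxx orbT.
rewrite -E !inE => /and3P[F'X _ RF'] /and3P[FX _ RF].
by exists F, F'.
Qed.

Let facet_ridge F R : F \in X -> is_2face F R -> R \in Y.
Proof.
case/and5P: feas => /subsetP XF /subsetP YR _ _ /and5P[/forall_inP two _ _ _ _] FX FR.
have RG : R \in potential_ridges G.
  by rewrite inE; apply/existsP; exists F; rewrite XF.
have := two R RG; rewrite subr_eq0 sum_mem_int; case: (R \in Y) => //.
rewrite mulr0 natz => /eqP E0.
have [/esym/eqP] : Posz 0 = Posz _ := E0; rewrite cards_eq0 => /eqP/setP/(_ F).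
by rewrite inE in_set0 FX XF // FR.
Qed.

Let edge_ridge e : e \in edges G -> exists2 R, R \in Y & e \in edges R.
Proof.
case/and5P: feas => _ /subsetP YR _ _ /and5P[_ _ _ /forall_inP pos _] eG.
have := pos e eG; rewrite sum_mem_int natz ltz_nat => /card_gt0P[R].
by rewrite inE => /and3P[RY _ eR]; exists R.
Qed.

Let elt_le H K (sH : is_cell s (Some H)) (sK : is_cell s (Some K)) :
  (exist _ (Some H) sH <= exist _ (Some K) sK :> P) = subgraph H K.
Proof. by []. Qed.

Let elt_lt H K (sH : is_cell s (Some H)) (sK : is_cell s (Some K)) :
  subgraph H K -> H != K -> elt sH < elt sK.
Proof.
move=> HK nHK; rewrite lt_neqAle elt_le HK andbT.
by apply: contra nHK => /eqP[] ->.
Qed.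

Let rank_lt H K (sH : is_cell s (Some H)) (sK : is_cell s (Some K)) :
  subgraph H K -> H != K -> (rank (exist _ (Some H) sH : P) < rank (exist _ (Some K) sK : P))%N.
Proof.
by move=> HK nHK; apply: ltn_rank; exact: elt_lt.
Qed.

Let c0 : is_cell s (Some empty_graph). Proof. by rewrite /= eqxx. Qed.
Let cv v : v \in verts G -> is_cell s (Some (vertex_graph v)).
Proof. by move=> vG; apply/or4P/Or42/existsP; exists v; rewrite vG eqxx. Qed.
Let ce e : e \in edges G -> is_cell s (Some (edge_graph e)).
Proof. by move=> eG; apply/or4P/Or43/existsP; exists e; rewrite eG eqxx. Qed.
Let cY R : R \in Y -> is_cell s (Some R).
Proof. by move=> RY; apply/or4P/Or44; rewrite RY. Qed.
Let cX F : F \in X -> is_cell s (Some F).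
Proof. by move=> FX; apply/or4P/Or44; rewrite FX orbT. Qed.

Let edge2 e : e \in edges G -> e \subset verts G /\ #|e| = 2.
Proof. by move/forall_inP: sG => /[apply] /andP[-> /eqP]. Qed.

Let rank_v v (h : is_cell s (Some (vertex_graph v))) : (0 < rank (elt h))%N.
Proof.
apply: leq_ltn_trans (leq0n _) (rank_lt c0 h _ _).
  by apply/andP; split; exact: sub0set.
by apply/eqP => -[] /setP/(_ v); rewrite !inE eqxx.
Qed.

Let rank_e e (eG : e \in edges G) (h : is_cell s (Some (edge_graph e))) :
  (1 < rank (elt h))%N.
Proof.
have [eV e2] := edge2 eG; have [v ve] : exists v, v \in e by apply/card_gt0P; rewrite e2.
have vG := subsetP eV v ve; apply: leq_ltn_trans (rank_v (cv vG)) (rank_lt _ h _ _).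
  by apply/andP; rewrite sub1set sub0set.
by apply/eqP => -[] eE _; move: e2; rewrite -eE cards1.
Qed.

Let vertex_edge v : v \in verts G -> exists2 e, e \in edges G & v \in e.
Proof.
move=> vG; have : (0 < deg G v)%N by exact: leq_trans (k_connected_deg sG kG vG).
by case/card_gt0P => e; rewrite inE => /andP[]; exists e.
Qed.

Let ridgeP R : R \in Y -> [/\ (2 < #|verts R|)%N, exists e, e \in edges R,
  subgraph R G & forall e, e \in edges R -> e \subset verts R].
Proof.
move=> RY; have [F [_ [FX _ _ FR _]]] := ridge_facets RY; have [sF kF FG] := facetP FX.
split; [exact: face_verts FR | exact: face_has_edge FR | | exact: face_edge_sub FR].
have /andP[R1 R2] := face_subgraph sF FR; have /andP[F1 F2] := FG.
by rewrite /subgraph (subset_trans R1 F1) (subset_trans R2 F2).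
Qed.

Let edge_lt_ridge e R : R \in Y -> e \in edges R ->
  subgraph (edge_graph e) R /\ edge_graph e != R.
Proof.
move=> RY eR; have [R3 _ /andP[_ /subsetP RG] Rsub] := ridgeP RY; split.
  by apply/andP; rewrite Rsub // sub1set.
have [_ e2] := edge2 (RG e eR).
by apply/eqP => E; move: R3; rewrite -E e2.
Qed.

Let rank_R R (RY : R \in Y) (h : is_cell s (Some R)) : (2 < rank (elt h))%N.
Proof.
have [_ [e eR] /andP[_ /subsetP RG] _] := ridgeP RY.
have [sub neq] := edge_lt_ridge RY eR.
exact: leq_ltn_trans (rank_e (RG e eR) (ce (RG e eR))) (rank_lt _ h sub neq).
Qed.

Let rank_top : forall x : P, (rank x <= 5)%N.
Proof. by case/and5P: icP => _ _ _ _ /eqP <- x; exact: leq_bigmax. Qed.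

Let rank_le4 H (h : is_cell s (Some H)) : (rank (elt h) <= 4)%N.
Proof.
have hN : is_cell s None by [].
rewrite -ltnS; apply: leq_trans (rank_top (exist _ None hN)).
by apply: ltn_rank; rewrite lt_neqAle.
Qed.

Let facet_has_ridge F : F \in X -> exists2 R, R \in Y & is_2face F R.
Proof.
move=> FX; have [sF kF _] := facetP FX; have := kF => /andP[F3 _].
case/and5P: feas => /subsetP/(_ F FX); rewrite inE.
case/existsP => A /and4P[_ /eqP FE /existsP[r rF] _] _ _ _ _.
have [v vF] : exists v, v \in verts F by apply/card_gt0P; exact: leq_trans F3.
have : (0 < deg F v)%N by exact: leq_trans (k_connected_deg sF kF vF).
case/card_gt0P => e; rewrite inE => /andP[eF _]; have [a aF _] := edgeP sF eF.
have FR : is_2face F (region_boundary r a).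
  by apply/existsP; exists r; rewrite rF; apply/existsP; exists a; rewrite aF eqxx.
by exists (region_boundary r a) => //; exact: facet_ridge FX FR.
Qed.

Let vertex_in_edge v e : e \in edges G -> v \in e ->
  subgraph (vertex_graph v) (edge_graph e) /\ vertex_graph v != edge_graph e.
Proof.
move=> eG ve; split; first by apply/andP; rewrite sub1set sub0set.
by have [_ e2] := edge2 eG; apply/eqP => -[] eE _; move: e2; rewrite -eE cards1.
Qed.

Let edge_in_facet F e : F \in X -> e \in edges F ->
  subgraph (edge_graph e) F /\ edge_graph e != F.
Proof.
move=> FX eF; have [sF /andP[F3 _] /andP[_ /subsetP FG]] := facetP FX.
have /forall_inP/(_ e eF)/andP[eV /eqP e2] := sF.
split; first by apply/andP; rewrite sub1set.
by apply/eqP => E; move: F3; rewrite -E e2.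
Qed.

(** A facet contains a ridge, so its rank is at least 3. If it were 3, the interval from a vertex
    [v] to [F] would have length 2 and contain just two edges, while [v] has degree at least 3 in
    [F]. *)
Let rank_F F (FX : F \in X) (h : is_cell s (Some F)) : rank (elt h) = 4.
Proof.
have [sF kF /andP[/subsetP FvG /subsetP FeG]] := facetP FX.
have [R RY FR] := facet_has_ridge FX.
have RF := face_subgraph sF FR.
have [_ [e eR] _ _] := ridgeP RY.
have F3 : (2 < rank (elt h))%N.
  apply: leq_trans (rank_R RY (cY RY)) (leq_rank _).
  by rewrite elt_le.
apply/eqP; rewrite eqn_leq rank_le4 ltn_neqAle F3 andbT; apply/eqP => F3E.
have eF : e \in edges F by case/andP: RF => _ /subsetP; apply.
have eG := FeG e eF; have [_ e2] := edge2 eG.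
have [v ve] : exists v, v \in e by apply/card_gt0P; rewrite e2.
have vF : v \in verts F.
  by have /forall_inP/(_ e eF)/andP[/subsetP/(_ v ve)] := sF.
have vG := FvG v vF.
have below f : f \in edges F -> v \in f -> exists hf : is_cell s (Some (edge_graph f)),
    [/\ elt (cv vG) < elt hf, elt hf < elt h, rank (elt (cv vG)) = 1 & rank (elt hf) = 2].
  move=> fF vf; have fG := FeG f fF; exists (ce fG).
  have [ve1 ve2] := vertex_in_edge fG vf; have [fF1 fF2] := edge_in_facet FX fF.
  have l1 : elt (cv vG) < elt (ce fG) by exact: elt_lt.
  have l2 : elt (ce fG) < elt h by exact: elt_lt.
  have l2' := ltn_rank l2; rewrite -F3E in l2'.
  suff [r1 r2] : rank (elt (cv vG)) = 1 /\ rank (elt (ce fG)) = 2 by split.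
  move: (rank_v (cv vG)) (ltn_rank l1) l2'.
  by case: (rank (elt (cv vG))) (rank (elt (ce fG))) => [|[|m]] [|[|[|n]]].
case/and5P: (icP) => lat gr eu ic _; pose L := EulerianLattice lat gr eu ic.
have [he [ve_lt eF_lt rv re]] := below e eF ve.
have cve : @cov _ L (elt (cv vG)) (elt he) by rewrite /cov ve_lt /= re rv.
have ceF : @cov _ L (elt he) (elt h) by rewrite /cov eF_lt /= re -F3E.
have [u [_ _ _ all]] := @cov_other _ L _ _ _ cve ceF.
have := k_connected_deg sF kF vF; rewrite /deg (cardsD1 e) inE eF ve add1n ltnS.
apply/negP; rewrite -ltnNge ltnS; apply/card_le1_eqP => f g.
have uniq f' : f' \in [set e0 in edges F | v \in e0] :\ e ->
    val (u : P) = Some (edge_graph f').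
  rewrite !inE => /and3P[fe fF vf]; have [hf [vf_lt fF_lt _ rf]] := below f' fF vf.
  have cvf : @cov _ L (elt (cv vG)) (elt hf) by rewrite /cov vf_lt /= rf rv.
  case: (all _ cvf (ltW fF_lt)) => [[f'e]|<-] //.
  by rewrite f'e eqxx in fe.
by move=> /uniq uf /uniq; rewrite uf => -[].
Qed.

(** A ridge of rank 4 would coincide with every selected facet containing it, but it lies in two
    different ones. *)
Let rank_RE R (RY : R \in Y) (h : is_cell s (Some R)) : rank (elt h) = 3.
Proof.
have [F [F' [FX F'X nFF' RF RF']]] := ridge_facets RY.
have le_facet K (KX : K \in X) : is_2face K R -> elt h <= elt (cX KX).
  by move=> KR; rewrite elt_le; have [sK _ _] := facetP KX; exact: face_subgraph.
apply/eqP; rewrite eqn_leq (rank_R RY) andbT -ltnS ltn_neqAle rank_le4 andbT.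
apply/eqP => R4.
have RE K (KX : K \in X) : is_2face K R -> R = K.
  move=> KR; have : elt h = elt (cX KX).
    by apply: eq_rank_le; rewrite ?le_facet // R4 rank_F.
  by case.
by move: nFF'; rewrite -(RE F) // -(RE F') // eqxx.
Qed.

(** The positivity constraint supplies a ridge over [e], whose rank 3 leaves no room above 2. *)
Let rank_eE e (eG : e \in edges G) (h : is_cell s (Some (edge_graph e))) : rank (elt h) = 2.
Proof.
have [R RY eR] := edge_ridge eG; have [sub neq] := edge_lt_ridge RY eR.
have := rank_lt h (cY RY) sub neq; rewrite (rank_RE RY) => lt3.
by apply/eqP; rewrite eqn_leq rank_e // andbT.
Qed.

Let rank_vE v (vG : v \in verts G) (h : is_cell s (Some (vertex_graph v))) : rank (elt h) = 1.
Proof.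
have [e eG ve] := vertex_edge vG; have [sub neq] := vertex_in_edge eG ve.
have := rank_lt h (ce eG) sub neq; rewrite (rank_eE eG) => lt2.
by apply/eqP; rewrite eqn_leq rank_v andbT.
Qed.

Let rank_0E (h : is_cell s (Some empty_graph)) : rank (elt h) = 0.
Proof.
have [v vG] : exists v, v \in verts G.
  by apply/card_gt0P; have /andP[V4 _] := kG; exact: leq_trans V4.
have : (rank (elt h) < rank (elt (cv vG)))%N.
  apply: rank_lt; first by apply/andP; split; exact: sub0set.
  by apply/eqP => -[] /setP/(_ v); rewrite !inE eqxx.
by rewrite (rank_vE vG); case: (rank _).
Qed.

Let rank_None (h : is_cell s None) :
  (4 < rank (exist (fun a => is_true (is_cell (s : solution T) a)) None h : P))%N.
Proof.
have [v vG] : exists v, v \in verts G.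
  by apply/card_gt0P; have /andP[V4 _] := kG; exact: leq_trans V4.
have [e eG _] := vertex_edge vG; have [R RY _] := edge_ridge eG.
have [F [_ [FX _ _ _ _]]] := ridge_facets RY.
by rewrite -(rank_F FX (cX FX)); apply: ltn_rank; rewrite lt_neqAle.
Qed.

Let level k : {set graph T} := nth set0 [:: [set empty_graph];
  [set vertex_graph v | v in verts G]; [set edge_graph e | e in edges G]; Y; X] k.

Let rank_level k H (h : is_cell s (Some H)) : (k < 5)%N -> H \in level k -> rank (elt h) = k.
Proof.
case: k => [|[|[|[|[|//]]]]] _ /=.
- by move/set1P => HE; move: h; rewrite HE; exact: rank_0E.
- by case/imsetP => v vG HE; move: h; rewrite HE; exact: rank_vE.
- by case/imsetP => e eG HE; move: h; rewrite HE; exact: rank_eE.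
- by move=> HY; apply: rank_RE.
- by move=> HX; apply: rank_F.
Qed.

Let level_rank H (h : is_cell s (Some H)) : H \in level (rank (elt h)).
Proof.
have in_level k : (k < 5)%N -> H \in level k -> H \in level (rank (elt h)).
  by move=> k5 Hk; rewrite (rank_level h k5 Hk).
have /or4P[/eqP HE|/existsP[v /andP[vG /eqP HE]]|/existsP[e /andP[eG /eqP HE]]|/orP[HY|HX]] := h.
- by apply: (in_level 0); rewrite //= HE set11.
- by apply: (in_level 1); rewrite //= HE imset_f.
- by apply: (in_level 2); rewrite //= HE imset_f.
- exact: (in_level 3).
- exact: (in_level 4).
Qed.

Let level_cell k H : (k < 5)%N -> H \in level k -> is_cell s (Some H).
Proof.
case: k => [|[|[|[|[|//]]]]] _; rewrite [level _]/=.
- by move/set1P ->; exact: c0.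
- by case/imsetP => v vG ->; exact: cv.
- by case/imsetP => e eG ->; exact: ce.
- exact: cY.
- exact: cX.
Qed.

Let card_level k : (k < 5)%N -> #|[set z : P | rank z == k]| = #|level k|.
Proof.
(* The default value concerns only the maximal element, whose rank exceeds 4. *)
move=> k5; pose f (z : P) : graph T := odflt empty_graph (val z).
have [some0 some_f] : (forall z : P, rank z == k -> val z = Some (f z)) /\ True.
  split=> // -[[H|] h] //= /eqP rk; have := rank_None h; rewrite rk.
  by rewrite ltnNge -ltnS k5.
rewrite -(card_in_imset (_ : {in [set z : P | rank z == k] &, injective f})); last first.
  move=> z z'; rewrite !inE => /some0 zE /some0 z'E ff.
  by apply: val_inj; rewrite zE z'E ff.
apply: eq_card => H; apply/imsetP/idP => [[z]|Hk].
  rewrite inE => rz ->; have := some0 z rz; case: z rz => [[K|] h] //= /eqP <- _.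
  exact: level_rank.
have h := level_cell k5 Hk; exists (elt h) => //.
by rewrite inE (rank_level h k5 Hk).
Qed.

Lemma output_fvector : has_fvector P f0 f1 f2 f3.
Proof.
have /and4P[_ /eqP F0 /eqP F1 _] := inG.
rewrite /has_fvector !card_level //; split=> //.
- by rewrite card_imset => [//|v w [/setP/(_ v)]]; rewrite !inE eqxx => /esym/eqP.
- by rewrite card_imset => [//|e e' []].
Qed.

End OutputRanks.

(** * Graphs of lattice elements *)

Section LabelledGraphs.
Local Open Scope order_scope.
Context {d : Order.disp_t} {L : eulerianLattice d} {T : finType} (pt : T -> L) (bot : L).
Implicit Types (x y z c r : L) (t u v : T) (K : T -> bool) (D : {set T}).

Definition vs z : {set T} := [set t | pt t <= z].
Definition gr z : graph T := (vs z, [set vs c | c in [set c : L | (c <= z) && (rank c == 2)]]).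

(** A bijection between the vertex type of the graphs and the atoms; it is a parameter so that it
    can be permuted later. *)
Definition atom_labelling : Prop :=
  [/\ forall x, bot <= x, forall t, cov bot (pt t), injective pt
    & forall x, cov bot x -> exists t, pt t = x].
Hypothesis lab : atom_labelling.

Let bot_le x : bot <= x. Proof. by case: lab => ->. Qed.
Let pt_cov t : cov bot (pt t). Proof. by case: lab => _ ->. Qed.
Let pt_inj : injective pt. Proof. by case: lab. Qed.
Let pt_surj x : cov bot x -> exists t, pt t = x. Proof. by case: lab => _ _ _; apply. Qed.

Lemma rank_bot : rank bot = 0.
Proof.
have [C [_ Cbot cardC]] := rank_chain bot; apply/eqP; rewrite -leqn0 -ltnS -cardC.
rewrite -(cards1 bot); apply: subset_leq_card; apply/subsetP => x /Cbot xb.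
by rewrite inE eq_le xb bot_le.
Qed.

Lemma rank_pt t : rank (pt t) = 1.
Proof. by rewrite (cov_rank (pt_cov t)) rank_bot. Qed.

Lemma pt_le t u : (pt t <= pt u) = (t == u).
Proof. by rewrite (cov_neq (pt_cov t) (pt_cov u)) (inj_eq pt_inj). Qed.

Lemma in_vs z t : (t \in vs z) = (pt t <= z).
Proof. by rewrite inE. Qed.

(** By atomicity the order of the lattice is inclusion of vertex sets. *)
Lemma vs_sub z y : (vs z \subset vs y) = (z <= y).
Proof.
apply/subsetP/idP => [sub|zy t]; last by rewrite !in_vs => /le_trans; apply.
apply: (atoms_le (x := bot)) => // x /pt_surj[t <-] tz.
by rewrite -in_vs sub // in_vs.
Qed.

Lemma vs_inj : injective vs.
Proof. by move=> z y E; apply/eqP; rewrite eq_le -!vs_sub E subxx. Qed.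

Lemma card_vs z : #|vs z| = #|[set x | cov bot x && (x <= z)]|.
Proof.
rewrite -(card_imset _ pt_inj); apply: eq_card => x; rewrite inE.
apply/imsetP/andP => [[t tz ->]|[/pt_surj[t <-] tz]]; first by rewrite pt_cov -in_vs.
by exists t; rewrite ?in_vs.
Qed.

Lemma pt_cov_edge t c : pt t <= c -> rank c = 2 -> cov (pt t) c.
Proof. by move=> tc rc; apply: covI; rewrite // rank_pt. Qed.

Lemma edge_join u v c y : u != v -> cov (pt u) c -> pt v <= c ->
  (c <= y) = (pt u <= y) && (pt v <= y).
Proof.
move=> uv uc vc; apply/idP/andP => [cy|[uy vy]].
  by rewrite (le_trans (cov_le uc) cy) (le_trans vc cy).
by apply: (edge_le (pt_cov u) (pt_cov v) _ uc vc uy vy); rewrite (inj_eq pt_inj).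
Qed.

Lemma vs_edge u v c : u != v -> cov (pt u) c -> pt v <= c -> vs c = [set u; v].
Proof.
move=> uv uc vc; apply/setP => t; rewrite in_vs !inE.
have [x [_ _ _ all]] := cov_other (pt_cov u) uc.
have vx : pt v = x by case: (all _ (pt_cov v) vc) => [/pt_inj vu|//]; rewrite vu eqxx in uv.
apply/idP/orP => [tc|[]/eqP->//]; last exact: cov_le.
case: (all _ (pt_cov t) tc) => [/pt_inj->|tx]; first by left.
by right; apply/eqP/pt_inj; rewrite tx vx.
Qed.

Lemma other_end u c : cov (pt u) c -> exists v, [/\ u != v, pt v <= c & cov (pt v) c].
Proof.
move=> uc; have [x [xu /pt_surj[v vx] xc _]] := cov_other (pt_cov u) uc.
by exists v; rewrite eq_sym -(inj_eq pt_inj) vx (cov_le xc).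
Qed.

Lemma edge_rank u c : cov (pt u) c -> rank c = 2.
Proof. by move/cov_rank->; rewrite rank_pt. Qed.

Lemma adj_grP z u v :
  reflect (exists c, [/\ u != v, cov (pt u) c, pt v <= c & c <= z]) (adj (gr z) u v).
Proof.
apply: (iffP imsetP) => [[c]|[c [uv uc vc cz]]]; last first.
  by exists c; rewrite ?(vs_edge uv uc vc) // inE cz (edge_rank uc).
rewrite inE => /andP[cz /eqP rc] E.
have uc : pt u <= c by rewrite -in_vs -E set21.
have vc : pt v <= c by rewrite -in_vs -E set22.
exists c; split=> //; last exact: pt_cov_edge.
apply/eqP => uv; have : #|vs c| = 2.
  by rewrite card_vs card_cov2 // rank_bot.
by rewrite -E uv setUid cards1.
Qed.

Lemma adj_gr u v c z : u != v -> cov (pt u) c -> pt v <= c -> c <= z -> adj (gr z) u v.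
Proof. by move=> ? ? ? ?; apply/adj_grP; exists c. Qed.

Lemma edges_grP z e : reflect (exists c, [/\ rank c = 2, c <= z & e = vs c]) (e \in edges (gr z)).
Proof.
apply: (iffP imsetP) => [[c]|[c [rc cz ->]]]; last by exists c; rewrite // inE cz rc.
by rewrite inE => /andP[cz /eqP rc] ->; exists c.
Qed.

Lemma vs_in_edges z c : rank c = 2 -> (vs c \in edges (gr z)) = (c <= z).
Proof.
move=> rc; apply/edges_grP/idP => [[c' [_ c'z /vs_inj->//]]|cz].
by exists c.
Qed.

Lemma simple_gr z : simple_graph (gr z).
Proof.
apply/forall_inP => e /edges_grP[c [rc cz ->]].
by rewrite vs_sub cz card_vs card_cov2 ?rank_bot.
Qed.

Lemma subgraph_gr z y : subgraph (gr z) (gr y) = (z <= y).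
Proof.
apply/andP/idP => [[sub _]|zy]; first by rewrite -vs_sub.
rewrite vs_sub zy; split=> //; apply/subsetP => e /edges_grP[c [rc cz ->]].
by rewrite vs_in_edges // (le_trans cz zy).
Qed.

Lemma gr_inj : injective gr.
Proof. by move=> z y [] /vs_inj. Qed.

(** An edge lies below [z] as soon as both of its ends do; this makes facets induced subgraphs. *)
Lemma induced_gr z y : z <= y -> induced (gr y) (vs z) = gr z.
Proof.
move=> zy; congr (_, _); apply/setP => e; rewrite inE.
apply/andP/edges_grP => [[/edges_grP[c [rc cy ->]]]|[c [rc cz ->]]].
  by rewrite vs_sub => cz; exists c.
by rewrite vs_sub cz vs_in_edges // (le_trans cz zy).
Qed.

Lemma deg_gr z u : deg (gr z) u = #|[set c | cov (pt u) c && (c <= z)]|.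
Proof.
rewrite /deg -(card_imset _ vs_inj); apply: eq_card => e; rewrite inE.
apply/andP/imsetP => [[/edges_grP[c [rc cz ->]]]|[c]].
  by rewrite in_vs => uc; exists c; rewrite // inE cz pt_cov_edge.
rewrite inE => /andP[uc cz] ->; rewrite in_vs cov_le //.
by rewrite vs_in_edges ?(edge_rank uc).
Qed.

(** Extends a function on vertices to edges, since the constancy lemmas for the lattice compare a
    vertex with an edge and not two adjacent vertices. *)
Definition lift K D z := [exists t in D, (pt t <= z) && K t].

Lemma lift_pt K D t : t \in D -> lift K D (pt t) = K t.
Proof.
move=> tD; apply/exists_inP/idP => [[u _ /andP[]]|Kt]; first by rewrite pt_le => /eqP->.
by exists t; rewrite // lexx.
Qed.

Lemma lift_edge K D z c t : cov (pt t) c -> c <= z -> vs c \subset D ->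
  {in D &, forall u v, adj (gr z) u v -> K u = K v} -> lift K D c = K t.
Proof.
move=> tc cz /subsetP sD Kloc; have tD : t \in D by rewrite sD // in_vs cov_le.
apply/exists_inP/idP => [[u uD /andP[uc Ku]]|Kt]; last by exists t; rewrite // cov_le.
have [tu|nut] := eqVneq t u; first by rewrite tu.
by rewrite (Kloc t u) //; exact: adj_gr tc uc cz.
Qed.

Lemma gr_connected y K : {in vs y &, forall u v, adj (gr y) u v -> K u = K v} ->
  {in vs y &, forall u v, K u = K v}.
Proof.
move=> Kloc u v uy vy; rewrite -(lift_pt K uy) -(lift_pt K vy).
rewrite !in_vs in uy vy.
apply: (graph_constant (x := bot) (y := y)) => // x c /pt_surj[t <-] tc cy.
have ty : t \in vs y by rewrite in_vs (le_trans (cov_le tc) cy).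
by rewrite lift_pt // (lift_edge tc cy) // vs_sub.
Qed.

(** Deleting labels is deleting atoms, so [deletion_constant] applies. Rank 5 gives 4-connectedness
    of the whole graph, rank 4 gives 3-connectedness of a facet. *)
Lemma k_connected_gr n y : rank y = n.+2 -> k_connected n.+1 (gr y).
Proof.
move=> ry; apply/andP; split.
  by rewrite /= card_vs; have := leq_card_atoms (bot_le y); rewrite ry rank_bot add0n.
apply/forallP => A; apply/implyP => /andP[/subsetP Ay An].
apply/connected_onP => [|K Kloc u v uD vD]; first exact: adj_sym.
have survE z : z <= y -> surv (pt @: A) z -> vs z \subset vs y :\: A.
  move=> zy /survP s; apply/subsetP => t; rewrite in_vs => tz.
  rewrite in_setD in_vs (le_trans tz zy) andbT; apply: contraL tz => tA.
  by apply: s; rewrite imset_f.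
have surv_pt t : t \in vs y :\: A -> surv (pt @: A) (pt t).
  rewrite in_setD => /andP[tA _]; apply/survP => _ /imsetP[a aA ->].
  by rewrite pt_le; apply: contraNneq tA => <-.
rewrite -(lift_pt K uD) -(lift_pt K vD).
have Dy t : t \in vs y :\: A -> pt t <= y by rewrite in_setD in_vs => /andP[].
apply: (@deletion_constant _ _ n bot y (pt @: A)) => //; rewrite ?Dy ?surv_pt //.
- by rewrite rank_bot.
- by rewrite card_imset.
- by move=> _ /imsetP[a _ ->]; rewrite lt_geF // cov_lt.
move=> x c /pt_surj[t <-] tc cy sc.
have sub := survE c cy sc.
have tD : t \in vs y :\: A by rewrite (subsetP sub) // in_vs cov_le.
by rewrite lift_pt // (lift_edge tc cy sub).
Qed.

Lemma gr_complement_connected R F K : cov R F -> rank F = 4 ->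
  {in vs F :\: vs R &, forall u v, adj (gr F) u v -> K u = K v} ->
  {in vs F :\: vs R &, forall u v, K u = K v}.
Proof.
move=> RF rF Kloc u v uD vD; rewrite -(lift_pt K uD) -(lift_pt K vD).
have DE t : (t \in vs F :\: vs R) = ~~ (pt t <= R) && (pt t <= F) by rewrite in_setD !in_vs.
move: uD vD; rewrite !DE => /andP[uR uF] /andP[vR vF].
apply: (@coatom_complement_constant _ _ bot F R) => //; first by rewrite rank_bot rF.
move=> x c /pt_surj[t <-] tc cF off.
have sub : vs c \subset vs F :\: vs R.
  apply/subsetP => t'; rewrite in_vs DE => t'c; rewrite (le_trans t'c cF) andbT.
  by apply: contraL t'c; exact: off.
have tD : t \in vs F :\: vs R by rewrite (subsetP sub) // in_vs cov_le.
by rewrite lift_pt // (lift_edge tc cF sub).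
Qed.

Lemma card_polygon_nbrs R u : rank R = 3 -> u \in vs R ->
  #|[set v in vs R | adj (gr R) u v]| = 2.
Proof.
move=> rR; rewrite in_vs => uR.
have rR' : rank R = rank (pt u) + 2 by rewrite rank_pt rR.
rewrite -(card_cov2 uR rR') -(card_imset _ vs_inj).
pose N := [set v in vs R | adj (gr R) u v].
rewrite -(card_in_imset (_ : {in N &, injective (fun v => [set u; v])})).
  apply: eq_card => e; apply/imsetP/imsetP => [[v]|[c]]; rewrite inE.
    case/andP=> vR /adj_grP[c [uv uc vc cR]] ->; exists c; first by rewrite inE uc.
    by rewrite (vs_edge uv uc vc).
  case/andP=> uc cR ->; have [v [uv vc _]] := other_end uc.
  exists v; last exact: vs_edge.
  by rewrite inE in_vs (le_trans vc cR) (adj_gr uv uc vc cR).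
move=> v w; rewrite !inE => /andP[_ uv] _ /setP/(_ v); rewrite !inE eqxx orbT.
by case/esym/orP => /eqP // vu; have [] := adjP (simple_gr R) uv; rewrite vu eqxx.
Qed.

End LabelledGraphs.

(** * The planar embedding and the 2-faces of a facet graph *)

Section FacetGraph.
Local Open Scope order_scope.
Context {d : Order.disp_t} {L : eulerianLattice d} {T : finType} (pt : T -> L) (bot : L).
Hypothesis lab : atom_labelling pt bot.
Context {F : L} (rF : rank F = 4).
Implicit Types (x y z c r : L) (t u v : T) (a b : T * T).

Notation gF := (gr pt F).

Let bot_le x : bot <= x. Proof. by case: lab => ->. Qed.
Let pt_cov t : cov bot (pt t). Proof. by case: lab => _ ->. Qed.
Let pt_inj : injective pt. Proof. by case: lab. Qed.
Let pt_surj x : cov bot x -> exists t, pt t = x. Proof. by case: lab => _ _ _; apply. Qed.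
Let rk : rank F = rank bot + 4. Proof. by rewrite (rank_bot lab). Qed.
Let sF : simple_graph gF. Proof. exact: simple_gr. Qed.

(** [c] is the edge underlying the dart [a], and [r] is a polygon of [F] on one of its sides. *)
Let flag_of a c r := [&& a.1 != a.2, cov (pt a.1) c, cov (pt a.2) c, cov c r & cov r F].

Let edge_uniq u v c c' : u != v -> cov (pt u) c -> cov (pt v) c ->
  cov (pt u) c' -> cov (pt v) c' -> c = c'.
Proof.
move=> uv uc vc uc' vc'; apply: (vs_inj lab).
by rewrite !(vs_edge lab uv) // cov_le.
Qed.

Let end_uniq u v v' c : u != v -> u != v' ->
  cov (pt u) c -> cov (pt v) c -> cov (pt v') c -> v = v'.
Proof.
move=> uv uv' uc vc v'c; have := vs_edge lab uv uc (cov_le vc).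
rewrite (vs_edge lab uv' uc (cov_le v'c)) => /setP/(_ v).
by rewrite !inE eqxx orbT [v == u]eq_sym (negbTE uv) => /eqP.
Qed.

Let third_edge x c c1 c2 r : cov x c -> cov x c1 -> cov x c2 -> cov c r -> cov c1 r -> cov c2 r ->
  c1 != c -> c2 != c -> c1 = c2.
Proof.
move=> xc xc1 xc2 cr c1r c2r n1 n2; have [t [_ _ _ all]] := cov_other xc cr.
case: (all _ xc1 (cov_le c1r)) n1 => [->|->]; first by rewrite eqxx.
by case: (all _ xc2 (cov_le c2r)) n2 => [->|->]; rewrite ?eqxx.
Qed.

Let dart_edge a : a \in darts gF ->
  exists c, [/\ a.1 != a.2, cov (pt a.1) c, cov (pt a.2) c & c <= F].
Proof.
rewrite in_darts => /(adj_grP lab)[c [n ac bc cF]]; exists c; split=> //.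
by apply: (pt_cov_edge lab bc); exact: (edge_rank lab ac).
Qed.

Let dart_of a c : a.1 != a.2 -> cov (pt a.1) c -> cov (pt a.2) c -> c <= F -> a \in darts gF.
Proof. by move=> n ac bc cF; rewrite in_darts; apply: (adj_gr lab n ac) => //; exact: cov_le. Qed.

Let edge_facets c : rank c = 2 -> c <= F ->
  exists r r', [/\ r' != r, cov c r, cov c r', cov r F & cov r' F].
Proof.
move=> rc cF; have cF' : c < F by apply: ltn_rank_le; rewrite // rc rF.
have [r cr ry] := ex_cov cF'.
have rF' : cov r F by apply: covI; rewrite // (cov_rank cr) rc rF.
by have [r' [? ? ? _]] := cov_other cr rF'; exists r, r'.
Qed.

Let euler_gr : #|verts gF| + #|[set r | cov r F]| = #|edges gF| + 2.
Proof.
have := card_lev4 (bot_le F) rk.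
have -> : #|lev bot F (rank bot + 1)| = #|verts gF|.
  rewrite (card_vs lab); apply: eq_card => x; rewrite inE.
  apply/levP/andP => [[bx xF rx]|[bx xF]]; last by rewrite (cov_rank bx) (cov_le bx) xF addn1.
  by rewrite xF covI // rx addn1.
have -> : #|lev bot F (rank bot + 2)| = #|edges gF|.
  rewrite card_imset; last exact: (vs_inj lab).
  apply: eq_card => x; rewrite inE; apply/levP/andP => [[bx xF ->]|[xF /eqP ->]].
    by rewrite xF (rank_bot lab).
  by rewrite bot_le xF (rank_bot lab).
have -> : #|lev bot F (rank bot + 3)| = #|[set r | cov r F]|.
  apply: eq_card => x; rewrite inE; apply/levP/idP => [[bx xF rx]|xF].
    by apply: covI; rewrite // rF rx (rank_bot lab).
  rewrite bot_le cov_le //; split=> //.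
  by move: rF; rewrite (cov_rank xF) (rank_bot lab) => -[].
by move=> ->.
Qed.

Section Rotation.
Variable w : L -> L -> L -> bool.
Hypothesis w_r : forall x y z z', cov bot x -> cov x y -> cov y z -> cov y z' ->
  cov z F -> cov z' F -> z' != z -> w x y z' = ~~ w x y z.
Hypothesis w_e : forall x y y' z, cov bot x -> cov x y -> cov x y' -> cov y z -> cov y' z ->
  cov z F -> y' != y -> w x y' z = ~~ w x y z.
Hypothesis w_v : forall x x' y z, cov bot x -> cov bot x' -> cov x y -> cov x' y -> cov y z ->
  cov z F -> x' != x -> w x' y z = ~~ w x y z.

(* At the vertex u the edge c is followed by the other edge c' at u of the
   polygon r that lies on the chosen side of c, i.e. w u c r = false. *)
Let step a b := [exists c, exists c', exists r,
  [&& a.1 == b.1, flag_of a c r, flag_of b c' r, c' != c & ~~ w (pt a.1) c r]].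

Let stepP a b : reflect (exists c c' r, [/\ a.1 = b.1, flag_of a c r, flag_of b c' r, c' != c &
    w (pt a.1) c r = false]) (step a b).
Proof.
apply: (iffP existsP) => [[c /existsP[c' /existsP[r /and5P[/eqP ? ? ? ? /negbTE ?]]]]|].
  by exists c, c', r.
case=> c [c' [r [e fa fb n wF]]]; exists c; apply/existsP; exists c'; apply/existsP; exists r.
by rewrite e eqxx fa fb n -e wF.
Qed.

Let step_ex a : a \in darts gF -> exists b, step a b.
Proof.
move=> /dart_edge[c [n ac bc cF]].
have [r [r' [nr cr cr' rF' r'F]]] := edge_facets (edge_rank lab ac) cF.
wlog wF : r r' nr cr cr' rF' r'F / w (pt a.1) c r = false => [wl|].
  case E: (w (pt a.1) c r); last exact: (wl r r').
  by apply: (wl r' r) => //; rewrite 1?eq_sym // (w_r (pt_cov _) ac cr cr') // E.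
have [c' [nc ac' c'r _]] := cov_other ac cr.
have [v [nv _ vc']] := other_end lab ac'.
exists (a.1, v); apply/stepP; exists c, c', r; split=> //; first by rewrite /flag_of n ac bc cr.
by rewrite /flag_of /= nv ac' vc' c'r.
Qed.

Let step_dart a b : step a b -> b \in darts gF.
Proof.
case/stepP => c [c' [r [_ _ /and5P[n b1 b2 c'r rF'] _ _]]].
by apply: (dart_of n b1 b2); exact: le_trans (cov_le c'r) (cov_le rF').
Qed.

(** The flip from [c] to [c'] changes the colour, so the target dart determines [r] as the polygon
    on the other side of [c'], and [r] then determines [c]. *)
Let step_inj a a' b : step a b -> step a' b -> a = a'.
Proof.
case/stepP => c [c' [r [ab /and5P[na ac a2c cr rF'] /and5P[nb bc' b2c' c'r _] nc wF]]].
case/stepP => c1 [c1' [r1 [a'b /and5P[na' a'c a'2c c1r r1F]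
  /and5P[_ bc1' b2c1' c1'r _] nc1 w1F]]].
have E : c1' = c' by apply: edge_uniq nb _ _ _ _.
subst c1'; rewrite ab in ac wF; rewrite a'b in a'c w1F.
have wT := w_e (pt_cov b.1) ac bc' cr c'r rF' nc.
have w1T := w_e (pt_cov b.1) a'c bc' c1r c1'r r1F nc1.
have rr : r1 = r.
  apply/eqP; apply: contraT => nr; have := w_r (pt_cov b.1) bc' c'r c1'r rF' r1F nr.
  by rewrite wT w1T wF w1F.
subst r1; have cc : c1 = c by apply: (third_edge (r := r) bc'); rewrite // eq_sym.
subst c1; apply: injective_projections; first by rewrite ab.
by apply: (end_uniq (u := a.1) (c := c)); rewrite // ?ab // -a'b.
Qed.

Let step_uniq a b b' : step a b -> step a b' -> b = b'.
Proof.
case/stepP => c [c' [r [ab /and5P[na ac a2c cr rF'] /and5P[nb bc' b2c' c'r _] nc wF]]].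
case/stepP => c1 [c1' [r1 [ab' /and5P[_ ac1 a2c1 c1r r1F]
  /and5P[nb' b'c1' b'2c1' c1'r _] nc1 w1F]]].
have E : c1 = c by apply: edge_uniq na _ _ _ _.
subst c1.
have rr : r1 = r.
  apply/eqP; apply: contraT => nr; have := w_r (pt_cov a.1) ac cr c1r rF' r1F nr.
  by rewrite wF w1F.
subst r1; rewrite -ab in bc' nb; rewrite -ab' in b'c1' nb'.
have cc : c1' = c' by apply: (third_edge (r := r) ac).
subst c1'; apply: injective_projections; first by rewrite -ab -ab'.
exact: (end_uniq (u := a.1) (c := c')).
Qed.

(** The identity outside the darts makes this a permutation of all pairs; on a dart [step_ex] makes
    the default unreachable. *)
Let next a := if a \in darts gF then odflt a [pick b | step a b] else a.

Let nextE a b : step a b -> next a = b.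
Proof.
move=> ab; rewrite /next; case/stepP: (ab) => c [_ [r [_ /and5P[n a1 a2 cr rF'] _ _ _]]].
rewrite (dart_of n a1 a2) ?(le_trans (cov_le cr) (cov_le rF')) //.
by case: pickP => [b' ab'|/(_ b)]; [exact: step_uniq ab' ab | rewrite ab].
Qed.

Let next_dart a : (next a \in darts gF) = (a \in darts gF).
Proof.
case: (boolP (a \in darts gF)) => [aG|/negbTE aG]; last by rewrite /next aG.
by have [b ab] := step_ex aG; rewrite (nextE ab) (step_dart ab).
Qed.

Let next_inj : injective next.
Proof.
move=> a a' E; case: (boolP (a \in darts gF)) => aG; last first.
  have := aG; rewrite -next_dart E next_dart => a'G.
  by move: E; rewrite /next (negbTE aG) (negbTE a'G).
have a'G : a' \in darts gF by rewrite -next_dart -E next_dart.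
have [b ab] := step_ex aG; have [b' ab'] := step_ex a'G.
move: E; rewrite (nextE ab) (nextE ab') => bb'.
by apply: step_inj ab _; rewrite bb'.
Qed.

Let q : {perm T * T} := perm next_inj.

Let qE a b : step a b -> q a = b.
Proof. by rewrite permE; exact: nextE. Qed.

Let q_step a : a \in darts gF -> step a (q a).
Proof. by move=> /step_ex[b ab]; rewrite (qE ab). Qed.

Let porbit_step a b : (q b \in porbit q a) = (b \in porbit q a).
Proof. by rewrite ![_ \in porbit q a]porbit_sym -(porbit_perm q 1 b) expg1. Qed.

(** The edges and polygons at a vertex [u] are the vertices and edges of the polygon [[u, F]], which
    is connected. Two edges at [u] on a common [r] are related by [step] in one direction or the
    other, so a single orbit contains all of them. *)
Let q_rotation : rotation gF q.
Proof.
apply/forall_inP => a aG; rewrite eqEsubset; apply/andP; split; apply/subsetP => b.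
  case/porbitP => i ->; elim: i => [|i]; first by rewrite expg0 perm1 inE aG eqxx.
  rewrite inE => /andP[iG /eqP ia]; rewrite expgSr permM inE -ia.
  have si := q_step iG; rewrite (step_dart si).
  by case/stepP: si => c [c' [r [-> _ _ _ _]]]; rewrite eqxx.
rewrite inE => /andP[bG /eqP ba].
pose K z := [exists b, [&& b \in darts gF, b.1 == a.1, pt b.2 <= z & b \in porbit q a]].
have KE b' c : b' \in darts gF -> b'.1 = a.1 -> cov (pt a.1) c -> pt b'.2 <= c ->
    K c = (b' \in porbit q a).
  move=> b'G b'a ac b'c; apply/existsP/idP => [[e /and4P[eG /eqP ea ec eq]]|eq]; last first.
    by exists b'; rewrite b'G b'a eqxx b'c.
  suff -> : b' = e by [].
  have [e1 [ne _ _ _]] := dart_edge eG; have [e2 [nb' _ _ _]] := dart_edge b'G.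
  apply: injective_projections; first by rewrite b'a.
  have rc := edge_rank lab ac.
  by apply: (end_uniq (u := a.1) (c := c)) => //; rewrite -?b'a -?ea //;
    [rewrite b'a -ea | exact: (pt_cov_edge lab) | exact: (pt_cov_edge lab)].
have [ca [na aca a2ca caF]] := dart_edge aG; have [cb [nb bcb b2cb cbF]] := dart_edge bG.
rewrite -(KE b cb) // -?ba //; last exact: cov_le.
have <- : K ca = K cb; last first.
  by rewrite (KE a ca) ?porbit_id // cov_le.
apply: (@graph_constant _ _ (pt a.1) F K) => //; last by rewrite -ba.
move=> c r ac cr rF'.
have crF : cov r F by apply: covI; rewrite // rF (cov_rank cr) (edge_rank lab ac).
apply/existsP/existsP => [[b' /and4P[b'G b'a b'c b'q]]|[b' /and4P[b'G /eqP b'a b'r b'q]]].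
  by exists b'; rewrite b'G b'a b'q (le_trans b'c (cov_le cr)).
have [c1 [nb' b'c1 b'2c1 c1F]] := dart_edge b'G.
have [E|nc] := eqVneq c1 c.
  by exists b'; rewrite b'G b'a eqxx b'q -E cov_le.
have c1r : cov c1 r.
  apply: covI; last by rewrite (cov_rank cr) (edge_rank lab ac) (edge_rank lab b'c1).
  rewrite (edge_join lab r nb' b'c1 (cov_le b'2c1)) b'r b'a.
  by rewrite (le_trans (cov_le ac) (cov_le cr)).
have [v [nv _ vc]] := other_end lab ac.
have vG : (a.1, v) \in darts gF.
  by apply: (dart_of (c := c)); rewrite //= (le_trans (cov_le cr)).
have fb' : flag_of b' c1 r by rewrite /flag_of nb' b'c1 b'2c1 c1r.
have fv : flag_of (a.1, v) c r by rewrite /flag_of /= nv ac vc cr.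
exists (a.1, v); rewrite vG eqxx cov_le //=.
have cb' : cov (pt a.1) c1 by rewrite -b'a.
case W : (w (pt a.1) c1 r).
  have sb : step (a.1, v) b'.
    apply/stepP; exists c, c1, r; split=> //.
    by have := w_e (pt_cov a.1) ac cb' cr c1r crF nc; rewrite W /=; case: (w _ _ _).
  by rewrite -(porbit_step a (a.1, v)) (qE sb).
have sb : step b' (a.1, v) by apply/stepP; exists c1, c, r; split; rewrite // ?b'a // eq_sym.
by rewrite -(qE sb) porbit_step.
Qed.

(* The face step from the dart a runs along the boundary of this r. *)
Let left_of a r := [exists c, flag_of a c r && ~~ w (pt a.2) c r].

Let left_ofP a r : reflect (exists2 c, flag_of a c r & w (pt a.2) c r = false) (left_of a r).
Proof.
by apply: (iffP existsP) => [[c /andP[f /negbTE wF]]|[c f wF]]; exists c; rewrite ?f ?wF.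
Qed.

Let fs := face_step q.

Let flag_rev a c r : flag_of a c r -> flag_of (a.2, a.1) c r.
Proof. by case/and5P=> n a1 a2 cr rF'; rewrite /flag_of eq_sym n a2 a1 cr. Qed.

Let left_dart a r : left_of a r -> a \in darts gF.
Proof.
case/left_ofP => c /and5P[n a1 a2 cr rF'] _; apply: (dart_of n a1 a2).
exact: le_trans (cov_le cr) (cov_le rF').
Qed.

(** Flipping the edge and then the vertex changes the colour twice, so the next dart has [r] on the
    same side. *)
Let face_step_left a c r : flag_of a c r -> w (pt a.2) c r = false ->
  exists c' v, [/\ fs a = (a.2, v), flag_of (a.2, v) c' r, c' != c & w (pt v) c' r = false].
Proof.
move=> fl wF; have /and5P[n a1 a2 cr rF'] := fl.
have [c' [nc a2c' c'r _]] := cov_other a2 cr.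
have [v [nv _ vc']] := other_end lab a2c'.
have fv : flag_of (a.2, v) c' r by rewrite /flag_of /= nv a2c' vc' c'r.
have sb : step (a.2, a.1) (a.2, v).
  by apply/stepP; exists c, c', r; split=> //; exact: flag_rev.
exists c', v; split=> //; first by rewrite /fs /face_step (qE sb).
rewrite (w_v (pt_cov a.2) (pt_cov v) a2c' vc' c'r rF')
  ?(w_e (pt_cov a.2) a2 a2c' cr c'r rF' nc) ?wF //.
by rewrite (inj_eq pt_inj) eq_sym.
Qed.

Let left_step a r : left_of a r -> left_of (fs a) r.
Proof.
case/left_ofP => c fl wF; have [c' [v [-> fv _ wv]]] := face_step_left fl wF.
by apply/left_ofP; exists c'.
Qed.

Let left_orbit a b r : left_of a r -> b \in orbit fs a -> left_of b r.
Proof.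
move=> al; case/trajectP => i _ ->; elim: i => //= i; exact: left_step.
Qed.

Let left_ex a : a \in darts gF -> exists r, left_of a r.
Proof.
move=> /dart_edge[c [n ac bc cF]].
have [r [r' [nr cr cr' rF' r'F]]] := edge_facets (edge_rank lab ac) cF.
case E: (w (pt a.2) c r); last first.
  by exists r; apply/left_ofP; exists c; rewrite // /flag_of n ac bc cr.
exists r'; apply/left_ofP; exists c; first by rewrite /flag_of n ac bc cr'.
by rewrite (w_r (pt_cov _) bc cr cr') // E.
Qed.

Let left_uniq a r r' : left_of a r -> left_of a r' -> r = r'.
Proof.
case/left_ofP => c /and5P[n a1 a2 cr rF'] wF.
case/left_ofP => c' /and5P[_ a1' a2' c'r' r'F] w'F.
have cc : c' = c by apply: edge_uniq n _ _ _ _.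
subst c'; apply/eqP; rewrite eq_sym; apply: contraT => nr.
by have := w_r (pt_cov a.2) a2 cr c'r' rF' r'F nr; rewrite wF w'F.
Qed.

Let facet_left r : cov r F -> exists a, left_of a r.
Proof.
move=> rF'; have rr : rank r = 3 by move: rF; rewrite (cov_rank rF') => -[].
have [x bx xr] : exists2 x, cov bot x & x <= r.
  by apply: ex_cov; apply: ltn_rank_le; rewrite ?bot_le // rr (rank_bot lab).
have [u uE] := pt_surj bx; subst x.
have ur : pt u < r by apply: ltn_rank_le; rewrite // rr (rank_pt lab).
have [c uc cr'] := ex_cov ur.
have cr : cov c r by apply: covI; rewrite // rr (edge_rank lab uc).
have [c' [nc uc' c'r _]] := cov_other uc cr.
wlog wF : c c' uc {cr'} cr nc uc' c'r / w (pt u) c r = false => [wl|].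
  case E: (w (pt u) c r); last exact: (wl c c').
  by apply: (wl c' c); rewrite // 1?eq_sym // (w_e (pt_cov u) uc uc' cr c'r rF' nc) E.
have [v [nv _ vc]] := other_end lab uc.
exists (v, u); apply/left_ofP; exists c => //.
by rewrite /flag_of /= eq_sym nv vc uc cr.
Qed.

(** The set of heads reached by the orbit of [a] is closed under adjacency in the connected graph of
    [r], so it contains the head of [b]; the colour then determines the dart from its head. *)
Let left_orbit_trans a b r : left_of a r -> left_of b r -> b \in orbit fs a.
Proof.
move=> al bl; have /left_ofP[c0 fa wa] := al; have /left_ofP[cb fb wb] := bl.
have /and5P[nb b1 b2 cbr rF'] := fb; have /and5P[na a1 a2 c0r _] := fa.
pose K z := [exists e in orbit fs a, pt e.2 <= z].
have Kpt u : K (pt u) = [exists e in orbit fs a, e.2 == u].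
  by apply: eq_existsb => e; rewrite (pt_le lab).
have Kb : K (pt b.2).
  have <- : K (pt a.2) = K (pt b.2).
    apply: (graph_constant (x := bot) (y := r)) => //.
    - move=> x c /pt_surj[u <-] uc cr'; rewrite Kpt.
      have cr : cov c r.
        apply: covI; rewrite // (edge_rank lab uc).
        by move: rF; rewrite (cov_rank rF') => -[].
      apply/exists_inP/exists_inP => [[e eo /eqP eu]|[e eo ec]].
        by exists e; rewrite // eu cov_le.
      have [eu|nu] := eqVneq e.2 u; first by exists e; rewrite // eu.
      have /left_ofP[ce fe we] := left_orbit al eo.
      have /and5P[ne e1 e2 cer _] := fe.
      have e2c := pt_cov_edge lab ec (edge_rank lab uc).
      have [cE|nc] := eqVneq c ce.
        exists (finv fs e); first by rewrite -(orbit_step q) f_finv //; exact: face_step_inj.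
        have fo : finv fs e \in darts gF.
          apply: (@left_dart _ r); apply: left_orbit al _.
          by rewrite -(orbit_step q) f_finv //; exact: face_step_inj.
        rewrite -(face_step_tail q_rotation fo) -/fs f_finv; last exact: face_step_inj.
        apply/eqP; apply: (end_uniq (u := e.2) (c := ce)) => //; first by rewrite eq_sym.
        by rewrite -cE.
      have [c' [v [fsE fv nc' wv]]] := face_step_left fe we.
      have /and5P[nv e2c' vc' c'r _] := fv.
      have cc : c' = c by apply: (third_edge (r := r) e2).
      exists (fs e); first by rewrite orbit_step.
      rewrite fsE /=; apply/eqP; apply: (end_uniq (u := e.2) (c := c)) => //.
      by rewrite -cc.
    - exact: le_trans (cov_le a2) (cov_le c0r).
    - exact: le_trans (cov_le b2) (cov_le cbr).
  by rewrite Kpt; apply/exists_inP; exists a; rewrite // -fconnect_orbit connect0.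
move: Kb; rewrite Kpt => /exists_inP[e eo /eqP eb].
have /left_ofP[ce fe we] := left_orbit al eo; have /and5P[ne e1 e2 cer _] := fe.
suff -> : b = e by [].
rewrite eb in e2 we.
have cc : ce = cb.
  apply/eqP; apply: contraT => nc.
  by have := w_e (pt_cov b.2) b2 e2 cbr cer rF' nc; rewrite wb we.
subst ce; apply: injective_projections; last by rewrite eb.
apply: (end_uniq (u := b.2) (c := cb)) => //; first by rewrite eq_sym.
by rewrite -eb eq_sym.
Qed.

(** [left_of] induces a bijection between the regions and the coatoms of [F]. *)
Let card_regions : fcard (face_step q) (darts gF) = #|[set r | cov r F]|.
Proof.
rewrite -card_face_roots.
pose f a := odflt bot [pick r | left_of a r].
have fE a r : left_of a r -> f a = r.
  move=> al; rewrite /f; case: pickP => [r' al'|/(_ r)]; last by rewrite al.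
  exact: left_uniq al' al.
have fsym := fconnect_sym (@face_step_inj _ q).
rewrite -(card_in_imset (_ : {in face_roots gF q &, injective f})).
  apply: eq_card => r; rewrite inE; apply/imsetP/idP => [[a]|rF'].
    rewrite [_ \in face_roots _ _]inE => /andP[/left_ex[r' al] _] ->; rewrite (fE _ _ al).
    by case/left_ofP: al => c /and5P[].
  have [a al] := facet_left rF'; exists (froot fs a).
    by apply: root_face_roots; rewrite ?q_rotation //; exact: left_dart al.
  by apply/esym/fE; apply: left_orbit al _; rewrite -fconnect_orbit connect_root.
move=> a b; rewrite [a \in _]inE [b \in _]inE => /andP[aG /eqP ra] /andP[bG /eqP rb].
have [r al] := left_ex aG; have [r' bl] := left_ex bG.
rewrite (fE _ _ al) (fE _ _ bl) => rr'; subst r'.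
have := left_orbit_trans al bl; rewrite -fconnect_orbit -(root_connect fsym).
by rewrite ra rb => /eqP.
Qed.

Let q_planar : planar_embedding gF q.
Proof. by rewrite /planar_embedding q_rotation card_regions euler_gr eqxx. Qed.

Lemma planar_gr_of_colouring : planar gF.
Proof. by apply/existsP; exists q. Qed.

End Rotation.

Lemma planar_gr : planar gF.
Proof.
have [w [w_r w_e w_v]] := flag_colouring (bot_le F) rk.
exact: planar_gr_of_colouring w_r w_e w_v.
Qed.

(** [is_2face] admits every planar embedding [q], so both directions are proved for an arbitrary
    one. The embedding built from the colouring only provides existence. *)
Lemma is_2face_gr H : reflect (exists2 R, cov R F & H = gr pt R) (is_2face gF H).
Proof.
have face_all q : planar_embedding gF q ->
    (forall R, cov R F -> exists2 a, a \in darts gF & region_boundary q a = gr pt R) /\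
    (forall a, a \in darts gF -> exists2 R, cov R F & region_boundary q a = gr pt R).
  case/andP=> rotq /eqP euler.
  have kF : k_connected 3 gF by apply: (k_connected_gr lab).
  have one R : cov R F -> exists2 a, a \in darts gF & region_boundary q a = gr pt R.
    move=> RF; have rR : rank R = 3 by move: rF; rewrite (cov_rank RF) => -[].
    rewrite -(induced_gr lab (cov_le RF)).
    have adjR u v : u \in vs pt R -> v \in vs pt R -> adj gF u v = adj (gr pt R) u v.
      rewrite !in_vs => uR vR; apply/(adj_grP lab)/(adj_grP lab) => -[c [uv uc vc cy]];
        exists c; split=> //; last exact: le_trans cy (cov_le RF).
      by rewrite (edge_join lab R uv uc vc) uR.
    apply: (induced_cycle_region sF rotq euler).
    - move=> K Kloc; apply: (gr_connected lab) => u v _ _; exact: Kloc.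
    - by move=> v vF; apply: leq_trans (k_connected_deg sF kF vF).
    - by rewrite (vs_sub lab) cov_le.
    - have [x bx xr] : exists2 x, cov bot x & x <= R.
        by apply: ex_cov; apply: ltn_rank_le; rewrite ?bot_le // rR (rank_bot lab).
      have [u uE] := pt_surj bx; apply/set0Pn; exists u; by rewrite in_vs uE.
    - move=> v vR; rewrite -[RHS](card_polygon_nbrs lab rR vR); apply: eq_card => u; rewrite !inE.
      by case uR: (pt u <= R); rewrite //= adjR // in_vs.
    - move=> K Kloc; apply: (gr_connected lab) => u v uR vR uv.
      by apply: Kloc => //; rewrite adjR.
    - by move=> K Kloc; exact: (gr_complement_connected lab RF rF Kloc).
  split=> // a aG.
  have XB G : G \in [set gr pt R | R in [set R | cov R F]] ->
      exists2 a, a \in darts gF & region_boundary q a = G.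
    by case/imsetP => R; rewrite inE => RF ->; exact: one.
  have /imsetP[R] : region_boundary q a \in [set gr pt R | R in [set R | cov R F]].
    (* Comparing Euler's formula for [q] with [euler_gr] gives as many regions as coatoms. *)
    apply: (region_boundaries_eq rotq XB) => //.
    rewrite card_imset; last exact: (gr_inj lab).
    by rewrite -(leq_add2l #|verts gF|) euler euler_gr.
  by rewrite inE => RF ->; exists R.
apply: (iffP existsP) => [[q /andP[qG /existsP[a /andP[aG /eqP->]]]]|[R RF ->]].
  by have [_ all] := face_all q qG; exact: all.
have /existsP[q qG] := planar_gr; exists q; rewrite qG.
have [one _] := face_all q qG; have [a aG aR] := one R RF.
by apply/existsP; exists a; rewrite aG aR eqxx.
Qed.

End FacetGraph.

(** * Completeness *)

Lemma leq_rank_embedding d d' (P : finPOrderType d) (Q : finPOrderType d') (f : P -> Q) x :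
  {mono f : x y / (x <= y)%O} -> rank x <= rank (f x).
Proof.
move=> fM; have [C [chC leC cardC]] := rank_chain x.
have f_inj : injective f by move=> y z E; apply/le_anti; rewrite -!fM E lexx.
rewrite -ltnS -cardC -(card_imset _ f_inj); apply: leq_card_rank.
  apply/forall_inP => _ /imsetP[y yC ->]; apply/forall_inP => _ /imsetP[z zC ->].
  by rewrite /Order.comparable !fM; have /forall_inP/(_ y yC)/forall_inP/(_ z zC) := chC.
by move=> _ /imsetP[y /leC yx ->]; rewrite fM.
Qed.

Section Isomorphism.
Local Open Scope order_scope.
Context {d d' : Order.disp_t} {P : finPOrderType d} {Q : finPOrderType d'}.
Context {g : P -> Q} {h : Q -> P} (gK : cancel g h) (hK : cancel h g).
Hypothesis gM : {mono g : x y / x <= y}.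

Let hM : {mono h : x y / x <= y}.
Proof. by move=> x y; rewrite -gM !hK. Qed.

Let gL : {mono g : x y / x < y}.
Proof. by move=> x y; rewrite !lt_leAnge !gM. Qed.

Let g_inj : injective g := can_inj gK.

Lemma rank_iso x : rank (g x) = rank x.
Proof.
apply/eqP; rewrite eqn_leq leq_rank_embedding // andbT.
by rewrite -{2}[x]gK leq_rank_embedding.
Qed.

Let card_iso (p : pred Q) : #|[set z | p (g z)]| = #|[set z | p z]|.
Proof.
rewrite -(card_imset _ g_inj); apply: eq_card => y; rewrite inE.
apply/imsetP/idP => [[x]|py]; first by rewrite inE => px ->.
by exists (h y); rewrite ?inE hK.
Qed.

(** The algorithm tests the poset of the solution, so the property of the given lattice has to be
    carried over to it. *)
Lemma ic_eulerian_lattice5_iso : ic_eulerian_lattice5 Q -> ic_eulerian_lattice5 P.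
Proof.
case/and5P=> lat gr eu ic len; apply/and5P; split.
- apply/forallP => x; apply/forallP => y.
  have /forallP/(_ (g x))/forallP/(_ (g y))
    /andP[/existsP[j /forallP jP] /existsP[m /forallP mP]] := lat.
  apply/andP; split; apply/existsP.
    by exists (h j); apply/forallP => z; rewrite -gM hK (eqP (jP _)) !gM.
  by exists (h m); apply/forallP => z; rewrite -gM hK (eqP (mP _)) !gM.
- apply/forallP => x; apply/forallP => y; apply/implyP => /andP[xy /forallP no].
  have /forallP/(_ (g x))/forallP/(_ (g y)) := gr; rewrite !rank_iso => /implyP; apply.
  by rewrite /covers gL xy; apply/forallP => z; have := no (h z); rewrite -!gL hK.
- apply/forallP => x; apply/forallP => y; apply/implyP => xy.
  have /forallP/(_ (g x))/forallP/(_ (g y)) := eu; rewrite gL xy /= -!card_iso.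
  by under [in X in #|pred_of_set X| == _]eq_finset => z do rewrite !gM rank_iso;
     under [in X in _ == #|pred_of_set X|]eq_finset => z do rewrite !gM rank_iso.
- apply/forallP => x; apply/forallP => y; apply/implyP => xy.
  have /forallP/(_ (g x))/forallP/(_ (g y)) := ic; rewrite gM !rank_iso xy /=.
  move=> /connected_onP-/(_ (fun a b => comparable_sym b a)) constK.
  apply/connected_onP => [a b|K Kloc u v]; first exact: comparable_sym.
  rewrite !inE => xu xv; rewrite -[u]gK -[v]gK.
  apply: (constK (K \o h)) => [a b||]; rewrite ?inE ?gL // => xa xb ab /=.
  apply: Kloc; rewrite ?inE -?gL ?hK //.
  by move: ab; rewrite /Order.comparable !hM.
- rewrite -(eqP len) /poset_length; apply/eqP.
  rewrite [RHS](reindex g) /=; last by apply: onW_bij; exists h.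
  by apply: eq_bigr => x _; rewrite rank_iso.
Qed.

End Isomorphism.

(** * The feasible solution read off from a lattice *)

Section LatticeSolution.
Local Open Scope order_scope.
Context {d : Order.disp_t} {L : eulerianLattice d} {T : finType} (pt : T -> L) (bot top : L).
Hypothesis lab : atom_labelling pt bot.
Hypotheses (le_top : forall x, x <= top) (rank_top : rank top = 5).
Implicit Types (x y z c r f : L) (t u v : T) (H F R : graph T).

Let bot_le x : bot <= x. Proof. by case: lab => ->. Qed.
Let pt_cov t : cov bot (pt t). Proof. by case: lab => _ ->. Qed.
Let pt_surj x : cov bot x -> exists t, pt t = x. Proof. by case: lab => _ _ _; apply. Qed.

Notation G := (gr pt top).
Notation facets := [set gr pt f | f in [set f : L | rank f == 4]].
Notation ridges := [set gr pt r | r in [set r : L | rank r == 3]].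

Definition lattice_solution : solution T := (G, (facets, ridges)).

Lemma gr_bot : gr pt bot = empty_graph.
Proof.
congr (_, _); first by apply/setP => t; rewrite in_vs inE lt_geF // cov_lt.
apply/setP => e; rewrite inE; apply/negP => /(edges_grP pt)[c [rc cb _]].
by move: (leq_rank cb); rewrite rc (rank_bot lab).
Qed.

Lemma gr_pt t : gr pt (pt t) = vertex_graph t.
Proof.
congr (_, _); first by apply/setP => u; rewrite in_vs inE (pt_le lab).
apply/setP => e; rewrite inE; apply/negP => /(edges_grP pt)[c [rc cb _]].
by move: (leq_rank cb); rewrite rc (rank_pt lab).
Qed.

Lemma gr_edge c : rank c = 2 -> gr pt c = edge_graph (vs pt c).
Proof.
move=> rc; congr (_, _); apply/setP => e; rewrite inE.
apply/(edges_grP pt)/eqP => [[c' [rc' c'c ->]]|->]; last by exists c.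
by rewrite (eq_rank_le c'c) // rc.
Qed.

Lemma rank_le1P x : (rank x <= 1)%N -> x = bot \/ exists t, x = pt t.
Proof.
move=> rx; have [->|nx] := eqVneq x bot; first by left.
have bx : bot < x by rewrite lt_neqAle eq_sym nx bot_le.
have cx : cov bot x.
  apply: covI; rewrite // (rank_bot lab); have := ltn_rank bx; rewrite (rank_bot lab).
  by case: (rank x) rx => [|[]].
by right; have [t <-] := pt_surj cx; exists t.
Qed.

Lemma is_face_gr f m : rank f = 4 -> m <= f -> (rank m <= 3)%N -> is_face (gr pt f) (gr pt m).
Proof.
move=> rf mf; rewrite leq_eqVlt => /predU1P[rm|].
  apply/or4P/Or44/(is_2face_gr lab rf); exists m => //.
  by apply: covI; rewrite // rf rm.
rewrite ltnS leq_eqVlt => /predU1P[rm|].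
  apply/or4P/Or43/exists_inP; exists (vs pt m); last by rewrite gr_edge.
  by rewrite (vs_in_edges lab).
rewrite ltnS => /rank_le1P[mE|[t mE]].
  by apply/or4P/Or41; rewrite mE gr_bot.
apply/or4P/Or42/exists_inP; exists t; last by rewrite mE gr_pt.
by rewrite in_vs -mE.
Qed.

(** The existence of meets is what makes the intersection of two facets a common face. *)
Lemma intersection_gr x y : intersection (gr pt x) (gr pt y) = gr pt (mt x y).
Proof.
congr (_, _); first by apply/setP => t; rewrite inE !in_vs le_mt.
apply/setP => e; rewrite inE; apply/andP/(edges_grP pt) => [[/(edges_grP pt)[c [rc cx ->]]]|].
  by rewrite (vs_in_edges lab) // => cy; exists c; rewrite le_mt cx cy.
by case=> c [rc]; rewrite le_mt => /andP[cx cy] ->; rewrite !(vs_in_edges lab) ?cx.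
Qed.

Let card_gr (p : pred (graph T)) (B : {set L}) :
  #|[set H in [set gr pt z | z in B] | p H]| = #|[set z in B | p (gr pt z)]|.
Proof.
rewrite -(card_imset _ (gr_inj lab)); apply: eq_card => H; rewrite inE.
apply/andP/imsetP => [[/imsetP[z zB ->] pz]|[z]]; first by exists z; rewrite // inE zB.
by rewrite inE => /andP[zB pz] ->; rewrite imset_f.
Qed.

Lemma facet_potential f : rank f = 4 -> gr pt f \in potential_facets G.
Proof.
move=> rf; rewrite inE; apply/existsP; exists (vs pt f).
rewrite (vs_sub lab) le_top (induced_gr lab (le_top f)) eqxx /=.
rewrite (planar_gr lab rf); exact: (k_connected_gr lab).
Qed.

Lemma ridge_potential r : rank r = 3 -> gr pt r \in potential_ridges G.
Proof.
move=> rr; have rt : r < top by apply: ltn_rank_le; rewrite // rr rank_top.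
have [f rf _] := ex_cov rt; have f4 : rank f = 4 by rewrite (cov_rank rf) rr.
rewrite inE; apply/existsP; exists (gr pt f); rewrite facet_potential //=.
by apply/(is_2face_gr lab f4); exists r.
Qed.

Let sum_facets (p : pred (graph T)) :
  (\sum_(F in potential_facets G | p F) (F \in facets)%:R
    = #|[set f | (rank f == 4)%N && p (gr pt f)]|%:R :> int)%R.
Proof.
rewrite sum_mem_int card_gr; congr (_%:R)%R; apply: eq_card => f.
rewrite [LHS]inE [RHS]inE [f \in _]inE.
by case: eqP => //= rf; rewrite facet_potential.
Qed.

Let sum_ridges (p : pred (graph T)) :
  (\sum_(R in potential_ridges G | p R) (R \in ridges)%:R
    = #|[set r | (rank r == 3)%N && p (gr pt r)]|%:R :> int)%R.
Proof.
rewrite sum_mem_int card_gr; congr (_%:R)%R; apply: eq_card => r.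
rewrite [LHS]inE [RHS]inE [r \in _]inE.
by case: eqP => //= rr; rewrite ridge_potential.
Qed.

Let facets_of_ridge r : rank r = 3 ->
  #|[set f | (rank f == 4) && is_2face (gr pt f) (gr pt r)]| = 2.
Proof.
move=> rr; rewrite -[RHS](card_lev2 (le_top r)); last by rewrite rr rank_top.
apply: eq_card => f; rewrite inE; apply/andP/levP => [[/eqP rf]|[rf _ f4]].
  case/(is_2face_gr lab rf) => r' r'f /(gr_inj lab) rr'; subst r'.
  by rewrite cov_le // rf rr.
have f4' : rank f = 4 by rewrite f4 rr.
split; first by rewrite f4'.
by apply/(is_2face_gr lab f4'); exists r; rewrite // covI // f4 addn1.
Qed.

Let card_above x k :
  #|lev x top (rank x + k)| = #|[set z | (rank z == rank x + k)%N && (x <= z)]|.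
Proof. by apply: eq_card => z; rewrite !inE le_top andbC. Qed.

Lemma lattice_feasible :
  feasible (Posz #|[set r : L | rank r == 3]|) (Posz #|[set f : L | rank f == 4]|)
    G (facets, ridges).
Proof.
have all_pred (A : {set graph T}) (y : graph T -> int) :
    (\sum_(F in A) y F = \sum_(F in A | true) y F)%R.
  by apply: eq_bigl => F; rewrite andbT.
apply/and5P; split.
- by apply/subsetP => H /imsetP[f + ->]; rewrite inE => /eqP; exact: facet_potential.
- by apply/subsetP => H /imsetP[r + ->]; rewrite inE => /eqP; exact: ridge_potential.
- rewrite all_pred (sum_facets xpredT) natz; apply/eqP; congr Posz.
  by apply: eq_card => f; rewrite !inE andbT.
- rewrite all_pred (sum_ridges xpredT) natz; apply/eqP; congr Posz.
  by apply: eq_card => f; rewrite !inE andbT.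
apply/and5P; split.
- apply/forall_inP => R RG; rewrite (sum_facets (fun F => is_2face F R)) subr_eq0.
  case: (boolP (R \in ridges)) => [/imsetP[r]|nR].
    by rewrite inE => /eqP rr ->; rewrite facets_of_ridge.
  (* The 2-faces of a selected facet are graphs of elements of rank 3, hence selected; so no
     selected facet contains an unselected ridge. *)
  rewrite mulr0 (_ : [set f | _] = set0) ?cards0 //; apply/setP => f; rewrite !inE.
  apply/negP => /andP[/eqP rf /(is_2face_gr lab rf)[r rf' RE]].
  move/negP: nR; apply; rewrite RE imset_f // inE.
  by move: rf; rewrite (cov_rank rf') => -[->].
- apply/forall_inP => v _.
  rewrite (sum_facets (fun F => v \in verts F)) (sum_ridges (fun F => v \in verts F)).
  have rk : rank top = rank (pt v) + 4 by rewrite rank_top (rank_pt lab).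
  have := card_lev4 (le_top (pt v)) rk; rewrite !card_above (rank_pt lab) (deg_gr lab).
  have -> : #|[set z | (rank z == 1 + 1) && (pt v <= z)]|
      = #|[set c | cov (pt v) c && (c <= top)]|.
    apply: eq_card => c; rewrite !inE le_top andbT /cov (rank_pt lab) andbC.
    apply/andP/andP => -[]; last by move/ltW.
    by move=> vc /eqP rc; rewrite rc; split=> //; apply: ltn_rank_le; rewrite // rc (rank_pt lab).
  under [X in _ = (#|pred_of_set X| + _)%N -> _]eq_finset => z do rewrite -in_vs.
  under [X in (_ + #|pred_of_set X|)%N = _ -> _]eq_finset => z do rewrite -in_vs.
  rewrite !natz /verts; clear.
  move: #|_| #|_| #|_| => a b c E; apply/eqP; move: E; lia.
- apply/forall_inP => _ /(edges_grP pt)[c [rc _ ->]].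
  rewrite (sum_facets (fun F => vs pt c \in edges F)) (sum_ridges (fun F => vs pt c \in edges F)).
  rewrite !natz; apply/eqP; congr Posz.
  under eq_finset => z do rewrite (vs_in_edges lab z rc).
  under [in RHS]eq_finset => z do rewrite (vs_in_edges lab z rc).
  have E : rank top = rank c + 3 by rewrite rc rank_top.
  by have := card_lev3 (le_top c) E; rewrite !card_above rc.
- apply/forall_inP => _ /(edges_grP pt)[c [rc _ ->]].
  rewrite (sum_ridges (fun F => vs pt c \in edges F)) natz ltz_nat.
  have ct : c < top by apply: ltn_rank_le; rewrite // rc rank_top.
  have [r cr _] := ex_cov ct; apply/card_gt0P; exists r.
  by rewrite inE (vs_in_edges lab) // cov_le // (cov_rank cr) rc.
apply/forall_inP => F FG; apply/forall_inP => F' F'G; apply/implyP => /andP[nFF'].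
(* The bound 1 can only fail when both facets are selected, and then their intersection is
   proper. *)
case: (boolP (F \in facets)) => [/imsetP[f]|_]; last by case: (F' \in _).
rewrite inE => /eqP rf FE.
case: (boolP (F' \in facets)) => [/imsetP[f']|_]; last by [].
rewrite inE => /eqP rf' F'E; case/negP.
have nff' : f != f' by apply: contra nFF' => /eqP ff'; rewrite FE F'E ff'.
have := lexx (mt f f'); rewrite le_mt => /andP[mf mf'].
have m3 : (rank (mt f f') <= 3)%N.
  rewrite -ltnS -rf; apply: ltn_rank; rewrite lt_neqAle mf andbT.
  apply: contra nff' => /eqP mE; apply/eqP/eq_rank_le; first by rewrite -{1}mE.
  by rewrite rf rf'.
by rewrite /proper_intersection FE F'E intersection_gr !is_face_gr.
Qed.

(** The maximal element of a solution poset is the adjoined [None], so [top] is not sent to its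
    graph. *)
Definition lattice_cell x : cell T := if x == top then None else Some (gr pt x).

Lemma lattice_cell_le x y : cell_le (lattice_cell x) (lattice_cell y) = (x <= y).
Proof.
rewrite /lattice_cell; have [->|ny] := eqVneq y top; first by case: ifP; rewrite le_top.
have [->|nx] := eqVneq x top; last by rewrite /= (subgraph_gr lab).
by apply/esym/negP => ty; move: ny; rewrite eq_le le_top ty.
Qed.

Lemma lattice_is_cell x : is_cell lattice_solution (lattice_cell x).
Proof.
rewrite /lattice_cell; have [//|nx] := eqVneq x top.
have : (rank x < 5)%N by rewrite -rank_top; apply: ltn_rank; rewrite lt_neqAle nx le_top.
rewrite ltnS leq_eqVlt => /predU1P[rx|].
  by apply/or4P/Or44; rewrite [X in _ || X]imset_f ?orbT // inE rx.
rewrite ltnS leq_eqVlt => /predU1P[rx|].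
  by apply/or4P/Or44; rewrite [X in X || _]imset_f // inE rx.
rewrite ltnS leq_eqVlt => /predU1P[rx|].
  apply/or4P/Or43/exists_inP; exists (vs pt x); last by rewrite gr_edge.
  by rewrite (vs_in_edges lab).
rewrite ltnS => /rank_le1P[mE|[t mE]]; first by apply/or4P/Or41; rewrite mE gr_bot.
apply/or4P/Or42/exists_inP; exists t; last by rewrite mE gr_pt.
by rewrite in_vs le_top.
Qed.

Lemma lattice_cell_surj a : is_cell lattice_solution a -> exists x, lattice_cell x = a.
Proof.
have below x : (rank x < 5)%N -> lattice_cell x = Some (gr pt x).
  move=> rx; rewrite /lattice_cell ifN //; apply: contraTneq rx => ->.
  by rewrite rank_top.
case: a => [H|_]; last by exists top; rewrite /lattice_cell eqxx.
case/or4P => [/eqP->|/exists_inP[t _ /eqP->]|/exists_inP[e]|/orP[]/imsetP[x]].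
- by exists bot; rewrite below ?gr_bot // (rank_bot lab).
- by exists (pt t); rewrite below ?gr_pt // (rank_pt lab).
- case/(edges_grP pt) => c [rc _ ->] /eqP->.
  by exists c; rewrite below ?gr_edge // rc.
- by rewrite inE => /eqP rx ->; exists x; rewrite below // rx.
- by rewrite inE => /eqP rx ->; exists x; rewrite below // rx.
Qed.

Lemma lattice_solution_isomorphic : exists (g : solution_poset lattice_solution -> L) h,
  [/\ cancel g h, cancel h g & {mono g : x y / x <= y}].
Proof.
pose h x : solution_poset lattice_solution :=
  exist (fun a => is_true (is_cell lattice_solution a)) _ (lattice_is_cell x).
have [g gK] : exists g, forall a, h (g a) = a.
  apply: (@fin_all_exists _ _ (fun a x => h x = a)) => a.
  by have [x xa] := lattice_cell_surj (valP a); exists x; apply: val_inj.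
have hM x y : (h x <= h y) = (x <= y) by rewrite -lattice_cell_le.
have hg x : g (h x) = x by apply/le_anti; rewrite -!hM gK lexx.
by exists g, h; split=> // a b; rewrite -hM !gK.
Qed.

End LatticeSolution.

(** * Labellings and the choice of a representative graph *)

Section Completeness.
Local Open Scope order_scope.
Context {d : Order.disp_t} {L : eulerianLattice d}.

(** An element of least rank equals its meet with any other element. *)
Lemma ex_bottom (x0 : L) : exists b : L, forall x, b <= x.
Proof.
case: (@arg_minnP _ x0 xpredT (@rank _ L) isT) => b _ min_b; exists b => x.
have := lexx (mt b x); rewrite le_mt => /andP[mb mx].
suff <- : mt b x = b by [].
by apply: (eq_rank_le mb); apply/eqP; rewrite eqn_leq (leq_rank mb); exact: min_b.
Qed.

Lemma ex_top (x0 : L) : exists2 t : L, forall x, x <= t & rank t = poset_length L.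
Proof.
case: (@arg_maxnP _ x0 xpredT (@rank _ L) isT) => t _ max_t; exists t.
  move=> x; have := lexx (jn t x); rewrite jn_le => /andP[tj xj].
  suff -> : t = jn t x by [].
  by apply: (eq_rank_le tj); apply/eqP; rewrite eqn_leq (leq_rank tj); exact: max_t.
apply/eqP; rewrite eqn_leq leq_bigmax /=; apply/bigmax_leqP => x _; exact: max_t.
Qed.

Lemma ex_labelling (T : finType) (bot : L) : (forall x, bot <= x) ->
  #|[set x : L | rank x == 1]| = #|T| -> exists pt : T -> L, atom_labelling pt bot.
Proof.
move=> bot_le cardT.
have rb : rank bot = 0.
  apply/eqP; rewrite -leqn0 leqNgt; apply/negP => rb.
  have [C [_ Cbot cardC]] := rank_chain bot.
  have : (#|C| <= #|[set bot]|)%N.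
    by apply: subset_leq_card; apply/subsetP => x /Cbot xb; rewrite inE eq_le xb bot_le.
  by rewrite cardC cards1 ltnS leqNgt rb.
pose A := [set x : L | rank x == 1].
have covE x : cov bot x = (x \in A).
  rewrite inE; apply/idP/eqP => [/cov_rank->|rx]; first by rewrite rb.
  by rewrite covI // rx rb.
exists (fun t => enum_val (cast_ord (esym cardT) (enum_rank t))); split=> //.
- by move=> t; rewrite covE enum_valP.
- by move=> t u /enum_val_inj/cast_ord_inj/enum_rank_inj.
move=> x; rewrite covE => xA.
exists (enum_val (cast_ord cardT (enum_rank_in xA x))).
by rewrite enum_valK cast_ordK enum_rankK_in.
Qed.

(** Relabelling turns an isomorphism with the listed representative into an equality of graphs. *)
Lemma atom_labelling_perm (T : finType) (pt : T -> L) (bot : L) (s : {perm T}) :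
  atom_labelling pt bot -> atom_labelling (pt \o s^-1%g) bot.
Proof.
case=> bot_le pt_cov pt_inj pt_surj; split=> //.
- by move=> t; exact: pt_cov.
- by apply: inj_comp => //; exact: perm_inj.
by move=> x /pt_surj[t <-]; exists (s t); rewrite /= permK.
Qed.

Lemma gr_perm (T : finType) (pt : T -> L) (s : {perm T}) (z : L) :
  gr (pt \o s^-1%g) z = (s @: verts (gr pt z), [set s @: (e : {set T}) | e in edges (gr pt z)]).
Proof.
have vsE c : vs (pt \o s^-1%g) c = s @: vs pt c.
  apply/setP => t; rewrite in_vs; apply/idP/imsetP => [tc|[u]].
    by exists (s^-1%g t); rewrite ?in_vs ?permKV.
  by rewrite in_vs => uc ->; rewrite /= permK.
rewrite /gr /verts /edges vsE /=; congr (_, _).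
by rewrite -imset_comp; apply: eq_imset => c; rewrite /= vsE.
Qed.

Lemma input_graph_gr (T : finType) (pt : T -> L) (bot top : L) (f0 f1 : int) :
  atom_labelling pt bot -> (forall x, x <= top) -> rank top = 5 ->
  Posz #|[set x : L | rank x == 1]| = f0 -> Posz #|[set x : L | rank x == 2]| = f1 ->
  input_graph f0 f1 (gr pt top).
Proof.
move=> lab le_top rt F0 F1; have bot_le : forall x, bot <= x by case: lab.
apply/and4P; split.
- exact: (simple_gr lab).
- apply/eqP; rewrite -F0 (card_vs lab); congr Posz; apply: eq_card => x.
  rewrite !inE le_top andbT /cov (rank_bot lab); apply/andP/eqP => [[_ /eqP//]|rx].
  by rewrite rx ltn_rank_le // (rank_bot lab) rx.
- apply/eqP; rewrite -F1 card_imset; last exact: (vs_inj lab).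
  by congr Posz; apply: eq_card => x; rewrite !inE le_top.
- exact: (k_connected_gr lab).
Qed.

End Completeness.

Theorem proposition3p2 (f0 f1 f2 f3 : int) (out : seq (solution 'I_(absz f0)))
    (run : find_lattices f0 f1 f2 f3 out) :
  (forall s, s \in out ->
     ic_eulerian_lattice5 (solution_poset s) /\
     has_fvector (solution_poset s) f0 f1 f2 f3) /\
  (forall (d : Order.disp_t) (L : finPOrderType d),
     ic_eulerian_lattice5 L -> has_fvector L f0 f1 f2 f3 ->
     exists2 s, s \in out & isomorphic (solution_poset s) L).
Proof.
have [gs [gs_input _ gs_all] outE] := run; split=> [s|d P icP [F0 F1 F2 F3]].
  rewrite outE mem_filter => /andP[ic_s /allpairsPdep[G [[X Y] [Ggs xyF sE]]]].
  (* The lattice property is guaranteed by the filter of the algorithm; the f-vector is not tested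
     there. *)
  split=> //; subst s; apply: output_fvector => //; first exact: gs_input.
  by move: xyF; rewrite mem_enum.
have /and5P[lat gr_ eu ic /eqP len] := icP.
pose L := EulerianLattice lat gr_ eu ic.
(* Length 5 excludes the empty poset, for which the maximum of the ranks is 0. *)
have x0 : L.
  case: (pickP (fun x : L => true)) => [x //|none]; suff : poset_length P = 0 by rewrite len.
  by rewrite /poset_length big_pred0.
have [bot bot_le] := ex_bottom x0.
have [top le_top] := ex_top x0; rewrite [poset_length _]len => rank_top.
have cardT : #|[set x : L | rank x == 1]| = #|'I_(absz f0)|.
  by rewrite card_ord -F0 absz_nat.
have [pt0 lab0] := ex_labelling bot_le cardT.
(* The list contains only some graph [H] isomorphic to that of the initial labelling; the
   isomorphism [s] corrects the labelling. *)
have [H Hgs /existsP[s /andP[/eqP Hv /eqP He]]] :=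
  gs_all _ (input_graph_gr lab0 le_top rank_top F0 F1).
have lab := atom_labelling_perm s lab0; set pt := pt0 \o _ in lab.
have HE : gr pt top = H by rewrite gr_perm Hv He; case: (H).
have [g [h [gK hK gM]]] := lattice_solution_isomorphic lab le_top rank_top.
exists (lattice_solution pt top); last by exists g => //; exists h.
rewrite outE mem_filter (ic_eulerian_lattice5_iso gK hK gM icP) /=.
apply/allpairsPdep; exists H, (lattice_solution pt top).2; rewrite -HE; split=> //.
  by rewrite HE.
by rewrite mem_enum -F2 -F3; apply: (lattice_feasible lab).
Qed.
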